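(* If $f\in L^2_+(\mathbb{T})$, then there exists a global weak solution $u:\mathbb{R}\to L^2_+(\mathbb{T})$ of the initial value problem $$u_\tau=i\partial_x\mathbf{P}\left[u^*\partial_x^{-1}(u^2)\right],\qquad \mathbf{P}[u]=u,\qquad u(0)=f,$$ with $u\in L^\infty(\mathbb{R};L^2_+(\mathbb{T}))$ and $u_\tau\in L^\infty(\mathbb{R};H^{-1}_+(\mathbb{T}))$.
   Context: Functions are complex-valued and $2\pi$-periodic in $x\in\mathbb{T}=\mathbb{R}/2\pi\mathbb{Z}$, $\tau$ is time, $^*$ denotes complex conjugation, and $\hat f(n)=\frac{1}{2\pi}\int_{\mathbb{T}}f(x)e^{-inx}\,dx$. The projection onto positive wavenumbers is $\mathbf{P}[f](x)=\sum_{n=1}^\infty\hat f(n)e^{inx}$. The inverse derivative acts on zero-mean functions by $\partial_x^{-1}(e^{inx})=\frac1{in}e^{inx}$, $n\ne0$. For $1\le p\le\infty$, $$L^p_+(\mathbb{T})=\{f\in L^p(\mathbb{T}):\hat f(n)=0\text{ for }n\le0\},\qquad W^{1,p}_+(\mathbb{T})=\{f\in L^p_+(\mathbb{T}):f_x\in L^p_+(\mathbb{T})\}.$$ For $s\in\mathbb{R}$, $H^s_+(\mathbb{T})$ is the space of periodic distributions $f=\sum_{n=1}^\infty\hat f(n)e^{inx}$ with $\|f\|_s=\big(\sum_{n\ge1}n^{2s}|\hat f(n)|^2\big)^{1/2}<\infty$. Definition of weak solution: a function $u:\mathbb{R}\to L^2_+(\mathbb{T})$ is a weak solution of $u_\tau=i\partial_x\mathbf{P}[u^*\partial_x^{-1}(u^2)]$,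 $\mathbf{P}[u]=u$, if $$\frac{d}{d\tau}\int_{\mathbb{T}}\phi^*u\,dx=-i\int_{\mathbb{T}}\phi_x^*\,u^*\partial_x^{-1}(u^2)\,dx$$ for every $\phi\in W^{1,p}_+(\mathbb{T})$ with $p>2$, in the sense of distributions in $\mathcal{D}'(\mathbb{R})$ with respect to $\tau$. (For $u\in L^2_+$, one has $u^2\in L^1_+$, $\partial_x^{-1}(u^2)\in L^\infty$ and $u^*\partial_x^{-1}(u^2)\in L^2$, so the right-hand side makes sense.) The initial condition $u(0)=f$ is understood in the sense of $u$ being continuous in $\tau$ with values in $H^{-s}_+(\mathbb{T})$, $0<s\le1$. *)

(* Defs.v *)
From HB Require Import structures.
From mathcomp Require Import all_boot all_order all_algebra.
From mathcomp Require Import complex.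
From mathcomp Require Import all_classical all_reals all_analysis.
Set Implicit Arguments.
Unset Strict Implicit.
Unset Printing Implicit Defensive.

Import Order.TTheory GRing.Theory Num.Theory.
Import numFieldNormedType.Exports.

Local Open Scope classical_set_scope.
Local Open Scope ring_scope.

Section ComplexIntegration.
Context {R : realType}.
Local Notation C := R[i].
Local Notation leb := (@lebesgue_measure R).

Definition cmod (z : C) : R := ComplexField.Normc.normc z.

Definition cmeasurable (f : R -> C) : Prop :=
  measurable_fun [set: R] (fun x => complex.Re (f x)) /\
  measurable_fun [set: R] (fun x => complex.Im (f x)).

Definition cint (D : set R) (f : R -> C) : C :=
  Complex (Rintegral leb D (fun x => complex.Re (f x)))
          (Rintegral leb D (fun x => complex.Im (f x))).

Definition clocally_integrable (a : R -> C) : Prop :=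
  locally_integrable [set: R] (fun t => complex.Re (a t)) /\
  locally_integrable [set: R] (fun t => complex.Im (a t)).

Definition smooth (g : R -> R) : Prop :=
  forall k x, derivable (derive1n k g) x 1.

Definition test_function (g : R -> R) : Prop :=
  smooth g /\ exists r : R, forall t, r < `|t| -> g t = 0.

(* d a / dt = b in D'(R), both sides being regular distributions. Real test
   functions suffice since distributions are complex-linear. *)
Definition distr_derivative (a b : R -> C) : Prop :=
  [/\ clocally_integrable a, clocally_integrable b &
    forall g : R -> R, test_function g ->
      cint [set: R] (fun t => a t * (derive1 g t)%:C%C) =
      - cint [set: R] (fun t => b t * (g t)%:C%C)].

End ComplexIntegration.

(* A function on T = R / 2 pi Z is a 2 pi-periodic function on R; integrals
   over T are taken over one period. Elements of L^p(T) are given by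
   representatives. *)
Section Torus.
Context {R : realType}.
Local Notation C := R[i].
Local Notation leb := (@lebesgue_measure R).

Definition torus : set R := [set` `[0, pi *+ 2]%R].

Lemma measurable_torus : measurable torus.
Proof. exact: measurable_itv. Qed.

Definition torus_measure : {measure set (measurableTypeR R) -> \bar R} :=
  mrestr leb measurable_torus.

Definition Lp_norm (p : \bar R) (f : R -> C) : \bar R :=
  Lnorm torus_measure p (fun x => (cmod (f x))%:E).

Definition Lp (p : \bar R) (f : R -> C) : Prop :=
  [/\ periodic f (pi *+ 2), cmeasurable f & (Lp_norm p f < +oo)%E].

Definition cis (x : R) : C := Complex (cos x) (sin x).

Definition fourier (f : R -> C) (n : int) : C :=
  ((pi *+ 2)^-1)%:C%C * cint torus (fun x => f x * cis (- (n%:~R * x))).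

Definition Lp_plus (p : \bar R) (f : R -> C) : Prop :=
  Lp p f /\ forall n : int, n <= 0 -> fourier f n = 0.

(* f_x = g in D'(T). *)
Definition torus_derivative (f g : R -> C) : Prop :=
  forall h : R -> R, smooth h -> periodic h (pi *+ 2) ->
    cint torus (fun x => f x * (derive1 h x)%:C%C) =
    - cint torus (fun x => g x * (h x)%:C%C).

(* f belongs to W^{1,p}_+(T), with f_x = g. *)
Definition W1p_plus (p : \bar R) (f g : R -> C) : Prop :=
  [/\ Lp_plus p f, Lp_plus p g & torus_derivative f g].

(* g = d_x^{-1} h for zero-mean h; this determines g almost everywhere. *)
Definition inverse_derivative (h g : R -> C) : Prop :=
  [/\ Lp 1%E h, fourier h 0 = 0, Lp 1%E g, fourier g 0 = 0 &
    forall n : int, n != 0 ->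
      fourier g n = (Complex 0 n%:~R)^-1 * fourier h n].

(* Unknown u : time -> space -> C; w t is d_x^{-1} (u t)^2. The condition
   P[u] = u is u t \in L^2_+, and p = +oo is allowed for the test functions. *)
Definition weak_solution (u : R -> R -> C) : Prop :=
  (forall t, Lp_plus 2%:E (u t)) /\
  exists2 w : R -> R -> C,
    (forall t, inverse_derivative (fun x => u t x ^+ 2) (w t)) &
    forall (p : \bar R) (phi phi_x : R -> C),
      (2%:E < p)%E -> W1p_plus p phi phi_x ->
      distr_derivative
        (fun t => cint torus (fun x => ((phi x)^*)%C * u t x))
        (fun t => - Complex 0 1 *
           cint torus (fun x => ((phi_x x)^*)%C * (((u t x)^*)%C * w t x))).

(* A periodic distribution is identified with the family of its Fourier
   coefficients; finiteness of the norm forces the polynomial growth that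
   characterizes such families. *)
Definition Hs_norm (s : R) (c : int -> C) : \bar R :=
  ((\sum_(1 <= n <oo) (n%:R `^ (2 * s) * cmod (c n%:Z) ^+ 2)%:E) `^ 2^-1)%E.

Definition Hs_plus (s : R) (c : int -> C) : Prop :=
  (forall n : int, n <= 0 -> c n = 0) /\ (Hs_norm s c < +oo)%E.

Definition continuous_Hs_plus (s : R) (c : R -> int -> C) : Prop :=
  (forall t, Hs_plus s (c t)) /\
  forall t0, Hs_norm s (c t - c t0) @[t --> t0] --> 0%E.

(* c_t = v in D'(R; H^s_+): Bochner integrals in H^s_+ are computed
   coefficientwise, as the coefficients are continuous linear functionals. *)
Definition Hs_time_derivative (c v : R -> int -> C) : Prop :=
  forall n : int, distr_derivative (fun t => c t n) (fun t => v t n).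

End Torus.

(* Bochner L^oo(R; X), for X the subspace E of V with norm N. *)
Section BochnerLinfty.
Context {R : realType} {V : zmodType}.
Variables (E : V -> Prop) (N : V -> \bar R).
Local Notation leb := (@lebesgue_measure R).

Definition simple_valued (s : R -> V) : Prop :=
  [/\ forall t, E (s t), finite_set (range s) &
    forall v, measurable (s @^-1` [set v])].

Definition strongly_measurable (u : R -> V) : Prop :=
  exists2 s : nat -> R -> V, (forall k, simple_valued (s k)) &
    \forall t \ae leb, N (u t - s k t) @[k --> \oo] --> 0%E.

Definition Linfty (u : R -> V) : Prop :=
  [/\ forall t, E (u t), strongly_measurable u &
    exists M : R, \forall t \ae leb, (N (u t) <= M%:E)%E].

End BochnerLinfty.

(* Main.v *)
Require Import Defs.
From HB Require Import structures.
From mathcomp Require Import all_boot all_order all_algebra.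
From mathcomp Require Import complex.
From mathcomp Require Import all_classical all_reals all_analysis.
From mathcomp Require Import measurable_realfun.
From mathcomp Require Import ring lra zify.
Set Implicit Arguments.
Unset Strict Implicit.
Unset Printing Implicit Defensive.
Import Order.TTheory GRing.Theory Num.Theory.
Import numFieldNormedType.Exports.
Local Open Scope classical_set_scope.
Local Open Scope ring_scope.

(** The equation is solved mode by mode. Write [c n] for the Fourier coefficients
of [u], with [n >= 1], let [sqcoef c] be the coefficients of [u ^+ 2], and let
[cubic_inf c n] be the sum over [l] of [(c l)^* sqcoef c (n + l) / (n + l)].
The equation becomes the infinite system [c' n = i n cubic_inf c n]. Two
features of this system give a global solution. Its truncations to finitely
many modes conserve the square sum of [c], because pairing the truncated
system with [c] and symmetrizing the weight [n / (n + l)] in its two indices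
leaves [i / 2] times the real number [\sum_m |sqcoef c m| ^+ 2]. And each
component [cubic_inf c n] is weakly continuous on balls of l2: the bound
[|sqcoef c m| <= \sum_j |c j| ^+ 2] and the summability of [l ^- 2] make its
tails uniformly small ([cubic_unif]), so that it passes to limits taken
coordinate by coordinate.

Existence ([ode_exists]) is therefore a compactness argument. The system cut
to [N] modes is discretized by Euler steps so short that the energy, which one
step changes only to second order, grows by at most 1 on the time interval
from [- N] to [N] ([euler_bounded]). The polygons converge at every time and
in every coordinate along an ultrafilter on the natural numbers, and a
discrete Taylor estimate uniform in the discretization ([euler_taylor]) shows
that the limit is differentiable and solves the system. Its coordinates are
Lipschitz in time.

To return to functions, coefficients in l2 are realized by the theorem of
Riesz and Fischer ([hardy_exists]), and uniqueness of Fourier coefficients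
([fourier_unique]) identifies the initial value almost everywhere. The
antiderivative of [u ^+ 2] has an absolutely convergent Fourier series by the
inequality of Hilbert ([sqcoef_hilbert]); being bounded, it makes the
nonlinearity square integrable, with coefficients [- i cubic_inf c n]
([fourier_nonlinearity]). Hence [cubic_inf c] is in l2 with a bound uniform in
time, which is the bound on the time derivative in H^(-1).

In the weak formulation both sides are limits of finite sums over modes, for
which the identity is the system itself; the sums are bounded uniformly in
time, and dominated convergence passes to the limit ([weak_formulation]).
Continuity in negative Sobolev norms and strong measurability only use that
the paths are bounded in l2 and uniformly continuous in time coordinate by
coordinate ([continuous_Hs_of_coords], [sample_cvg]). *)

(** * Modulus and limits of complex numbers *)

Section ComplexModulus.
Context {R : realType}.
Local Notation C := R[i].
Implicit Types z w : C.

Lemma cmod_ge0 z : 0 <= cmod z.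
Proof. by rewrite /cmod; case: z => a b /=; exact: sqrtr_ge0. Qed.

Lemma cmod0 : cmod (0 : C) = 0.
Proof. exact: Normc.normc0. Qed.

Lemma cmod1 : cmod (1 : C) = 1.
Proof. exact: Normc.normc1. Qed.

Lemma cmodM z w : cmod (z * w) = cmod z * cmod w.
Proof. exact: Normc.normcM. Qed.

Lemma cmodN z : cmod (- z) = cmod z.
Proof. exact: (@normcN R z). Qed.

Lemma cmodB z w : cmod (z - w) = cmod (w - z).
Proof. by rewrite -cmodN opprB. Qed.

Lemma ler_cmodD z w : cmod (z + w) <= cmod z + cmod w.
Proof. exact: (@le_normcD R z w). Qed.

Lemma ler_cmodB z w : cmod (z - w) <= cmod z + cmod w.
Proof. by rewrite (le_trans (ler_cmodD _ _)) ?cmodN. Qed.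

Lemma cmodV z : cmod z^-1 = (cmod z)^-1.
Proof. exact: Normc.normcV. Qed.

Lemma sqr_cmod z : cmod z ^+ 2 = complex.Re z ^+ 2 + complex.Im z ^+ 2.
Proof. by case: z => a b; rewrite /cmod /= sqr_sqrtr // addr_ge0 ?sqr_ge0. Qed.

Lemma cmod_conj z : cmod z^*%C = cmod z.
Proof. by case: z => a b; rewrite /cmod /= sqrrN. Qed.

Lemma cmod_real (x : R) : cmod x%:C%C = `|x|.
Proof. by rewrite /cmod /= expr0n addr0 sqrtr_sqr. Qed.

Lemma cmod_imag (x : R) : cmod (Complex 0 x) = `|x|.
Proof. by rewrite /cmod /= expr0n /= add0r sqrtr_sqr. Qed.

Lemma cmod_nat n : cmod (n%:R : C) = n%:R.
Proof. by rewrite -(rmorph_nat (real_complex R)) cmod_real normr_nat. Qed.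

Lemma ler_Re_cmod z : `|complex.Re z| <= cmod z.
Proof.
rewrite -(@ler_pXn2r _ 2) ?nnegrE ?cmod_ge0 // real_normK ?num_real // sqr_cmod.
by rewrite lerDl sqr_ge0.
Qed.

Lemma ler_Im_cmod z : `|complex.Im z| <= cmod z.
Proof.
rewrite -(@ler_pXn2r _ 2) ?nnegrE ?cmod_ge0 // real_normK ?num_real // sqr_cmod.
by rewrite lerDr sqr_ge0.
Qed.

Lemma cmod_le_ReIm z : cmod z <= `|complex.Re z| + `|complex.Im z|.
Proof.
rewrite -(@ler_pXn2r _ 2) ?nnegrE ?cmod_ge0 ?addr_ge0 // sqr_cmod.
by rewrite sqrrD !real_normK ?num_real // addrAC lerDl mulrn_wge0 ?mulr_ge0.
Qed.

Lemma ler_cmod_sum (I : Type) (r : seq I) (P : pred I) (F : I -> C) :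
  cmod (\sum_(i <- r | P i) F i) <= \sum_(i <- r | P i) cmod (F i).
Proof.
apply: (big_ind2 (fun z x => cmod z <= x)); rewrite ?cmod0 //.
by move=> z x w y zx wy; rewrite (le_trans (ler_cmodD _ _)) ?lerD.
Qed.

Lemma mulCconj z : z * z^*%C = (cmod z ^+ 2)%:C%C.
Proof.
rewrite sqr_cmod; case: z => a b /=; rewrite /real_complex_def /=.
by apply/eqP; rewrite eq_complex /=; apply/andP; split; apply/eqP; ring.
Qed.

Lemma sqr_cmodD z w :
  cmod (z + w) ^+ 2 = cmod z ^+ 2 + 2 * complex.Re (w * z^*%C) + cmod w ^+ 2.
Proof. by rewrite !sqr_cmod; case: z => a b; case: w => c d /=; ring. Qed.

Lemma sqr_cmodD_le z w : cmod (z + w) ^+ 2 <= 2 * (cmod z ^+ 2 + cmod w ^+ 2).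
Proof.
rewrite !sqr_cmod; case: z => a b; case: w => c d /=.
by have := sqr_ge0 (a - c); have := sqr_ge0 (b - d); lra.
Qed.

Lemma ler_dist_cmod z w : `|cmod z - cmod w| <= cmod (z - w).
Proof.
rewrite ler_norml; apply/andP; split.
  by have := ler_cmodD (w - z) z; rewrite subrK cmodB; lra.
by have := ler_cmodD (z - w) w; rewrite subrK; lra.
Qed.

Lemma ReD z w : complex.Re (z + w) = complex.Re z + complex.Re w.
Proof. by case: z; case: w. Qed.
Lemma ImD z w : complex.Im (z + w) = complex.Im z + complex.Im w.
Proof. by case: z; case: w. Qed.
Lemma ReN z : complex.Re (- z) = - complex.Re z.
Proof. by case: z. Qed.
Lemma ImN z : complex.Im (- z) = - complex.Im z.
Proof. by case: z. Qed.
Lemma ReM z w : complex.Re (z * w) =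
  complex.Re z * complex.Re w - complex.Im z * complex.Im w.
Proof. by case: z; case: w. Qed.
Lemma ImM z w : complex.Im (z * w) =
  complex.Re z * complex.Im w + complex.Im z * complex.Re w.
Proof. by case: z => a b; case: w => c d /=; ring. Qed.
Lemma Re_conj z : complex.Re z^*%C = complex.Re z.
Proof. by case: z. Qed.
Lemma Im_conj z : complex.Im z^*%C = - complex.Im z.
Proof. by case: z. Qed.
Lemma Re_sum (I : Type) (r : seq I) (P : pred I) (F : I -> C) :
  complex.Re (\sum_(i <- r | P i) F i) = \sum_(i <- r | P i) complex.Re (F i).
Proof. by apply: (big_morph (@complex.Re R)) => // x y; exact: ReD. Qed.

Lemma conjM z w : (z * w)^*%C = z^*%C * w^*%C.
Proof. exact: rmorphM. Qed.
Lemma conj_sum (I : Type) (r : seq I) (F : I -> C) :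
  (\sum_(i <- r) F i)^*%C = \sum_(i <- r) (F i)^*%C.
Proof. exact: rmorph_sum. Qed.

Lemma real_complexM (x y : R) : (x * y)%:C%C = x%:C%C * y%:C%C.
Proof. exact: rmorphM. Qed.
Lemma real_complex_sum (I : Type) (r : seq I) (F : I -> R) :
  (\sum_(i <- r) F i)%:C%C = \sum_(i <- r) (F i)%:C%C.
Proof. exact: rmorph_sum. Qed.

Lemma complexP z w :
  complex.Re z = complex.Re w -> complex.Im z = complex.Im w -> z = w.
Proof. by case: z => a b; case: w => c d /= -> ->. Qed.

End ComplexModulus.

Section ComplexLimits.
Context {R : realType}.
Local Notation C := R[i].

(** Componentwise, as are measurability and the integral, so that limit theorems
    for real functions apply to each part. *)
Definition ccvg {T : Type} (F : set_system T) (z : T -> C) (l : C) : Prop :=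
  (complex.Re (z t) @[t --> F] --> complex.Re l) /\
  (complex.Im (z t) @[t --> F] --> complex.Im l).

Section Filter.
Context {T : Type} {F : set_system T} {FF : Filter F}.
Implicit Types (z w : T -> C) (l m : C).

Lemma ccvgP z l :
  ccvg F z l <-> forall e : R, 0 < e -> \forall t \near F, cmod (z t - l) <= e.
Proof.
split=> [[zr zi] e e0|zl].
  have e20 : 0 < e / 2 by rewrite divr_gt0.
  move/cvgrPdist_le : zr => /(_ _ e20) zr; move/cvgrPdist_le : zi => /(_ _ e20) zi.
  near=> t; apply: (le_trans (cmod_le_ReIm _)).
  rewrite ReD ImD ReN ImN distrC [X in _ + X]distrC [e]splitr lerD //.
    by near: t.
  by near: t.
split; apply/cvgrPdist_le => e e0; near=> t; rewrite distrC.
  rewrite -ReN -ReD (le_trans (ler_Re_cmod _)) //.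
  by near: t; exact: zl.
rewrite -ImN -ImD (le_trans (ler_Im_cmod _)) //.
by near: t; exact: zl.
Unshelve. all: by end_near. Qed.

Lemma ccvg_cst l : ccvg F (fun=> l) l.
Proof. by split; exact: cvg_cst. Qed.

Lemma ccvgD z w l m : ccvg F z l -> ccvg F w m -> ccvg F (fun t => z t + w t) (l + m).
Proof.
move=> [zr zi] [wr wi]; split; [rewrite ReD|rewrite ImD].
  under eq_fun do rewrite ReD; exact: cvgD.
under eq_fun do rewrite ImD; exact: cvgD.
Qed.

Lemma ccvgM z w l m : ccvg F z l -> ccvg F w m -> ccvg F (fun t => z t * w t) (l * m).
Proof.
move=> [zr zi] [wr wi]; split; [rewrite ReM|rewrite ImM].
  under eq_fun do rewrite ReM; apply: cvgB; exact: cvgM.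
under eq_fun do rewrite ImM; apply: cvgD; exact: cvgM.
Qed.

Lemma ccvg_conj z l : ccvg F z l -> ccvg F (fun t => (z t)^*%C) l^*%C.
Proof.
move=> [zr zi]; split; [rewrite Re_conj|rewrite Im_conj].
  by under eq_fun do rewrite Re_conj.
by under eq_fun do rewrite Im_conj; exact: cvgN.
Qed.

Lemma ccvgN z l : ccvg F z l -> ccvg F (fun t => - z t) (- l).
Proof.
move=> zl; have := ccvgM (ccvg_cst (-1)) zl; rewrite mulN1r.
by under eq_fun do rewrite mulN1r.
Qed.

Lemma ccvgB z w l m : ccvg F z l -> ccvg F w m -> ccvg F (fun t => z t - w t) (l - m).
Proof. by move=> zl wm; apply: ccvgD zl _; exact: ccvgN. Qed.

Lemma ccvgMl c z l : ccvg F z l -> ccvg F (fun t => c * z t) (c * l).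
Proof. by move=> zl; exact: (ccvgM (ccvg_cst c) zl). Qed.

Lemma ccvg_sum (I : Type) (r : seq I) (z : I -> T -> C) (l : I -> C) :
  (forall i, ccvg F (z i) (l i)) ->
  ccvg F (fun t => \sum_(i <- r) z i t) (\sum_(i <- r) l i).
Proof.
move=> zl; elim: r => [|i r ih].
  by rewrite big_nil; under [X in ccvg _ X _]eq_fun do rewrite big_nil; exact: ccvg_cst.
rewrite big_cons; under [X in ccvg _ X _]eq_fun do rewrite big_cons.
exact: ccvgD.
Qed.

Lemma ccvg_cmod z l : ccvg F z l -> cmod (z t) @[t --> F] --> cmod l.
Proof.
move=> /ccvgP zl; apply/cvgrPdist_le => e e0.
near=> t; rewrite distrC (le_trans (ler_dist_cmod _ _)) //.
by near: t; exact: zl.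
Unshelve. all: by end_near. Qed.

Lemma near_eq_ccvg z w l : (\forall t \near F, z t = w t) -> ccvg F w l -> ccvg F z l.
Proof.
move=> zw /ccvgP wl; apply/ccvgP => e e0; near=> t.
by rewrite (_ : z t = w t); near: t => //; exact: wl.
Unshelve. all: by end_near. Qed.

End Filter.

Section ProperFilter.
Context {T : Type} {F : set_system T} {FF : ProperFilter F}.
Implicit Types (z : T -> C) (l m : C).

Lemma ccvg_unique z l m : ccvg F z l -> ccvg F z m -> l = m.
Proof.
move=> [zr zi] [zr' zi']; apply: complexP.
  exact: (cvg_unique (@Rhausdorff R) zr zr').
exact: (cvg_unique (@Rhausdorff R) zi zi').
Qed.

Lemma ccvg_cmod_le z l (b : R) :
  ccvg F z l -> (\forall t \near F, cmod (z t) <= b) -> cmod l <= b.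
Proof.
move=> /ccvg_cmod zl zb; rewrite -(cvg_lim (@Rhausdorff R) zl).
by apply: limr_le => //; apply/cvg_ex; exists (cmod l).
Qed.

End ProperFilter.

(** Bounded closed intervals are compact. Limits along an ultrafilter exist
    simultaneously for all bounded families, which replaces the extraction of
    diagonal subsequences. *)
Lemma ultra_ccvg {T : Type} (U : set_system T) (z : T -> C) (b : R) :
  UltraFilter U -> (\forall t \near U, cmod (z t) <= b) -> exists l, ccvg U z l.
Proof.
move=> UU zb.
have PU : ProperFilter U := @ultra_proper _ _ UU.
have lim_real (x : T -> R) : (\forall t \near U, `|x t| <= b) -> exists l : R, x @ U --> l.
  move=> xb; have [|l [_ cl]] := @segment_compact R (- b) b (x @ U) _.
    by apply: filterS xb => t; rewrite /= in_itv /= -ler_norml.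
  exists l => B nB; have [//|UB] := in_ultra_setVsetC (x @^-1` B) UU.
  by have [y [/= yB By]] := cl (~` B) B UB nB; exfalso.
have [lr zr] : exists l : R, complex.Re (z t) @[t --> U] --> l.
  by apply: lim_real; apply: filterS zb => t; apply: le_trans (ler_Re_cmod _).
have [li zi] : exists l : R, complex.Im (z t) @[t --> U] --> l.
  by apply: lim_real; apply: filterS zb => t; apply: le_trans (ler_Im_cmod _).
by exists (Complex lr li).
Qed.

(** A limit exists along some ultrafilter because the sequence is bounded, and
    the Cauchy property brings the whole sequence to it. *)
Lemma cauchy_ccvg (z : nat -> C) :
  (forall e : R, 0 < e -> exists N, forall n, (N <= n)%N -> cmod (z n - z N) <= e) ->
  exists l, ccvg \oo z l.
Proof.
move=> zC; have [U [UU oU]] := ultraFilterLemma (@eventually_filter).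
have PU : ProperFilter U := @ultra_proper _ _ UU.
have [N0 zN0] := zC 1 ltr01.
have [l zl] : exists l, ccvg U z l.
  apply: (@ultra_ccvg _ _ _ (1 + cmod (z N0))) => //; apply: oU.
  exists N0 => // n /= /zN0 h; rewrite -[z n](subrK (z N0)).
  by rewrite (le_trans (ler_cmodD _ _)) ?lerD2r.
exists l; apply/ccvgP => e e0.
have [N zN] := zC (e / 2) (divr_gt0 e0 (ltr0n _ 2)).
have zNl : cmod (l - z N) <= e / 2.
  apply: (@ccvg_cmod_le _ U _ (fun n => z n - z N)).
    by apply: ccvgB => //; exact: ccvg_cst.
  by apply: oU; exists N.
exists N => // n /= /zN h.
rewrite (_ : z n - l = (z n - z N) - (l - z N)); last by rewrite opprB addrA subrK.
by rewrite (le_trans (ler_cmodB _ _)) // [leRHS]splitr lerD.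
Qed.

End ComplexLimits.

(** * Summation inequalities *)

Section RealSums.
Context {R : realType}.

Lemma cauchy_schwarz_sum (I : Type) (r : seq I) (P : pred I) (x y : I -> R) :
  (\sum_(i <- r | P i) x i * y i) ^+ 2 <=
  (\sum_(i <- r | P i) x i ^+ 2) * (\sum_(i <- r | P i) y i ^+ 2).
Proof.
suff : [/\ 0 <= \sum_(i <- r | P i) x i ^+ 2, 0 <= \sum_(i <- r | P i) y i ^+ 2 &
  (\sum_(i <- r | P i) x i * y i) ^+ 2 <=
  (\sum_(i <- r | P i) x i ^+ 2) * (\sum_(i <- r | P i) y i ^+ 2)] by case.
elim: r => [|i r]; first by rewrite !big_nil expr0n mul0r.
rewrite !big_cons; case: (P i) => //.
set A := \sum_(j <- r | P j) x j ^+ 2; set B := \sum_(j <- r | P j) y j ^+ 2.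
set S := \sum_(j <- r | P j) x j * y j => -[A0 B0 SAB].
split; [by rewrite addr_ge0 ?sqr_ge0|by rewrite addr_ge0 ?sqr_ge0|].
have : 2 * S * (x i * y i) <= A * y i ^+ 2 + B * x i ^+ 2.
  apply: (le_trans (ler_norm _)).
  have AB0 : 0 <= A * y i ^+ 2 + B * x i ^+ 2 by rewrite addr_ge0 // mulr_ge0 ?sqr_ge0.
  rewrite -(@ler_pXn2r _ 2) ?nnegrE // real_normK ?num_real //.
  have := ler_wpM2r (sqr_ge0 (x i * y i)) SAB.
  by have := sqr_ge0 (A * y i ^+ 2 - B * x i ^+ 2); nra.
nra.
Qed.

Lemma ler_sum_nat_const (n : nat) (F : nat -> R) (c : R) :
  (forall i, (i < n)%N -> F i <= c) -> \sum_(i < n) F i <= n%:R * c.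
Proof.
move=> Fc; have -> : n%:R * c = \sum_(i < n) c.
  by rewrite sumr_const card_ord mulr_natl.
by apply: ler_sum => i _; exact: Fc.
Qed.

Lemma exists_nat_ge (x : R) : exists2 n, (0 < n)%N & x <= n%:R.
Proof.
exists (Num.truncn `|x|).+1 => //; apply: (le_trans (ler_norm x)).
by rewrite ltW // truncnS_gt.
Qed.

(** Telescoping: [l ^- 2 <= 2 / l - 2 / l.+1] for [l >= 1]. *)
Lemma sum_inv_sqr (m n : nat) : (0 < m)%N -> (m <= n)%N ->
  \sum_(m <= l < n) (l%:R ^- 2 : R) <= 2 / m%:R.
Proof.
move=> m0 /subnKC <-; set k := (n - m)%N.
suff : \sum_(m <= l < m + k) (l%:R ^- 2 : R) <= 2 / m%:R - 2 / (m + k)%:R.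
  by move/le_trans; apply; rewrite lerBlDr lerDl divr_ge0.
elim: k => [|k ih]; first by rewrite addn0 big_geq // subrr.
rewrite addnS big_nat_recr /= ?leq_addr //.
have k0 : 0 < (m + k)%:R :> R by rewrite ltr0n addn_gt0 m0.
have k1 : 1 <= (m + k)%:R :> R by rewrite ler1n addn_gt0 m0.
move: ih; rewrite -[(m + k).+1%:R]natr1; set x := (m + k)%:R in k0 k1 *.
suff : x ^- 2 <= 2 / x - 2 / (x + 1) by lra.
have x10 : 0 < x + 1 by lra.
rewrite -subr_ge0.
have -> : 2 / x - 2 / (x + 1) - x ^- 2 = (x - 1) / (x ^+ 2 * (x + 1)).
  by field; do ?[apply/andP; split]; rewrite ?gt_eqF //; lra.
by rewrite divr_ge0 ?subr_ge0 // mulr_ge0 ?sqr_ge0 // ltW.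
Qed.

(** Telescoping: with [s k = sqrt k / (sqrt j + sqrt k)] each term is at most [4
    * (s k.+1 - s k)], and [s <= 1]. These are the weighted row sums of the
    Hilbert matrix. *)
Lemma schur_weight (j K : nat) : (0 < j)%N ->
  \sum_(k < K) (Num.sqrt j%:R / (Num.sqrt k.+1%:R * (j + k.+1)%:R) : R) <= 4.
Proof.
move=> j0; pose s (k : nat) : R := Num.sqrt k%:R / (Num.sqrt j%:R + Num.sqrt k%:R).
have p0 : 0 < Num.sqrt j%:R :> R by rewrite sqrtr_gt0 ltr0n.
suff : \sum_(k < K) (Num.sqrt j%:R / (Num.sqrt k.+1%:R * (j + k.+1)%:R) : R) <= 4 * s K.
  move/le_trans; apply; rewrite ger_pMr // /s ler_pdivrMr ?mul1r ?lerDr ?sqrtr_ge0//.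
  by rewrite ltr_wpDr ?sqrtr_ge0.
elim: K => [|k ih].
  by rewrite big_ord0 /s sqrtr0 mul0r mulr0.
rewrite big_ord_recr /=.
suff : Num.sqrt j%:R / (Num.sqrt k.+1%:R * (j + k.+1)%:R) <= 4 * (s k.+1 - s k) by lra.
rewrite /s; set p := Num.sqrt j%:R in p0 *; set y := Num.sqrt k.+1%:R.
set z := Num.sqrt k%:R.
have y0 : 0 < y by rewrite sqrtr_gt0 ltr0n.
have z0 : 0 <= z by rewrite sqrtr_ge0.
have yz : y ^+ 2 - z ^+ 2 = 1 by rewrite !sqr_sqrtr ?ler0n // -natr1 addrC addKr.
have -> : (j + k.+1)%:R = p ^+ 2 + y ^+ 2 :> R by rewrite !sqr_sqrtr ?ler0n // natrD.
have -> : 4 * (y / (p + y) - z / (p + z)) = 4 * p * (y - z) / ((p + y) * (p + z)).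
  by field; apply/andP; split; rewrite gt_eqF //; lra.
have zy : z <= y by rewrite ler_wsqrtr // ler_nat.
rewrite ler_pdivrMr; last by rewrite mulr_gt0 // addr_gt0 ?exprn_gt0.
rewrite mulrAC ler_pdivlMr; last by rewrite mulr_gt0 //; lra.
have -> : 4 * p * (y - z) * (y * (p ^+ 2 + y ^+ 2)) =
   p * (4 * ((y - z) * y) * (p ^+ 2 + y ^+ 2)) by ring.
rewrite ler_pM2l //.
have h1 : 1 <= 2 * ((y - z) * y).
  have : (y - z) * (y + z) <= (y - z) * (2 * y) by rewrite ler_wpM2l //; lra.
  by rewrite -yz; lra.
have h2 : (p + y) * (p + z) <= 2 * (p ^+ 2 + y ^+ 2).
  have : (p + y) * (p + z) <= (p + y) * (p + y) by rewrite ler_pM2l //; lra.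
  by have := sqr_ge0 (p - y); lra.
have h3 : 0 <= p ^+ 2 + y ^+ 2 by rewrite addr_ge0 ?sqr_ge0.
have := ler_wpM2r h3 h1; lra.
Qed.

(** Schur's test: the square of [sqrt j * x j - sqrt k * x k] bounds each term
    by half the sum of [x j ^+ 2] with weight [sqrt (j / k)] and [x k ^+ 2] with
    the inverse weight, both divided by [j + k]; the sums of these weights are
    those of [schur_weight]. *)
Lemma hilbert_inequality (x : nat -> R) (E : R) (K : nat) :
  (forall j, 0 <= x j) -> (forall n, \sum_(j < n) x j ^+ 2 <= E) ->
  \sum_(j < K) \sum_(k < K) x j.+1 * x k.+1 / (j.+1 + k.+1)%:R <= 4 * E.
Proof.
move=> x0 xE.
pose w (j k : nat) : R := Num.sqrt j.+1%:R / (Num.sqrt k.+1%:R * (j.+1 + k.+1)%:R).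
have xwE : \sum_(j < K) x j.+1 ^+ 2 * \sum_(k < K) w j k <= 4 * E.
  apply: (@le_trans _ _ (\sum_(j < K) x j.+1 ^+ 2 * 4)).
    by apply: ler_sum => j _; rewrite ler_wpM2l ?sqr_ge0 //; exact: schur_weight.
  rewrite -mulr_suml mulrC ler_wpM2l //; apply: le_trans (xE K.+1).
  by rewrite [leRHS]big_ord_recl /= lerDr sqr_ge0.
have : \sum_(j < K) \sum_(k < K) x j.+1 * x k.+1 / (j.+1 + k.+1)%:R <=
    2^-1 * (\sum_(j < K) x j.+1 ^+ 2 * (\sum_(k < K) w j k) +
            \sum_(k < K) x k.+1 ^+ 2 * (\sum_(j < K) w k j)).
  under [X in _ + X]eq_bigr do rewrite mulr_sumr.
  under [X in X + _]eq_bigr do rewrite mulr_sumr.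
  rewrite [X in _ + X]exchange_big /= -big_split /= mulr_sumr.
  apply: ler_sum => j _; rewrite -big_split /= mulr_sumr; apply: ler_sum => k _.
  rewrite /w [(k.+1 + j.+1)%N]addnC.
  set p := Num.sqrt j.+1%:R; set q := Num.sqrt k.+1%:R; set s := (j.+1 + k.+1)%:R.
  have p0 : 0 < p by rewrite sqrtr_gt0 ltr0n.
  have q0 : 0 < q by rewrite sqrtr_gt0 ltr0n.
  have s0 : 0 < s by rewrite ltr0n.
  rewrite -subr_ge0.
  have -> : 2^-1 * (x j.+1 ^+ 2 * (p / (q * s)) + x k.+1 ^+ 2 * (q / (p * s))) -
     x j.+1 * x k.+1 / s = (p * x j.+1 - q * x k.+1) ^+ 2 / (2 * (p * q * s)).
    by field; rewrite !gt_eqF.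
  by rewrite divr_ge0 ?sqr_ge0 // mulr_ge0 // !mulr_ge0 // ltW.
move/le_trans; apply; lra.
Qed.

(** The antidiagonals [j + k = m] with [m < K] are disjoint subsets of the
    square. *)
Lemma triangle_sum_le (f : nat -> nat -> R) (K : nat) : (forall j k, 0 <= f j k) ->
  \sum_(m < K) \sum_(j < m.+1) f j (m - j)%N <= \sum_(j < K) \sum_(k < K) f j k.
Proof.
move=> f0.
have -> : \sum_(m < K) \sum_(j < m.+1) f j (m - j)%N =
    \sum_(m < K) \sum_(j < K | (j <= m)%N) f j (m - j)%N.
  apply: eq_bigr => m _.
  by rewrite (big_ord_widen K (fun j => f j (m - j)%N)) ?ltn_ord.
rewrite (exchange_big_dep predT) //=; apply: ler_sum => j _.
rewrite -(big_mkord (fun m => (j <= m)%N) (fun m => f j (m - j)%N)).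
rewrite -(big_mkord predT (fun k => f j k)).
rewrite -[X in \sum_(0 <= m < K | (_ <= _)%N) X m]/(fun m => _).
have -> : \sum_(0 <= i < K | (j <= i)%N) f j (i - j)%N = \sum_(j <= i < K) f j (i - j)%N.
  rewrite [RHS]big_nat_cond (big_cat_nat (n := j)) //=; last exact: ltnW.
  rewrite big_nat_cond big_pred0 ?add0r => [|i]; last first.
    by rewrite ltnNge; case: (j <= i)%N; rewrite ?andbF.
  rewrite big_nat_cond; apply: eq_bigl => i; by case: (j <= i)%N; rewrite ?andbF ?andbT.
rewrite -{1}[val j]add0n big_addn.
under eq_bigr do rewrite addnK.
by rewrite [leRHS](big_cat_nat (n := (K - j)%N)) ?leq_subr //= lerDl sumr_ge0.
Qed.

End RealSums.

(** * The nonlinearity on Fourier coefficients and its conservative Euler scheme *)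

Section CubicNonlinearity.
Context {R : realType}.
Local Notation C := R[i].
Implicit Types (a b : nat -> C) (E : R).

(** The coefficients of [u ^+ 2] for [u] with coefficients [a]. *)
Definition sqcoef a (m : nat) : C := \sum_(j < m.+1) a j * a (m - j)%N.

(** If [u] has coefficients [a] and [w] is the zero-mean antiderivative of [u ^+
    2], the coefficient of wave number [n] of [u^* w] is [- i] times this sum
    with [L] infinite. *)
Definition cubic (L : nat) a (n : nat) : C :=
  \sum_(l < L) (a l)^*%C * sqcoef a (n + l) / (n + l)%:R.

Definition ell2 a E : Prop := forall n, \sum_(j < n) cmod (a j) ^+ 2 <= E.

Lemma ell2_ge0 a E : ell2 a E -> 0 <= E.
Proof. by move=> /(_ 0%N); rewrite big_ord0. Qed.

Lemma ell2_range a E m n : ell2 a E -> \sum_(m <= j < n) cmod (a j) ^+ 2 <= E.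
Proof.
move=> aE; have [nm|mn] := leqP n m; first by rewrite big_geq // (ell2_ge0 aE).
apply: le_trans (aE n); rewrite -(big_mkord predT (fun j => cmod (a j) ^+ 2)).
by rewrite [leRHS](big_cat_nat (n := m)) //= ?(ltnW mn) // lerDr sumr_ge0 // => i _; rewrite sqr_ge0.
Qed.

Lemma ell2_coord a E j : ell2 a E -> cmod (a j) <= Num.sqrt E.
Proof.
move=> aE; rewrite -[leLHS]ger0_norm ?cmod_ge0 // -sqrtr_sqr ler_wsqrtr //.
by have := ell2_range j j.+1 aE; rewrite big_nat1.
Qed.

Lemma sum_rev (V : nmodType) (f : nat -> V) m :
  \sum_(j < m.+1) f (m - j)%N = \sum_(j < m.+1) f j.
Proof.
rewrite [RHS](reindex_inj rev_ord_inj) /=.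
by apply: eq_bigr => j _; rewrite subSS.
Qed.

Lemma sqcoef_le a E m : ell2 a E -> cmod (sqcoef a m) <= E.
Proof.
move=> aE; apply: (le_trans (ler_cmod_sum _ _ _)).
apply: (@le_trans _ _ (\sum_(j < m.+1)
   2^-1 * (cmod (a j) ^+ 2 + cmod (a (m - j)%N) ^+ 2))).
  apply: ler_sum => j _; rewrite cmodM.
  have := sqr_ge0 (cmod (a j) - cmod (a (m - j)%N)); nra.
rewrite -mulr_sumr big_split /= (sum_rev (fun j => cmod (a j) ^+ 2)).
have := aE m.+1; lra.
Qed.

(** This is where the inequality of Hilbert enters: it makes the Fourier series
    of the antiderivative of [u ^+ 2] absolutely convergent for [u] merely in
    L2. *)
Lemma sqcoef_hilbert a E K : a 0%N = 0 -> ell2 a E ->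
  \sum_(m < K) cmod (sqcoef a m) / m%:R <= 4 * E.
Proof.
move=> a0 aE; have xE n : \sum_(j < n) cmod (a j) ^+ 2 <= E := aE n.
pose f j k := cmod (a j) * cmod (a k) / (j + k)%:R.
have f0 j k : 0 <= f j k by rewrite divr_ge0 // mulr_ge0 ?cmod_ge0.
apply: (@le_trans _ _ (\sum_(m < K) \sum_(j < m.+1) f j (m - j)%N)).
  apply: ler_sum => m _; rewrite /f.
  have -> : \sum_(j < m.+1) cmod (a j) * cmod (a (m - j)%N) / (j + (m - j))%:R =
     (\sum_(j < m.+1) cmod (a j) * cmod (a (m - j)%N)) / m%:R.
    rewrite mulr_suml; apply: eq_bigr => j _; rewrite subnKC //.
    by rewrite -ltnS.
  rewrite ler_wpM2r ?invr_ge0 //; apply: (le_trans (ler_cmod_sum _ _ _)).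
  by under eq_bigr do rewrite cmodM.
apply: (le_trans (triangle_sum_le K f0)).
case: K => [|K]; first by rewrite big_ord0 mulr_ge0 // (ell2_ge0 aE).
rewrite big_ord_recl [X in X + _]big1 => [|k _]; last by rewrite /f a0 cmod0 !mul0r.
rewrite add0r.
apply: le_trans (hilbert_inequality (x := fun j => cmod (a j)) K _ xE) => [|j]; last exact: cmod_ge0.
apply: ler_sum => j _; rewrite big_ord_recl.
by rewrite {1}/f /= a0 cmod0 mulr0 mul0r add0r.
Qed.

(** Since [|sqcoef a m| <= E], the tail is at most [E] times the sum of [|a l| /
    l], to which the inequality of Cauchy and Schwarz applies. The bound is
    uniform in [n] and over the ball of l2. *)
Lemma cubic_tail a E n L0 L : ell2 a E -> (0 < L0)%N -> (L0 <= L)%N ->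
  cmod (cubic L a n - cubic L0 a n) <= E * Num.sqrt (E * (2 / L0%:R)).
Proof.
move=> aE L00 L0L; have E0 := ell2_ge0 aE.
have -> : cubic L a n - cubic L0 a n =
   \sum_(L0 <= l < L) (a l)^*%C * sqcoef a (n + l) / (n + l)%:R.
  rewrite /cubic -!(big_mkord xpredT (fun l => (a l)^*%C * sqcoef a (n + l) / (n + l)%:R)).
  by rewrite [X in X - _](big_cat_nat (n := L0)) //= [X in X - _]addrC addrK.
apply: (le_trans (ler_cmod_sum _ _ _)).
apply: (@le_trans _ _ (E * \sum_(L0 <= l < L) cmod (a l) * l%:R^-1)).
  rewrite mulr_sumr big_nat_cond [leRHS]big_nat_cond; apply: ler_sum => l.
  rewrite andbT => /andP[L0l _]; have l0 : (0 < l)%N by exact: leq_trans L0l.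
  rewrite !cmodM cmodV cmod_conj cmod_nat -mulrA mulrCA.
  rewrite ler_pM ?cmod_ge0 ?mulr_ge0 ?cmod_ge0 ?invr_ge0 ?sqcoef_le //.
  rewrite ler_wpM2l ?cmod_ge0 // lef_pV2 ?posrE ?ltr0n ?addn_gt0 ?l0 ?orbT //.
  by rewrite ler_nat leq_addl.
rewrite ler_wpM2l //.
set S := \sum_(L0 <= l < L) _.
have S0 : 0 <= S by apply: sumr_ge0 => l _; rewrite mulr_ge0 ?cmod_ge0 ?invr_ge0.
rewrite -[S]ger0_norm // -sqrtr_sqr ler_wsqrtr //.
apply: (le_trans (cauchy_schwarz_sum _ _ _ _)).
apply: ler_pM; [by apply: sumr_ge0 => l _; rewrite sqr_ge0
  |by apply: sumr_ge0 => l _; rewrite sqr_ge0|exact: ell2_range|].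
under eq_bigr do rewrite exprVn.
exact: sum_inv_sqr.
Qed.

Lemma cubic_le a E n L : a 0%N = 0 -> ell2 a E ->
  cmod (cubic L a n) <= E * Num.sqrt (E * 2).
Proof.
move=> a0 aE; have E0 := ell2_ge0 aE.
case: L => [|L]; first by rewrite /cubic big_ord0 cmod0 mulr_ge0 ?sqrtr_ge0.
have := @cubic_tail a E n 1 L.+1 aE isT isT; rewrite divr1.
by rewrite {2}/cubic big_ord1 a0 conjc0 !mul0r subr0.
Qed.

Lemma sqcoef_lip a b E d m : ell2 a E -> ell2 b E ->
  (forall j, (j <= m)%N -> cmod (a j - b j) <= d) ->
  cmod (sqcoef a m - sqcoef b m) <= m.+1%:R * (2 * Num.sqrt E * d).
Proof.
move=> aE bE abd; rewrite /sqcoef -sumrB; apply: (le_trans (ler_cmod_sum _ _ _)).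
apply: (ler_sum_nat_const (F := fun j => cmod (a j * a (m - j)%N - b j * b (m - j)%N))) => j jm.
have -> : a j * a (m - j)%N - b j * b (m - j)%N =
  (a j - b j) * a (m - j)%N + b j * (a (m - j)%N - b (m - j)%N) by ring.
apply: (le_trans (ler_cmodD _ _)); rewrite !cmodM.
have := ell2_coord (m - j) aE; have := ell2_coord j bE.
have := abd j jm; have := abd (m - j)%N (leq_subr _ _).
have := cmod_ge0 (a j - b j); have := cmod_ge0 (a (m - j)%N - b (m - j)%N).
have := cmod_ge0 (b j); have := cmod_ge0 (a (m - j)%N).
set p := cmod (a j - b j); set q := cmod (a (m - j)%N - _); set s := Num.sqrt E.
move=> *; have : p * cmod (a (m - j)%N) <= d * s by rewrite ler_pM.
have : cmod (b j) * q <= s * d by rewrite ler_pM.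
lra.
Qed.

Lemma cubic_lip a b E d n L : ell2 a E -> ell2 b E ->
  (forall j, (j < n + L)%N -> cmod (a j - b j) <= d) ->
  cmod (cubic L a n - cubic L b n) <= L%:R * (E * (1 + 2 * (n + L)%:R) * d).
Proof.
move=> aE bE abd; have E0 := ell2_ge0 aE.
rewrite /cubic -sumrB; apply: (le_trans (ler_cmod_sum _ _ _)).
apply: (ler_sum_nat_const (F := fun l => cmod ((a l)^*%C * sqcoef a (n + l) / (n + l)%:R -
   (b l)^*%C * sqcoef b (n + l) / (n + l)%:R))) => l lL.
rewrite -mulrBl cmodM cmodV cmod_nat.
have d0 : 0 <= d by apply: le_trans (abd l _); rewrite ?cmod_ge0 // ltn_addl.
set Y := (X in X / _).
suff YE : Y <= E * (1 + 2 * (n + L)%:R) * d.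
  case: (n + l)%N => [|k]; first by rewrite invr0 mulr0 (le_trans (cmod_ge0 _) YE).
  by apply: le_trans YE; rewrite ler_pdivrMr // ler_peMr ?cmod_ge0 // ler1n.
have -> : Y = cmod (((a l - b l)^*)%C * sqcoef a (n + l) +
    (b l)^*%C * (sqcoef a (n + l) - sqcoef b (n + l))).
  by congr cmod; rewrite rmorphB /=; ring.
apply: (le_trans (ler_cmodD _ _)); rewrite !cmodM !cmod_conj.
have h1 : cmod (a l - b l) * cmod (sqcoef a (n + l)) <= d * E.
  by rewrite ler_pM ?cmod_ge0 ?abd ?sqcoef_le // ltn_addl.
have h2 : cmod (b l) * cmod (sqcoef a (n + l) - sqcoef b (n + l)) <=
    Num.sqrt E * ((n + l).+1%:R * (2 * Num.sqrt E * d)).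
  rewrite ler_pM ?cmod_ge0 ?ell2_coord // sqcoef_lip // => j jl.
  by apply: abd; rewrite (leq_ltn_trans jl) // ltn_add2l.
have h3 : Num.sqrt E * ((n + l).+1%:R * (2 * Num.sqrt E * d)) <= 2 * (n + L)%:R * E * d.
  have -> : Num.sqrt E * ((n + l).+1%:R * (2 * Num.sqrt E * d)) =
    2 * (n + l).+1%:R * (Num.sqrt E ^+ 2) * d by ring.
  rewrite sqr_sqrtr // -!mulrA ler_wpM2l // ler_wpM2r ?mulr_ge0 // ler_nat.
  by rewrite -addnS leq_add2l.
move: h1 h2 h3; lra.
Qed.

(** Weak continuity on balls of l2: by [cubic_tail] only boundedly many terms
    matter, and a finite sum depends on finitely many coordinates. Uniformity in
    [L] allows the truncation to vary together with the sequence. *)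
Lemma cubic_unif E n (e : R) : 0 <= E -> 0 < e -> exists (J : nat) (d : R), 0 < d /\
  forall a b L, ell2 a E -> ell2 b E ->
    (forall j, (j < J)%N -> cmod (a j - b j) <= d) ->
    cmod (cubic L a n - cubic L b n) <= e.
Proof.
move=> E0 e0.
have [L0 L00 tail] : exists2 L0, (0 < L0)%N & E * Num.sqrt (E * (2 / L0%:R)) <= e / 3.
  have [L0 L00 L0E] := exists_nat_ge (2 * E * (3 * E / e) ^+ 2); exists L0 => //.
  have L0p : 0 < L0%:R :> R by rewrite ltr0n.
  have e30 : 0 <= e / 3 by rewrite divr_ge0 // ltW.
  rewrite -(@ler_pXn2r _ 2) ?nnegrE ?mulr_ge0 ?sqrtr_ge0 ?(ltW e0) //.
  rewrite exprMn sqr_sqrtr ?mulr_ge0 // ?invr_ge0 //.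
  rewrite -(ler_pM2r (_ : 0 < L0%:R * (3 / e) ^+ 2)); last by rewrite mulr_gt0 // exprn_gt0 // divr_gt0.
  have -> : E ^+ 2 * (E * (2 / L0%:R)) * (L0%:R * (3 / e) ^+ 2) = 2 * E * (3 * E / e) ^+ 2.
    by field; rewrite !gt_eqF.
  have -> // : (e / 3) ^+ 2 * (L0%:R * (3 / e) ^+ 2) = L0%:R.
  by field; rewrite gt_eqF.
pose K : R := L0%:R * (E * (1 + 2 * (n + L0)%:R)).
have K0 : 0 <= K by rewrite !mulr_ge0 // addr_ge0 // mulr_ge0.
pose d := e / 3 / (K + 1).
have d0 : 0 < d by rewrite !divr_gt0 // ltr_wpDl.
have Kd : K * d <= e / 3.
  by rewrite /d mulrCA ger_pMr ?divr_gt0 // ler_pdivrMr ?ltr_wpDl // mul1r lerDl.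
exists (n + L0)%N, d; split => // a b L aE bE abd.
have head l : (l <= L0)%N -> cmod (cubic l a n - cubic l b n) <= e / 3.
  move=> lL0; apply: le_trans Kd.
  apply: (le_trans (cubic_lip (E := E) (d := d) _ _ _)) => // [j jl|].
    by apply: abd; rewrite (leq_trans jl) // leq_add2l.
  rewrite mulrA ler_wpM2r ?(ltW d0) // /K.
  have lnL : 2 * (n + l)%:R <= 2 * (n + L0)%:R :> R.
    by rewrite ler_wpM2l // ler_nat leq_add2l.
  by rewrite ler_pM ?ler_nat ?ler_wpM2l ?lerD2l // mulr_ge0 // addr_ge0 // mulr_ge0.
have [LL0|L0L] := leqP L L0.
  by rewrite (le_trans (head _ LL0)) // ler_pdivrMr // ler_peMr ?(ltW e0) // ler1n.
have -> : cubic L a n - cubic L b n = (cubic L a n - cubic L0 a n) +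
   (cubic L0 a n - cubic L0 b n) - (cubic L b n - cubic L0 b n) by ring.
apply: (le_trans (ler_cmodB _ _)); apply: (le_trans (lerD (ler_cmodD _ _) (lexx _))).
have := cubic_tail n aE L00 (ltnW L0L); have := cubic_tail n bE L00 (ltnW L0L).
have := head L0 (leqnn _); lra.
Qed.

Lemma cubic_cauchy a E n : ell2 a E -> exists l, ccvg \oo (fun L => cubic L a n) l.
Proof.
move=> aE; apply: cauchy_ccvg => e e0.
have E0 := ell2_ge0 aE.
have [L0 L00 L0E] := exists_nat_ge (2 * E * (E / e) ^+ 2); exists L0 => L LN.
apply: (le_trans (cubic_tail n aE L00 LN)).
have L0p : 0 < L0%:R :> R by rewrite ltr0n.
rewrite -(@ler_pXn2r _ 2) ?nnegrE ?mulr_ge0 ?sqrtr_ge0 ?(ltW e0) //.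
rewrite exprMn sqr_sqrtr ?mulr_ge0 // ?invr_ge0 //.
rewrite -(ler_pM2r (_ : 0 < L0%:R / e ^+ 2)); last by rewrite divr_gt0 // exprn_gt0.
have -> : E ^+ 2 * (E * (2 / L0%:R)) * (L0%:R / e ^+ 2) = 2 * E * (E / e) ^+ 2.
  by field; rewrite !gt_eqF.
have -> // : e ^+ 2 * (L0%:R / e ^+ 2) = L0%:R.
by field; rewrite gt_eqF.
Qed.

Definition cubic_inf a n : C := xget 0 [set l | ccvg \oo (fun L => cubic L a n) l].

Lemma cubic_infP a E n : ell2 a E -> ccvg \oo (fun L => cubic L a n) (cubic_inf a n).
Proof. by move=> aE; exact: (@xgetPex _ (0 : C) _ (cubic_cauchy n aE)). Qed.

Lemma cubic_inf_unif E n (e : R) : 0 <= E -> 0 < e -> exists (J : nat) (d : R), 0 < d /\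
  forall a b, ell2 a E -> ell2 b E ->
    (forall j, (j < J)%N -> cmod (a j - b j) <= d) ->
    cmod (cubic_inf a n - cubic_inf b n) <= e.
Proof.
move=> E0 e0; have [J [d [d0 H]]] := cubic_unif n E0 e0.
exists J, d; split => // a b aE bE abd.
apply: ccvg_cmod_le (ccvgB (cubic_infP n aE) (cubic_infP n bE)) _.
by apply: nearW => L; exact: H.
Qed.

(** The truncation and the sequence change together along [U]; the uniformity in
    [L] of [cubic_unif] separates the two limits. *)
Lemma cubic_diag_cvg (U : set_system nat) (b : nat -> nat -> C) a E n :
  ProperFilter U -> \oo `<=` U -> ell2 a E -> (\forall N \near U, ell2 (b N) E) ->
  (forall j, ccvg U (fun N => b N j) (a j)) ->
  ccvg U (fun N => cubic N.+1 (b N) n) (cubic_inf a n).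
Proof.
move=> PU oU aE bE ba; apply/ccvgP => e e0.
have e20 : 0 < e / 2 by rewrite divr_gt0.
have [J [d [d0 H]]] := cubic_unif n (ell2_ge0 aE) e20.
have near_lt (K : nat) : \forall N \near U, forall j, (j < K)%N -> cmod (b N j - a j) <= d.
  elim: K => [|K ih]; first by apply: nearW => N j; rewrite ltn0.
  have /ccvgP/(_ _ d0) bK := ba K.
  near=> N => j; rewrite ltnS leq_eqVlt => /predU1P[->|jK]; first by near: N.
  by move: j jK; near: N.
have /ccvgP/(_ _ e20)[N0 _ aN0] := cubic_infP n aE.
have N0U : \forall N \near U, (N0 <= N)%N by apply: oU; exists N0.
near=> N.
rewrite [e]splitr.
have -> : cubic N.+1 (b N) n - cubic_inf a n =
  (cubic N.+1 (b N) n - cubic N.+1 a n) + (cubic N.+1 a n - cubic_inf a n) by ring.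
rewrite (le_trans (ler_cmodD _ _)) // lerD //.
  by apply: H => //; near: N.
by apply: aN0; rewrite /= leqW //; near: N.
Unshelve. all: by end_near. Qed.

Definition support_le (N : nat) a : Prop := forall n, (N < n)%N -> a n = 0.

Lemma sum_support (N n : nat) (x : nat -> R) :
  (forall j, 0 <= x j) -> (forall j, (N < j)%N -> x j = 0) ->
  \sum_(j < n) x j <= \sum_(j < N.+1) x j.
Proof.
move=> x0 xN; rewrite -!(big_mkord xpredT x).
have [nN|Nn] := leqP n N.+1.
  by rewrite [leRHS](big_cat_nat (n := n)) //= lerDl sumr_ge0.
rewrite (big_cat_nat (n := N.+1)) ?(ltnW Nn) //= [X in _ + X]big_nat_cond.
by rewrite [X in _ + X]big1 ?addr0 // => j; rewrite andbT => /andP[/xN].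
Qed.

(** Over a box that does not depend on [m], so that it can be exchanged with the
    other sums. *)
Lemma sqcoef_box N a m : support_le N a ->
  sqcoef a m = \sum_(p : 'I_N.+1 * 'I_N.+1)
     (if (p.1 + p.2 == m)%N then a p.1 * a p.2 else 0).
Proof.
move=> aN; rewrite /sqcoef.
have big_ext (M : nat) : (m <= M)%N -> (N <= M)%N ->
    \sum_(j < m.+1) a j * a (m - j)%N =
    \sum_(j < N.+1) if (j <= m)%N then a j * a (m - j)%N else 0.
  move=> mM NM.
  rewrite (big_ord_widen_cond M.+1 xpredT (fun j => a j * a (m - j)%N)) //=.
  rewrite (big_ord_widen_cond M.+1 xpredT
     (fun j => if (j <= m)%N then a j * a (m - j)%N else 0)) //=.
  rewrite big_mkcond [RHS]big_mkcond /=; apply: eq_bigr => j _.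
  rewrite !ltnS; case: (leqP j N) => // /aN ->; by rewrite mul0r; case: ifP.
rewrite (big_ext (m + N)%N) ?leq_addr ?leq_addl //.
rewrite -(pair_big xpredT xpredT (fun (j k : 'I_N.+1) =>
   if (j + k == m)%N then a j * a k else 0)) /=.
apply: eq_bigr => j _; case: (leqP j m) => jm; last first.
  by rewrite big1 // => k _; rewrite gtn_eqF // ltn_addr.
have [mjN|Nmj] := leqP (m - j) N; last first.
  rewrite (aN _ Nmj) mulr0 big1 // => k _; rewrite ltn_eqF //.
  by rewrite -ltn_subRL; apply: leq_trans Nmj; rewrite ltn_ord.
rewrite (bigD1 (Ordinal (mjN : (m - j < N.+1)%N))) //= subnKC // eqxx.
rewrite big1 ?addr0 // => k kmj; case: eqP => // jkm.
by move/eqP: kmj; case; apply: val_inj; rewrite /= -jkm addKn.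
Qed.

(** Symmetrizing [n / (n + l)] in its two indices gives [1 / 2], so the sum
    inside is [i / 2] times [\sum_m |sqcoef a m| ^+ 2], a real number. This is
    conservation of the L2 norm for the truncated system. *)
Lemma cubic_orthogonal N a : a 0%N = 0 -> support_le N a ->
  complex.Re (\sum_(n < N.+1)
    Complex 0 n%:R * cubic N.+1 a n * (a n)^*%C) = 0.
Proof.
move=> a0 aN.
pose X (p : 'I_N.+1 * 'I_N.+1) : C := (a p.1)^*%C * (a p.2)^*%C * sqcoef a (p.1 + p.2).
pose S := \sum_(p : 'I_N.+1 * 'I_N.+1) p.1%:R / (p.1 + p.2)%:R * X p.
have SE : \sum_(n < N.+1) Complex 0 n%:R * cubic N.+1 a n * (a n)^*%C = Complex 0 1 * S.
  rewrite /S -(pair_big xpredT xpredT (fun (j k : 'I_N.+1) =>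
     j%:R / (j + k)%:R * X (j, k))) /= mulr_sumr; apply: eq_bigr => j _.
  have -> : Complex 0 j%:R = Complex 0 1 * j%:R :> C.
    by rewrite -(rmorph_nat (real_complex R)); apply: complexP; rewrite /=; ring.
  rewrite -!mulrA; congr (_ * _); rewrite /cubic mulr_suml mulr_sumr; apply: eq_bigr => k _.
  rewrite /X /=; ring.
have TE : S + S = \sum_p X p.
  have {2}-> : S = \sum_(p : 'I_N.+1 * 'I_N.+1) p.2%:R / (p.1 + p.2)%:R * X p.
    rewrite /S (reindex_inj (h := fun p : 'I_N.+1 * 'I_N.+1 => (p.2, p.1))) /=; last first.
      by move=> [i j] [k l] [-> ->].
    by apply: eq_bigr => p _; rewrite /X /= addnC [X in _ * (X * _)]mulrC.
  rewrite -big_split /=; apply: eq_bigr => -[j k] _ /=.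
  rewrite -mulrDl -mulrDl -natrD; case jk : (j + k)%N => [|m]; last first.
    by rewrite divff ?mul1r // pnatr_eq0.
  move: jk => /eqP; rewrite addn_eq0 => /andP[/eqP j0 _].
  have -> : X (j, k) = 0 by rewrite /X /= j0 a0 conjc0 !mul0r.
  by rewrite mulr0.
have T_real : complex.Im (\sum_p X p) = 0.
  have : (\sum_p X p)^*%C = \sum_p X p.
    pose h (p q : 'I_N.+1 * 'I_N.+1) : C :=
      if (q.1 + q.2 == p.1 + p.2)%N then
        (a p.1)^*%C * (a p.2)^*%C * (a q.1 * a q.2) else 0.
    have -> : \sum_p X p = \sum_p \sum_q h p q.
      apply: eq_bigr => p _; rewrite /X (sqcoef_box _ aN) mulr_sumr.
      by apply: eq_bigr => q _; rewrite /h; case: ifP; rewrite ?mulr0.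
    rewrite rmorph_sum /=; under eq_bigr do rewrite rmorph_sum /=.
    rewrite exchange_big /=; apply: eq_bigr => p _; apply: eq_bigr => q _.
    rewrite /h eq_sym; case: ifP => _; last by rewrite conjc0.
    by rewrite !rmorphM /= !conjcK mulrC.
  case: (\sum_p X p) => x y /= [] /eqP.
  by rewrite eq_sym -subr_eq0 opprK -mulr2n mulrn_eq0 => /eqP.
rewrite SE ReM /= mul0r mul1r sub0r.
by apply/eqP; rewrite oppr_eq0; move: T_real; rewrite -TE ImD => /eqP; rewrite -mulr2n mulrn_eq0.
Qed.

Definition euler_step (N : nat) (h : R) a : nat -> C := fun n =>
  if (n <= N)%N then a n + h%:C%C * (Complex 0 n%:R * cubic N.+1 a n) else 0.

(** The term of first order in [h] vanishes by [cubic_orthogonal]. *)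
Lemma euler_step_energy N h a E : a 0%N = 0 -> support_le N a -> ell2 a E ->
  \sum_(n < N.+1) cmod (euler_step N h a n) ^+ 2 <=
  \sum_(n < N.+1) cmod (a n) ^+ 2 + h ^+ 2 * (2 * N.+1%:R ^+ 3 * E ^+ 3).
Proof.
move=> a0 aN aE; have E0 := ell2_ge0 aE.
pose F (n : nat) : C := Complex 0 n%:R * cubic N.+1 a n.
have -> : \sum_(n < N.+1) cmod (euler_step N h a n) ^+ 2 =
   \sum_(n < N.+1) (cmod (a n) ^+ 2 + 2 * complex.Re (h%:C%C * F n * (a n)^*%C)
      + h ^+ 2 * cmod (F n) ^+ 2).
  apply: eq_bigr => n _; rewrite /euler_step -ltnS ltn_ord sqr_cmodD.
  by rewrite cmodM cmod_real exprMn real_normK ?num_real.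
rewrite !big_split /= -!mulr_sumr -Re_sum.
have -> : complex.Re (\sum_(n < N.+1) h%:C%C * F n * (a n)^*%C) = 0.
  under eq_bigr do rewrite -mulrA.
  rewrite -mulr_sumr ReM /= mul0r subr0.
  by rewrite /F cubic_orthogonal // mulr0.
rewrite mulr0 addr0 lerD2l ler_wpM2l ?sqr_ge0 //.
have -> : 2 * N.+1%:R ^+ 3 * E ^+ 3 = N.+1%:R * (N.+1%:R ^+ 2 * (2 * E ^+ 3)) by ring.
apply: (ler_sum_nat_const (F := fun n => cmod (F n) ^+ 2)) => n nN.
have -> : 2 * E ^+ 3 = (E * Num.sqrt (E * 2)) ^+ 2.
  by rewrite exprMn sqr_sqrtr ?mulr_ge0 //; ring.
rewrite -exprMn ler_pXn2r ?nnegrE ?cmod_ge0 ?mulr_ge0 ?sqrtr_ge0 // /F cmodM.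
rewrite ler_pM ?cmod_ge0 ?cubic_le //.
rewrite cmod_imag normr_nat ler_nat; exact: ltnW.
Qed.

Lemma euler_step_support N h a : support_le N (euler_step N h a).
Proof. by move=> n nN; rewrite /euler_step leqNgt nN. Qed.

Lemma euler_step0 N h a : a 0%N = 0 -> euler_step N h a 0%N = 0.
Proof. by move=> a0; rewrite /euler_step /= a0 add0r -/(0 : C) mul0r mulr0. Qed.

Definition euler (N : nat) (h : R) (c : nat -> C) (k : nat) : nat -> C :=
  iter k (euler_step N h) (fun n => if (n <= N)%N then c n else 0).

Lemma euler0 N h (c : nat -> C) k : c 0%N = 0 -> euler N h c k 0%N = 0.
Proof.
move=> c0; elim: k => [|k ih] /=; first by rewrite /euler /= c0.
exact: euler_step0.
Qed.

Lemma euler_support N h c k : support_le N (euler N h c k).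
Proof.
case: k => [|k]; last exact: euler_step_support.
by move=> n nN; rewrite /euler /= leqNgt nN.
Qed.

(** With step [1 / H], the time interval from [- N] to [N] is reached in [N * H]
    steps; each changes the energy by at most [K / H ^+ 2] for a constant [K]
    depending on [N] and [E], and [H] is taken at least [N * K]. *)
Lemma euler_bounded (c : nat -> C) E N : c 0%N = 0 -> ell2 c E ->
  exists2 H, (N < H)%N & forall (h : R) k, `|h| = H%:R^-1 -> (k <= N * H)%N ->
    ell2 (euler N h c k) (E + 1).
Proof.
move=> c0 cE; have E0 := ell2_ge0 cE.
pose K : R := 2 * N.+1%:R ^+ 3 * (E + 1) ^+ 3.
have K0 : 0 <= K by rewrite /K !mulr_ge0 ?exprn_ge0 ?addr_ge0.
have [H H0 HK] := exists_nat_ge (N.+1%:R + N%:R * K).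
have NKH : N%:R * K <= H%:R by apply: le_trans HK; rewrite lerDr.
have NH : (N < H)%N.
  rewrite -(ler_nat R); apply: le_trans HK; rewrite lerDl mulr_ge0 //.
exists H => // h k hH.
have Hp : 0 < H%:R :> R by rewrite ltr0n.
have h2 : h ^+ 2 = H%:R ^- 2 by rewrite -(real_normK (num_real h)) hH exprVn.
have bd_ell2 k' : (k' <= N * H)%N ->
    \sum_(n < N.+1) cmod (euler N h c k' n) ^+ 2 <= E + k'%:R * (H%:R ^- 2 * K) ->
    ell2 (euler N h c k') (E + 1).
  move=> kNH bd n.
  apply: (le_trans (@sum_support N n (fun j => cmod (euler N h c k' j) ^+ 2)
    (fun j => sqr_ge0 _) _)).
    by move=> j /(@euler_support N h c k') ->; rewrite cmod0 expr0n.
  apply: le_trans bd _; rewrite lerD2l.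
  rewrite mulrCA mulrC ler_pdivrMr ?exprn_gt0 // mul1r expr2.
  apply: (@le_trans _ _ (N%:R * H%:R * K)).
    by rewrite ler_wpM2r // -natrM ler_nat.
  by rewrite mulrAC ler_wpM2r.
move=> kNH; apply: (bd_ell2 k kNH).
elim: k kNH => [_|k ih kNH].
  rewrite mul0r addr0; apply: le_trans (cE N.+1); apply: ler_sum => j _.
  by rewrite /euler /= -ltnS ltn_ord.
have ihk := ih (ltnW kNH).
have := euler_step_energy h (euler0 N h k c0) (@euler_support N h c k)
  (bd_ell2 _ (ltnW kNH) ihk).
rewrite h2 -/K -natr1 mulrDl mul1r -/(euler N h c k.+1) => /le_trans; apply.
by rewrite addrA lerD2r.
Qed.

End CubicNonlinearity.

(** * Existence for the infinite system of ordinary differential equations *)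

Section RealDerivative.
Context {R : realType}.
Local Notation C := R[i].

Definition cderive (f : R -> C) (t : R) (l : C) : Prop :=
  is_derive t 1 (fun s => complex.Re (f s)) (complex.Re l) /\
  is_derive t 1 (fun s => complex.Im (f s)) (complex.Im l).

Lemma is_derive_dist (f : R -> R) (s l : R) :
  (forall e, 0 < e -> exists2 d, 0 < d & forall t, `|t - s| <= d ->
     `|f t - f s - (t - s) * l| <= e * `|t - s|) ->
  is_derive s 1 f l.
Proof.
move=> fl.
have H : h^-1 *: ((f \o shift s) (h *: (1 : R)) - f s) @[h --> (0 : R)^'] --> l.
  apply/cvgrPdist_le => e e0; have [d d0 H] := fl e e0.
  near=> h; have h0 : h != 0 by near: h; exact: nbhs_dnbhs_neq.
  have hd : `|h| <= d by near: h; exact: dnbhs0_le.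
  have := H (s + h); rewrite addrC addKr => /(_ hd).
  rewrite /= [h *: 1]mulr1 => fe.
  rewrite distrC -(ler_pM2r (_ : 0 < `|h|)) ?normr_gt0 // -normrM.
  suff -> : (h^-1 *: (f (h + s) - f s) - l) * h = f (s + h) - f s - h * l by [].
  by rewrite [h + s]addrC /GRing.scale /=; field.
by apply: DeriveDef; [apply/cvg_ex; exists l|exact: (cvg_lim (@Rhausdorff R) H)].
Unshelve. all: by end_near. Qed.

Lemma cderive_dist (f : R -> C) (s : R) (l : C) :
  (forall e, 0 < e -> exists2 d, 0 < d & forall t, `|t - s| <= d ->
     cmod (f t - f s - (t - s)%:C%C * l) <= e * `|t - s|) ->
  cderive f s l.
Proof.
move=> fl; split; apply: is_derive_dist => e e0; have [d d0 H] := fl e e0;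
  exists d => // t /H; apply: le_trans.
  apply: le_trans (ler_Re_cmod _); rewrite !ReD !ReN ReM /= mul0r subr0 //.
apply: le_trans (ler_Im_cmod _); rewrite !ImD !ImN ImM /= mul0r addr0 //.
Qed.

End RealDerivative.

Section Trajectory.
Context {R : realType}.
Local Notation C := R[i].

Lemma ccvg_cmod_le_cvg {T : Type} {F : set_system T} {FF : ProperFilter F}
    (z : T -> C) (l : C) (r : T -> R) (r0 : R) :
  ccvg F z l -> r @ F --> r0 -> (\forall t \near F, cmod (z t) <= r t) -> cmod l <= r0.
Proof.
move=> /ccvg_cmod zl rr zr; rewrite -subr_ge0.
have H : r t - cmod (z t) @[t --> F] --> r0 - cmod l by exact: cvgB.
rewrite -(cvg_lim (@Rhausdorff R) H).
apply: limr_ge; first by apply/cvg_ex; exists (r0 - cmod l).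
by apply: filterS zr => t; rewrite /= subr_ge0.
Qed.

Lemma cvg_sumr {T I : Type} {F : set_system T} {FF : Filter F} (r : seq I)
    (f : I -> T -> R) (l : I -> R) : (forall i, f i @ F --> l i) ->
  \sum_(i <- r) f i t @[t --> F] --> \sum_(i <- r) l i.
Proof.
move=> fl; elim: r => [|i r ih].
  by rewrite big_nil; under eq_fun do rewrite big_nil; exact: cvg_cst.
by rewrite big_cons; under eq_fun do rewrite big_cons; exact: cvgD.
Qed.

(** Telescoping: each step adds [h * i n] times the current value of [cubic],
    which is within [e] of [X]. *)
Lemma euler_increment_add N (h : R) (c : nat -> C) (k i n : nat) (X : C) (e : R) :
  (n <= N)%N ->
  (forall j, (j < i)%N -> cmod (cubic N.+1 (euler N h c (k + j)) n - X) <= e) ->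
  cmod (euler N h c (k + i) n - euler N h c k n -
        (i%:R * h)%:C%C * (Complex 0 n%:R * X)) <= i%:R * `|h| * (n%:R * e).
Proof.
move=> nN; elim: i => [|i ih] H.
  by rewrite addn0 subrr sub0r cmodN !cmodM cmod_real !mul0r normr0 mul0r.
rewrite addnS; set Y := euler N h c (k + i) n.
have -> : euler N h c (k + i).+1 n = Y +
    h%:C%C * (Complex 0 n%:R * cubic N.+1 (euler N h c (k + i)) n).
  by rewrite /euler iterS /euler_step nN.
have {ih}ih := ih (fun j ji => H j (ltnW ji)).
set Z := cubic _ _ _; have HZ : cmod (Z - X) <= e by exact: H.
rewrite -natr1; set W := euler N h c k n in ih *.
have -> : Y + h%:C%C * (Complex 0 n%:R * Z) - W - ((i%:R + 1) * h)%:C%C * (Complex 0 n%:R * X)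
  = (Y - W - (i%:R * h)%:C%C * (Complex 0 n%:R * X)) + h%:C%C * (Complex 0 n%:R * (Z - X)).
  by rewrite mulrDl mul1r rmorphD /=; ring.
apply: (le_trans (ler_cmodD _ _)); rewrite !mulrDl mul1r lerD //.
rewrite !cmodM cmod_real ler_wpM2l //.
by rewrite cmod_imag normr_nat ler_wpM2l.
Qed.

Lemma euler_increment N (h : R) (c : nat -> C) (k1 k2 n : nat) (X : C) (e : R) :
  (n <= N)%N ->
  (forall j, (minn k1 k2 <= j <= maxn k1 k2)%N ->
     cmod (cubic N.+1 (euler N h c j) n - X) <= e) ->
  cmod (euler N h c k2 n - euler N h c k1 n -
        ((k2%:R - k1%:R) * h)%:C%C * (Complex 0 n%:R * X)) <=
  `|k2%:R - k1%:R| * `|h| * (n%:R * e).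
Proof.
move=> nN H; have [k12|k21] := leqP k1 k2.
  rewrite -natrB // normr_nat -{1}(subnKC k12); apply: euler_increment_add => // j jk.
  by apply: H; rewrite (minn_idPl k12) (maxn_idPr k12) leq_addr /= -leq_subRL // ltnW.
have -> : `|k2%:R - k1%:R| = (k1 - k2)%:R :> R.
  by rewrite distrC -natrB ?(ltnW k21) // normr_nat.
have -> : euler N h c k2 n - euler N h c k1 n - ((k2%:R - k1%:R) * h)%:C%C * (Complex 0 n%:R * X) =
  - (euler N h c (k2 + (k1 - k2)) n - euler N h c k2 n -
     ((k1 - k2)%:R * h)%:C%C * (Complex 0 n%:R * X)).
  rewrite subnKC ?(ltnW k21) // natrB ?(ltnW k21) // -[k2%:R - _]opprB mulNr rmorphN /=.
  by ring.
rewrite cmodN; apply: euler_increment_add => // j jk.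
apply: H; rewrite (minn_idPr (ltnW k21)) (maxn_idPl (ltnW k21)) leq_addr /=.
by rewrite -leq_subRL ?(ltnW k21) // ltnW.
Qed.

Lemma euler_lipschitz N (h : R) (c : nat -> C) (k1 k2 n K : nat) (E : R) :
  c 0%N = 0 -> (forall k, (k <= K)%N -> ell2 (euler N h c k) E) ->
  (k1 <= K)%N -> (k2 <= K)%N ->
  cmod (euler N h c k2 n - euler N h c k1 n) <=
  `|k2%:R - k1%:R| * `|h| * (n%:R * (E * Num.sqrt (E * 2))).
Proof.
move=> c0 cE k1K k2K; have E0 := ell2_ge0 (cE _ k1K).
have [nN|Nn] := leqP n N; last first.
  by rewrite !euler_support // subrr cmod0 !mulr_ge0 ?sqrtr_ge0.
have := @euler_increment N h c k1 k2 n 0 (E * Num.sqrt (E * 2)) nN.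
rewrite mulr0 mulr0 subr0; apply => j /andP[_ jk]; rewrite subr0 cubic_le //.
  exact: euler0.
by apply: cE; rewrite (leq_trans jk) // geq_max k1K.
Qed.

(** The coordinates move with bounded speed ([euler_lipschitz]), so over a short
    time the cubic term varies by at most [e] by [cubic_unif]. It matters that
    [d] does not depend on the discretization. *)
Lemma euler_taylor n (E e : R) : 0 <= E -> 0 < e -> exists2 d : R, 0 < d &
  forall N (h : R) (c : nat -> C) k1 k2 K, (n <= N)%N -> c 0%N = 0 ->
    (forall k, (k <= K)%N -> ell2 (euler N h c k) E) ->
    (k1 <= K)%N -> (k2 <= K)%N -> `|k2%:R - k1%:R| * `|h| <= d ->
    cmod (euler N h c k2 n - euler N h c k1 n -
      ((k2%:R - k1%:R) * h)%:C%C * (Complex 0 n%:R * cubic N.+1 (euler N h c k1) n)) <=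
    `|k2%:R - k1%:R| * `|h| * (n%:R * e).
Proof.
move=> E0 e0; have [J [d [d0 H]]] := cubic_unif n E0 e0.
pose B : R := J%:R * (E * Num.sqrt (E * 2)).
have B0 : 0 <= B by rewrite !mulr_ge0 ?sqrtr_ge0.
exists (d / (B + 1)); first by rewrite divr_gt0 // ltr_wpDl.
move=> N h c k1 k2 K nN c0 cE k1K k2K khd.
apply: euler_increment => // j /andP[jm jM].
have jK : (j <= K)%N by rewrite (leq_trans jM) // geq_max k1K.
apply: H => [||m mJ]; [exact: cE|exact: cE|].
apply: (le_trans (euler_lipschitz m c0 cE k1K jK)).
have kj : `|j%:R - k1%:R| <= `|k2%:R - k1%:R| :> R.
  have [k12|k21] := leqP k1 k2.
    move: jm jM; rewrite (minn_idPl k12) (maxn_idPr k12) => kj jk.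
    by rewrite -!natrB // !normr_nat ler_nat leq_sub2r.
  move: jm jM; rewrite (minn_idPr (ltnW k21)) (maxn_idPl (ltnW k21)) => kj jk.
  rewrite distrC [leRHS]distrC -!natrB ?(ltnW k21) // !normr_nat ler_nat.
  by rewrite leq_sub2l.
apply: (@le_trans _ _ (d / (B + 1) * B)).
  rewrite ler_pM ?mulr_ge0 ?sqrtr_ge0 //.
    by apply: le_trans khd; rewrite ler_wpM2r.
  by rewrite /B ler_wpM2r ?mulr_ge0 ?sqrtr_ge0 // ler_nat ltnW.
by rewrite mulrAC ler_pdivrMr ?ltr_wpDl // ler_pM2l // lerDl.
Qed.

(** Compactness: the Euler polygons of the system with [N] modes and [H N] steps
    per unit of time are bounded by [euler_bounded], so they converge at every
    time and in every coordinate along an ultrafilter finer than the filter at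
    infinity. The estimate of [euler_taylor] is uniform in the discretization
    and becomes differentiability of the limit, with the derivative identified
    by [cubic_diag_cvg]. Negative times are reached with negative steps. *)
Theorem ode_exists (c : nat -> C) (E : R) : c 0%N = 0 -> ell2 c E ->
  exists u : R -> nat -> C, [/\ u 0 = c, forall t, u t 0%N = 0,
    forall t, ell2 (u t) (E + 1),
    forall n s t, cmod (u t n - u s n) <=
       n%:R * ((E + 1) * Num.sqrt ((E + 1) * 2)) * `|t - s| &
    forall n t, cderive (fun s => u s n) t (Complex 0 n%:R * cubic_inf (u t) n)].
Proof.
move=> c0 cE; set M := E + 1.
have E0 := ell2_ge0 cE; have M0 : 0 <= M by rewrite addr_ge0.
have /choice[H HP] : forall N, exists H, (N < H)%N /\ forall (h : R) k,
    `|h| = H%:R^-1 -> (k <= N * H)%N -> ell2 (euler N h c k) M.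
  by move=> N; have [H NH HM] := euler_bounded N c0 cE; exists H.
have Hgt0 N : 0 < (H N)%:R :> R by rewrite ltr0n; apply: leq_ltn_trans (HP N).1.
pose kk (t : R) N := Num.truncn (`|t| * (H N)%:R).
pose b (s : R) (t : R) N := euler N (s / (H N)%:R) c (kk t N).
have kkle t N : (kk t N)%:R <= `|t| * (H N)%:R.
  by rewrite truncn_le // mulr_ge0 // ltW.
have ltkk t N : `|t| * (H N)%:R < (kk t N)%:R + 1 by rewrite natr1 truncnS_gt.
have nearN (t : R) : \forall N \near \oo, `|t| <= N%:R :> R.
  by have [m m0 tm] := exists_nat_ge `|t|; exists m => // N /= mN;
    apply: le_trans tm _; rewrite ler_nat.
have kkNH t N : `|t| <= N%:R -> (kk t N <= N * H N)%N.
  by move=> tN; rewrite -(ler_nat R) natrM (le_trans (kkle t N)) // ler_wpM2r // ltW.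
have hH (s : R) N : `|s| = 1 -> `|s / (H N)%:R| = (H N)%:R^-1.
  by move=> s1; rewrite normrM s1 mul1r normfV normr_nat.
have bM s t : `|s| = 1 -> \forall N \near \oo, ell2 (b s t N) M.
  by move=> s1; apply: filterS (nearN t) => N /(kkNH t); apply: (HP N).2; exact: hH.
have [U [UU oU]] := ultraFilterLemma (@eventually_filter).
have PU : ProperFilter U := @ultra_proper _ _ UU.
pose sg (t : R) : R := if t < 0 then -1 else 1.
have sg1 t : `|sg t| = 1 by rewrite /sg; case: ifP; rewrite ?normrN normr1.
have /choice[u uP] : forall t, exists ut : nat -> C, forall n,
    ccvg U (fun N => b (sg t) t N n) (ut n).
  move=> t; have /choice[ut utP] : forall n, exists l, ccvg U (fun N => b (sg t) t N n) l.
    move=> n; apply: (@ultra_ccvg _ _ _ _ (Num.sqrt M)).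
    by apply: oU; apply: filterS (bM _ t (sg1 t)) => N; exact: ell2_coord.
  by exists ut.
have bsg s t N : `|s| = 1 -> t = s * `|t| -> b s t N = b (sg t) t N.
  move=> s1 ts; have [->|t0] := eqVneq t 0.
    by rewrite /b /kk normr0 mul0r truncn0.
  congr b; have nt0 : 0 < `|t| by rewrite normr_gt0.
  have : s = 1 \/ s = -1.
    by move/eqP: s1; rewrite eqr_norml ler01 andbT => /orP[]/eqP; [left|right].
  move=> -[] se; rewrite /sg ts se.
    by rewrite mul1r ltNge normr_ge0.
  by rewrite mulN1r oppr_lt0 nt0.
have uPs s t n : `|s| = 1 -> t = s * `|t| -> ccvg U (fun N => b s t N n) (u t n).
  by move=> s1 ts; under [X in ccvg _ X _]eq_fun do rewrite bsg //; exact: uP.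
have kcvg t : (kk t N)%:R / (H N)%:R @[N --> U] --> `|t|.
  apply: cvg_trans (_ : (kk t N)%:R / (H N)%:R @[N --> \oo] --> `|t|).
    by move=> A; exact: oU.
  apply/cvgrPdist_le => e e0; have [m m0 em] := exists_nat_ge e^-1.
  exists m => // N /= mN; rewrite ger0_norm; last first.
    by rewrite subr_ge0 ler_pdivrMr.
  rewrite lerBlDl -(ler_pM2r (Hgt0 N)) mulrDl divfK ?gt_eqF //.
  apply: (le_trans (ltW (ltkk t N))); rewrite lerD2l.
  rewrite -ler_pdivrMl // mulr1 (le_trans em) // ler_nat.
  by apply: leq_trans mN _; apply: ltnW; exact: (HP N).1.
have dcvg s p q : p = s * `|p| -> q = s * `|q| ->
    ((kk q N)%:R - (kk p N)%:R) * (s / (H N)%:R) @[N --> U] --> q - p.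
  move=> ps qs; rewrite {2}ps {2}qs -mulrBr.
  have -> : (fun N => ((kk q N)%:R - (kk p N)%:R) * (s / (H N)%:R)) =
     (fun N => s * ((kk q N)%:R / (H N)%:R - (kk p N)%:R / (H N)%:R)).
    by apply/funext => N; ring.
  apply: cvgM; first exact: cvg_cst.
  by apply: cvgB.
(* Times of the same sign lie on a common polygon, whose increments compare them
   directly. *)
have sign2 p q : 0 <= p * q -> exists s : R, [/\ `|s| = 1, p = s * `|p| & q = s * `|q|].
  move=> pq; have [p0|p0|p0] := ltgtP p 0.
  - exists (-1); rewrite normrN normr1 !mulN1r ltr0_norm // ler0_norm ?opprK //.
    by rewrite -(nmulr_rge0 _ p0).
  - exists 1; rewrite normr1 !mul1r gtr0_norm // ger0_norm //.
    by rewrite -(pmulr_rge0 _ p0).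
  - exists (sg q); rewrite sg1 p0 normr0 mulr0; split => //.
    rewrite /sg; case: ltP => q0; first by rewrite ltr0_norm // mulN1r opprK.
    by rewrite ger0_norm // mul1r.
have uM t : ell2 (u t) M.
  move=> n; have H0 : \sum_(j < n) cmod (b (sg t) t N j) ^+ 2 @[N --> U] -->
      \sum_(j < n) cmod (u t j) ^+ 2.
    by apply: cvg_sumr => j; apply: cvgM; exact: ccvg_cmod (uP t j).
  rewrite -(cvg_lim (@Rhausdorff R) H0); apply: limr_le.
    by apply/cvg_ex; exists (\sum_(j < n) cmod (u t j) ^+ 2).
  by apply: oU; apply: filterS (bM _ t (sg1 t)) => N; exact.
have lip_same n p q : 0 <= p * q ->
    cmod (u q n - u p n) <= n%:R * (M * Num.sqrt (M * 2)) * `|q - p|.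
  move=> /sign2[s [s1 ps qs]].
  rewrite mulrC.
  apply: ccvg_cmod_le_cvg (ccvgB (uPs s q n s1 qs) (uPs s p n s1 ps)) _ _.
    apply: cvgM; last exact: cvg_cst.
    by apply: cvg_norm; exact: (dcvg s).
  apply: oU; near=> N; rewrite /= normrM; apply: (@euler_lipschitz N _ c (kk p N) (kk q N) n (N * H N)%N M) => //.
  - by move=> k; apply: (HP N).2; exact: hH.
  - by apply: kkNH; near: N; exact: nearN.
  - by apply: kkNH; near: N; exact: nearN.
exists u; split => //.
- apply/funext => n; apply: ccvg_unique (uP 0 n) _.
  apply: near_eq_ccvg (ccvg_cst (c n)).
  apply: oU; exists n => // N /= nN.
  by rewrite /b /kk normr0 mul0r truncn0 /euler /= nN.
- move=> t; apply: ccvg_unique (uP t 0%N) _.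
  under [X in ccvg _ X _]eq_fun do rewrite /b euler0 //.
  exact: ccvg_cst.
- move=> n p q; have [pq|pq] := leP 0 (p * q); first exact: lip_same.
  (* Times of opposite signs are compared through time 0, which both polygons
     share. *)
  have -> : u q n - u p n = (u q n - u 0 n) - (u p n - u 0 n) by ring.
  apply: (le_trans (ler_cmodB _ _)).
  have := lip_same n 0 q; rewrite mul0r => /(_ (lexx 0)) h1.
  have := lip_same n 0 p; rewrite mul0r => /(_ (lexx 0)) h2.
  apply: (le_trans (lerD h1 h2)); rewrite !subr0 -mulrDr ler_wpM2l //.
    by rewrite !mulr_ge0 ?sqrtr_ge0.
  have [p0|p0|p0] := ltgtP p 0; last by move: pq; rewrite p0 mul0r ltxx.
    have q0 : 0 < q by rewrite -(nmulr_rlt0 _ p0).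
    by rewrite (ltr0_norm p0) (gtr0_norm q0) gtr0_norm // subr_gt0 (lt_trans p0).
  have q0 : q < 0 by rewrite -(pmulr_rlt0 _ p0).
  have qp : q - p < 0 by rewrite subr_lt0 (lt_trans q0).
  by rewrite (ltr0_norm q0) (gtr0_norm p0) (ltr0_norm qp) opprB addrC.
- move=> n p; apply: cderive_dist => e e0.
  have e'0 : 0 < e / n.+1%:R by rewrite divr_gt0.
  (* The wave number [n] multiplies the error, hence [e / n.+1]. *)
  have [d d0 Hd] := euler_taylor n M0 e'0.
  (* The radius [d'] keeps [q] on the same side of 0 as [p], so that one polygon
     passes through both. *)
  have [d' d'0 [d'd d's]] : exists2 d', 0 < d' & d' < d /\ forall q, `|q - p| <= d' -> 0 <= p * q.
    have [->|p0] := eqVneq p 0.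
      by exists (d / 2); [rewrite divr_gt0|split => [|q _]; rewrite ?mul0r //; lra].
    have p'0 : 0 < `|p| by rewrite normr_gt0.
    exists (Num.min (d / 2) `|p|); first by rewrite lt_min divr_gt0.
    split=> [|q]; first by rewrite gt_min; apply/orP; left; lra.
    rewrite le_min => /andP[_]; move: p0; rewrite neq_lt => /orP[p0|p0].
      by rewrite (ltr0_norm p0) ler_norml => /andP[_ h]; rewrite nmulr_rge0 //; lra.
    by rewrite (gtr0_norm p0) ler_norml => /andP[h _]; rewrite pmulr_rge0 //; lra.
  exists d' => // q qp; have [s [s1 ps qs]] := sign2 _ _ (d's q qp).
  have ecv : ccvg U (fun N => b s q N n - b s p N n -
     (((kk q N)%:R - (kk p N)%:R) * (s / (H N)%:R))%:C%C *
     (Complex 0 n%:R * cubic N.+1 (b s p N) n))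
     (u q n - u p n - (q - p)%:C%C * (Complex 0 n%:R * cubic_inf (u p) n)).
    apply: ccvgB; first by apply: ccvgB; exact: uPs.
    apply: ccvgM; first by split; [exact: dcvg|exact: cvg_cst].
    apply: ccvgMl; apply: (cubic_diag_cvg n PU oU (uM p)).
      by apply: oU; exact: bM.
    by move=> j; exact: uPs.
  have ncv : `|(kk q N)%:R - (kk p N)%:R| * `|s / (H N)%:R| @[N --> U] --> `|q - p|.
    under eq_fun do rewrite -normrM.
    by apply: cvg_norm; exact: dcvg.
  have nd : \forall N \near U, `|(kk q N)%:R - (kk p N)%:R| * `|s / (H N)%:R| <= d.
    have qpd : `|q - p| < d by exact: le_lt_trans d'd.
    by apply: filterS (cvgr_lt _ ncv _ qpd) => N /ltW.
  apply: (@le_trans _ _ (`|q - p| * (n%:R * (e / n.+1%:R)))); last first.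
    rewrite mulrC ler_wpM2r // mulrCA ger_pMr // ler_pdivrMr // mul1r ler_nat //.
  apply: ccvg_cmod_le_cvg ecv (cvgM ncv (cvg_cst _)) _.
  have nN : \forall N \near U, (n <= N)%N by apply: oU; exists n.
  have pN : \forall N \near U, `|p| <= N%:R by apply: oU; exact: nearN.
  have qN : \forall N \near U, `|q| <= N%:R by apply: oU; exact: nearN.
  near=> N; apply: (Hd N _ c (kk p N) (kk q N) (N * H N)%N) => //.
  - by near: N.
  - by move=> k; apply: (HP N).2; exact: hH.
  - by apply: kkNH; near: N.
  - by apply: kkNH; near: N.
  - by near: N.
Unshelve. all: by end_near. Qed.

End Trajectory.

(** * Integration of complex-valued functions *)

Section ComplexIntegral.
Context {R : realType}.
Local Notation C := R[i].
Local Notation leb := (@lebesgue_measure R).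
Implicit Types (f g : R -> C) (D : set R).

#[export] Instance ae_leb_filter : Filter (nbhs (almost_everywhere leb)).
Proof. exact: (ae_filter_ringOfSetsType leb). Qed.

Lemma cmeasurable_cst (c : C) : cmeasurable (fun=> c).
Proof. by split; exact: measurable_cst. Qed.

Lemma cmeasurableD f g : cmeasurable f -> cmeasurable g -> cmeasurable (fun x => f x + g x).
Proof.
move=> [fr fi] [gr gi]; split.
  by under eq_fun do rewrite ReD; exact: measurable_funD.
by under eq_fun do rewrite ImD; exact: measurable_funD.
Qed.

Lemma cmeasurableM f g : cmeasurable f -> cmeasurable g -> cmeasurable (fun x => f x * g x).
Proof.
move=> [fr fi] [gr gi]; split.
  by under eq_fun do rewrite ReM; apply: measurable_funB; exact: measurable_funM.
by under eq_fun do rewrite ImM; apply: measurable_funD; exact: measurable_funM.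
Qed.

Lemma cmeasurable_conj f : cmeasurable f -> cmeasurable (fun x => (f x)^*%C).
Proof.
move=> [fr fi]; split; first by under eq_fun do rewrite Re_conj.
by under eq_fun do rewrite Im_conj; exact: measurable_funN.
Qed.

Lemma cmeasurable_real (h : R -> R) : measurable_fun setT h -> cmeasurable (fun x => (h x)%:C%C).
Proof. by move=> mh; split => //; exact: measurable_cst. Qed.

Lemma cmeasurableN f : cmeasurable f -> cmeasurable (fun x => - f x).
Proof.
move=> mf; have -> : (fun x => - f x) = (fun x => -1 * f x).
  by apply/funext => x; rewrite mulN1r.
exact: cmeasurableM (cmeasurable_cst _) mf.
Qed.

Lemma cmeasurableB f g : cmeasurable f -> cmeasurable g -> cmeasurable (fun x => f x - g x).
Proof. by move=> mf mg; apply: cmeasurableD mf _; exact: cmeasurableN. Qed.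

Lemma cmeasurable_lim (h : nat -> R -> C) f : (forall n, cmeasurable (h n)) ->
  (forall x, ccvg \oo (fun n => h n x) (f x)) -> cmeasurable f.
Proof.
move=> mh hf; split.
  apply: (measurable_fun_cvg (h := fun n x => complex.Re (h n x))).
    by move=> n; exact: (mh n).1.
  by move=> x _; exact: (hf x).1.
apply: (measurable_fun_cvg (h := fun n x => complex.Im (h n x))).
  by move=> n; exact: (mh n).2.
by move=> x _; exact: (hf x).2.
Qed.

Lemma measurable_sqr_cmod f : cmeasurable f -> measurable_fun setT (fun x => cmod (f x) ^+ 2).
Proof.
move=> [fr fi]; under eq_fun do rewrite sqr_cmod.
by apply: measurable_funD; exact: measurable_funX.
Qed.

Lemma measurable_sqrt (h : R -> R) : measurable_fun setT h ->
  measurable_fun setT (fun x => Num.sqrt (h x)).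
Proof.
move=> mh; have ms : measurable_fun [set: R] (@Num.sqrt R).
  by apply: continuous_measurable_fun; exact: sqrt_continuous.
exact: (measurableT_comp ms mh).
Qed.

Lemma measurable_cmod f : cmeasurable f -> measurable_fun setT (fun x => cmod (f x)).
Proof.
move=> mf; have -> : (fun x => cmod (f x)) = (fun x => Num.sqrt (cmod (f x) ^+ 2)).
  by apply/funext => x; rewrite sqrtr_sqr ger0_norm ?cmod_ge0.
by apply: measurable_sqrt; exact: measurable_sqr_cmod.
Qed.

Definition cintegrable D f : Prop :=
  leb.-integrable D (fun x => (complex.Re (f x))%:E) /\
  leb.-integrable D (fun x => (complex.Im (f x))%:E).

Lemma cintegrable_le D f (g : R -> R) : measurable D -> cmeasurable f ->
  (forall x, D x -> cmod (f x) <= g x) -> leb.-integrable D (EFin \o g) ->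
  cintegrable D f.
Proof.
move=> mD [fr fi] fg ig; split; apply: le_integrable ig => //.
- by apply/measurable_EFinP; exact: measurable_funTS.
- move=> x Dx; rewrite lee_fin (le_trans (ler_Re_cmod _)) // (le_trans (fg x Dx)) //.
  exact: ler_norm.
- by apply/measurable_EFinP; exact: measurable_funTS.
- move=> x Dx; rewrite lee_fin (le_trans (ler_Im_cmod _)) // (le_trans (fg x Dx)) //.
  exact: ler_norm.
Qed.

Lemma cintegrable_cmod D f : measurable D -> cmeasurable f -> cintegrable D f ->
  leb.-integrable D (fun x => (cmod (f x))%:E).
Proof.
move=> mD mf [fr fi].
have := @integrableD _ _ R leb D mD _ _ (integrable_abse fr) (integrable_abse fi).
apply: le_integrable => //.
  by apply/measurable_EFinP; apply: measurable_funTS; exact: measurable_cmod.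
move=> x Dx; rewrite lee_fin ger0_norm ?cmod_ge0 // (le_trans (cmod_le_ReIm _)) //.
exact: ler_norm.
Qed.

Lemma cintegrableD D f g : measurable D -> cintegrable D f -> cintegrable D g ->
  cintegrable D (fun x => f x + g x).
Proof.
move=> mD [fr fi] [gr gi]; split.
  by under eq_fun do rewrite ReD EFinD; exact: integrableD.
by under eq_fun do rewrite ImD EFinD; exact: integrableD.
Qed.

Lemma cintegrableZ D f (c : C) : measurable D -> cintegrable D f ->
  cintegrable D (fun x => c * f x).
Proof.
move=> mD [fr fi]; split.
  under eq_fun do rewrite ReM EFinB !EFinM.
  by apply: integrableB => //; exact: integrableZl.
under eq_fun do rewrite ImM EFinD !EFinM.
by apply: integrableD => //; exact: integrableZl.
Qed.

Lemma cintD D f g : measurable D -> cintegrable D f -> cintegrable D g ->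
  cint D (fun x => f x + g x) = cint D f + cint D g.
Proof.
move=> mD [fr fi] [gr gi]; rewrite /cint.
under eq_Rintegral do rewrite ReD.
under [X in Complex _ X]eq_Rintegral do rewrite ImD.
by rewrite !RintegralD.
Qed.

Lemma cintZ D f (c : C) : measurable D -> cintegrable D f ->
  cint D (fun x => c * f x) = c * cint D f.
Proof.
move=> mD [fr fi]; rewrite /cint.
under eq_Rintegral do rewrite ReM.
under [X in Complex _ X]eq_Rintegral do rewrite ImM.
have Z (a : R) (h : R -> R) : leb.-integrable D (EFin \o h) ->
    leb.-integrable D (EFin \o (fun x => a * h x)).
  by move=> ih; exact: (@integrableZl _ _ R leb D mD a _ ih).
rewrite RintegralB ?RintegralD ?RintegralZl //; try exact: Z.
by case: c.
Qed.

Lemma cint_conj D f : measurable D -> cintegrable D f ->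
  cint D (fun x => (f x)^*%C) = (cint D f)^*%C.
Proof.
move=> mD [fr fi]; rewrite /cint /=.
under eq_Rintegral do rewrite Re_conj.
under [X in Complex _ X]eq_Rintegral do rewrite Im_conj -mulN1r.
by rewrite RintegralZl // mulN1r.
Qed.

Lemma cint0 D : cint D (fun=> 0) = 0 :> C.
Proof. by rewrite /cint /Rintegral /= integral0. Qed.

Lemma cintegrable0 D : cintegrable D (fun=> 0).
Proof. by split; exact: integrable0. Qed.

Lemma cintegrable_sum D (I : Type) (r : seq I) (F : I -> R -> C) : measurable D ->
  (forall i, cintegrable D (F i)) -> cintegrable D (fun x => \sum_(i <- r) F i x).
Proof.
move=> mD iF; elim: r => [|i r ih].
  by under eq_fun do rewrite big_nil; exact: cintegrable0.
by under eq_fun do rewrite big_cons; exact: cintegrableD.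
Qed.

Lemma cint_sum D (I : Type) (r : seq I) (F : I -> R -> C) : measurable D ->
  (forall i, cintegrable D (F i)) ->
  cint D (fun x => \sum_(i <- r) F i x) = \sum_(i <- r) cint D (F i).
Proof.
move=> mD iF; elim: r => [|i r ih].
  by rewrite big_nil; under eq_fun do rewrite big_nil; exact: cint0.
rewrite big_cons; under eq_fun do rewrite big_cons.
by rewrite cintD ?ih //; exact: cintegrable_sum.
Qed.

Lemma cintegrableN D f : measurable D -> cintegrable D f -> cintegrable D (fun x => - f x).
Proof.
move=> mD /(cintegrableZ (-1) mD); congr (cintegrable _ _).
by apply/funext => x; rewrite mulN1r.
Qed.

Lemma cintN D f : measurable D -> cintegrable D f -> cint D (fun x => - f x) = - cint D f.
Proof.
move=> mD iF; rewrite -mulN1r -cintZ //; congr cint.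
by apply/funext => x; rewrite mulN1r.
Qed.

Lemma cintB D f g : measurable D -> cintegrable D f -> cintegrable D g ->
  cint D (fun x => f x - g x) = cint D f - cint D g.
Proof. by move=> mD fi gi; rewrite cintD ?cintN //; exact: cintegrableN. Qed.

Lemma eq_cint D f g : (forall x, D x -> f x = g x) -> cint D f = cint D g.
Proof.
move=> fg; rewrite /cint; congr Complex; apply: eq_Rintegral => x; rewrite inE => /fg -> //.
Qed.

(** The factor 2 comes from estimating the two components separately. *)
Lemma le_cmod_cint D f : measurable D -> cmeasurable f -> cintegrable D f ->
  cmod (cint D f) <= 2 * \int[leb]_(x in D) cmod (f x).
Proof.
move=> mD mf fi; have ic := cintegrable_cmod mD mf fi; move: fi => [fr fi].
apply: (le_trans (cmod_le_ReIm _)); rewrite mulrDl !mul1r lerD //=.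
  have h := @le_normr_Rintegral _ _ R leb D _ mD fr.
  apply: (le_trans h).
  apply: le_Rintegral => //.
    exact: integrable_norm.
  by move=> x _; exact: ler_Re_cmod.
have h := @le_normr_Rintegral _ _ R leb D _ mD fi.
apply: (le_trans h).
apply: le_Rintegral => //.
  exact: integrable_norm.
by move=> x _; exact: ler_Im_cmod.
Qed.

Lemma dominated_cint D (h : nat -> R -> C) f (g : R -> R) :
  measurable D -> (forall n, cmeasurable (h n)) -> cmeasurable f ->
  (\forall x \ae leb, D x -> ccvg \oo (fun n => h n x) (f x)) ->
  leb.-integrable D (EFin \o g) ->
  (forall n x, D x -> cmod (h n x) <= g x) ->
  ccvg \oo (fun n => cint D (h n)) (cint D f).
Proof.
move=> mD mh mf hf ig hg.
have real_dct (hr : nat -> R -> R) (fr : R -> R) :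
    (forall n, measurable_fun setT (hr n)) -> measurable_fun setT fr ->
    (\forall x \ae leb, D x -> hr n x @[n --> \oo] --> fr x) ->
    (forall n x, D x -> `|hr n x| <= g x) ->
    Rintegral leb D (hr n) @[n --> \oo] --> Rintegral leb D fr.
  move=> mhr mfr hfr hgr.
  have [|||||ifr _ cv] := @dominated_convergence _ _ R leb D mD
    (fun n x => (hr n x)%:E) (EFin \o fr) (EFin \o g).
  - by move=> n; apply/measurable_EFinP; exact: (measurable_funTS (mhr n)).
  - by apply/measurable_EFinP; exact: (measurable_funTS mfr).
  - by apply: filterS hfr => x hfr Dx; apply: cvg_EFin; [exact: nearW|exact: hfr].
  - exact: ig.
  - by apply: aeW => x n Dx; rewrite lee_fin hgr.
  apply: fine_cvg; rewrite fineK; last exact: integrable_fin_num.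
  exact: cv.
split; apply: real_dct.
- by move=> n; exact: (mh n).1.
- exact: mf.1.
- by apply: filterS hf => x hf Dx; exact: (hf Dx).1.
- by move=> n x Dx; exact: le_trans (ler_Re_cmod _) (hg n x Dx).
- by move=> n; exact: (mh n).2.
- exact: mf.2.
- by apply: filterS hf => x hf Dx; exact: (hf Dx).2.
- by move=> n x Dx; exact: le_trans (ler_Im_cmod _) (hg n x Dx).
Qed.

End ComplexIntegral.

(** * Square-integrable functions on the circle *)

Section SquareIntegrable.
Context {R : realType}.
Local Notation C := R[i].
Local Notation leb := (@lebesgue_measure R).
Local Notation tor := (@torus R).
Implicit Types (f g v : R -> C).

Lemma leb_torus : leb tor = (pi *+ 2)%:E.
Proof.
rewrite /torus lebesgue_measure_itv /= lte_fin mulrn_wgt0 ?pi_gt0 //.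
by rewrite oppr0 adde0.
Qed.

Lemma torus_lty : (leb tor < +oo)%E.
Proof. by rewrite leb_torus ltry. Qed.

Lemma integrable_torus_bounded (h : R -> R) (B : R) : measurable_fun setT h ->
  (forall x, tor x -> `|h x| <= B) -> leb.-integrable tor (EFin \o h).
Proof.
move=> mh hB; apply: (@measurable_bounded_integrable _ _ _ leb h tor measurable_torus torus_lty).
  exact: measurable_funTS.
exists B; split; first exact: num_real.
by move=> M BM x tx; apply: (le_trans (hB x tx)); exact: ltW.
Qed.

Lemma integrable_torus_cst (B : R) : leb.-integrable tor (fun=> B%:E).
Proof. by apply: (@integrable_torus_bounded (fun=> B) `|B|). Qed.

Definition sqint f : Prop :=
  cmeasurable f /\ leb.-integrable tor (fun x => (cmod (f x) ^+ 2)%:E).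

(** The square of the L2 norm; without the root, orthogonality relations stay
    polynomial. *)
Definition norm2 f : R := \int[leb]_(x in tor) (cmod (f x) ^+ 2).

Lemma norm2_ge0 f : 0 <= norm2 f.
Proof. by apply: Rintegral_ge0 => x _; rewrite sqr_ge0. Qed.

Lemma sqint_bounded f (B : R) : cmeasurable f -> (forall x, cmod (f x) <= B) -> sqint f.
Proof.
move=> mf fB; split => //.
apply: (@integrable_torus_bounded (fun x => cmod (f x) ^+ 2) (B ^+ 2)).
  exact: measurable_sqr_cmod.
move=> x _; rewrite ger0_norm ?sqr_ge0 // ler_pXn2r ?nnegrE ?cmod_ge0 //.
exact: le_trans (cmod_ge0 _) (fB x).
Qed.

Lemma sqint_le f (h : R -> R) : cmeasurable f ->
  (forall x, tor x -> cmod (f x) ^+ 2 <= h x) -> leb.-integrable tor (EFin \o h) ->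
  sqint f.
Proof.
move=> mf fh ih; split => //; apply: le_integrable ih => //.
- exact: measurable_torus.
- by apply/measurable_EFinP; apply: measurable_funTS; exact: measurable_sqr_cmod.
- move=> x tx; rewrite lee_fin ger0_norm ?sqr_ge0 //.
  exact: le_trans (fh x tx) (ler_norm _).
Qed.

Lemma le_norm2 f (h : R -> R) : cmeasurable f ->
  (forall x, tor x -> cmod (f x) ^+ 2 <= h x) -> leb.-integrable tor (EFin \o h) ->
  norm2 f <= \int[leb]_(x in tor) h x.
Proof.
move=> mf fh ih; apply: le_Rintegral => //; first exact: measurable_torus.
exact: (sqint_le mf fh ih).2.
Qed.

Lemma integrableZ_torus (a : R) (h : R -> R) : leb.-integrable tor (EFin \o h) ->
  leb.-integrable tor (EFin \o (fun x => a * h x)).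
Proof. by move=> ih; exact: (@integrableZl _ _ R leb tor measurable_torus a _ ih). Qed.

Lemma integrableD_torus (h k : R -> R) : leb.-integrable tor (EFin \o h) ->
  leb.-integrable tor (EFin \o k) -> leb.-integrable tor (EFin \o (fun x => h x + k x)).
Proof. by move=> ih ik; exact: (@integrableD _ _ R leb tor measurable_torus _ _ ih ik). Qed.

Lemma sqintD f g : sqint f -> sqint g -> sqint (fun x => f x + g x).
Proof.
move=> [mf fi] [mg gi].
apply: (@sqint_le _ (fun x => 2 * (cmod (f x) ^+ 2 + cmod (g x) ^+ 2))).
- exact: cmeasurableD.
- by move=> x _; exact: sqr_cmodD_le.
- by apply: integrableZ_torus; exact: integrableD_torus.
Qed.

Lemma sqint_mul_bounded f g (B : R) : sqint f -> cmeasurable g ->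
  (forall x, cmod (g x) <= B) -> sqint (fun x => f x * g x).
Proof.
move=> [mf fi] mg gB; apply: (@sqint_le _ (fun x => B ^+ 2 * cmod (f x) ^+ 2)).
- exact: cmeasurableM.
- move=> x _; rewrite cmodM exprMn mulrC ler_wpM2r ?sqr_ge0 //.
  by rewrite ler_pXn2r ?nnegrE ?cmod_ge0 // (le_trans (cmod_ge0 (g x))).
- exact: integrableZ_torus.
Qed.

Lemma sqint_cst (c : C) : sqint (fun=> c).
Proof. by apply: (@sqint_bounded _ (cmod c)) => //; exact: cmeasurable_cst. Qed.

Lemma sqintZ f (c : C) : sqint f -> sqint (fun x => c * f x).
Proof.
move=> sf; under eq_fun do rewrite mulrC.
by apply: (@sqint_mul_bounded _ (fun=> c) (cmod c)) => //; exact: cmeasurable_cst.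
Qed.

Lemma sqintN f : sqint f -> sqint (fun x => - f x).
Proof. by move=> /(sqintZ (-1)); under eq_fun do rewrite mulN1r. Qed.

Lemma sqintB f g : sqint f -> sqint g -> sqint (fun x => f x - g x).
Proof. by move=> sf sg; apply: sqintD => //; exact: sqintN. Qed.

Lemma sqint_conj f : sqint f -> sqint (fun x => (f x)^*%C).
Proof.
move=> [mf fi]; split; first exact: cmeasurable_conj.
by under eq_fun do rewrite cmod_conj.
Qed.

Lemma mul_le_sqr (p q l : R) : 0 < l -> 2 * (p * q) <= l * p ^+ 2 + l^-1 * q ^+ 2.
Proof.
move=> l0; rewrite -subr_ge0.
have -> : l * p ^+ 2 + l^-1 * q ^+ 2 - 2 * (p * q) = l^-1 * (l * p - q) ^+ 2.
  by field; rewrite gt_eqF.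
by rewrite mulr_ge0 ?sqr_ge0 // invr_ge0 ltW.
Qed.

Lemma sqintM f g : sqint f -> sqint g -> cintegrable tor (fun x => f x * g x).
Proof.
move=> [mf fi] [mg gi].
apply: (@cintegrable_le _ _ _ (fun x => cmod (f x) ^+ 2 + cmod (g x) ^+ 2)).
- exact: measurable_torus.
- exact: cmeasurableM.
- move=> x _; rewrite cmodM.
  have := mul_le_sqr (cmod (f x)) (cmod (g x)) ltr01; rewrite invr1 !mul1r.
  have := mulr_ge0 (cmod_ge0 (f x)) (cmod_ge0 (g x)); lra.
- exact: integrableD_torus.
Qed.

Lemma sqint_integrable f : sqint f -> cintegrable tor f.
Proof.
move=> sf; have := sqintM sf (sqint_cst 1).
by congr (cintegrable _ _); apply/funext => x; rewrite mulr1.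
Qed.

(** The inequality of arithmetic and geometric means with a free weight [l],
    which serves as the inequality of Cauchy and Schwarz. *)
Lemma cint_mul_le f g (l : R) : sqint f -> sqint g -> 0 < l ->
  cmod (cint tor (fun x => f x * g x)) <= l * norm2 f + l^-1 * norm2 g.
Proof.
move=> sf sg l0; have [mf fi] := sf; have [mg gi] := sg.
have mT := @measurable_torus R.
have sfg := sqintM sf sg.
apply: (le_trans (le_cmod_cint mT (cmeasurableM mf mg) sfg)).
have <- : \int[leb]_(x in tor) (l * cmod (f x) ^+ 2 + l^-1 * cmod (g x) ^+ 2) =
    l * norm2 f + l^-1 * norm2 g.
  by rewrite RintegralD ?RintegralZl //; exact: integrableZ_torus.
rewrite -RintegralZl //; last exact: (cintegrable_cmod mT (cmeasurableM mf mg) sfg).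
have ic := cintegrable_cmod mT (cmeasurableM mf mg) sfg.
apply: le_Rintegral => //.
- exact: integrableZ_torus.
- by apply: integrableD_torus; exact: integrableZ_torus.
- by move=> x _; rewrite cmodM; exact: mul_le_sqr.
Qed.

(** The weight [l] of [cint_mul_le] is chosen large against [norm2 v / e], and
    the mean-square distance is then made small against [l]. *)
Lemma ccvg_cint_norm2 {T : Type} {F : set_system T} {FF : Filter F}
    (h : T -> R -> C) f v : (forall t, sqint (h t)) -> sqint f -> sqint v ->
  norm2 (fun x => f x - h t x) @[t --> F] --> (0 : R) ->
  ccvg F (fun t => cint tor (fun x => h t x * v x)) (cint tor (fun x => f x * v x)).
Proof.
move=> sh sf sv hf; apply/ccvgP => e e0.
have mT := @measurable_torus R.
pose V := norm2 v + 1; have V0 : 0 < V by rewrite ltr_wpDl // norm2_ge0.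
(* With this weight the term [l^-1 * norm2 v] is at most half of [e]. *)
pose l := 2 * V / e; have l0 : 0 < l by rewrite !divr_gt0 // mulr_gt0.
have d0 : 0 < e / 2 / l by rewrite divr_gt0 // divr_gt0.
near=> t.
rewrite cmodB -cintB //; try exact: sqintM.
under eq_cint => x _ do rewrite -mulrBl.
apply: (le_trans (cint_mul_le (sqintB sf (sh t)) sv l0)).
rewrite [e]splitr lerD //.
  rewrite mulrC -ler_pdivlMr //; apply: ltW; near: t.
  exact: cvgr_lt hf _ d0.
rewrite /l invf_div mulrAC ler_pdivrMr ?mulr_gt0 // -subr_ge0.
have -> : e / 2 * (2 * V) - e * norm2 v = e by rewrite /V; field.
exact: ltW.
Unshelve. all: by end_near. Qed.

End SquareIntegrable.

(** * Trigonometric sums and the inequality of Bessel *)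

Section Derivatives.
Context {R : realType}.
Local Notation C := R[i].
Local Notation leb := (@lebesgue_measure R).

Lemma Rintegral_derive (F f : R -> R) (a b : R) : a < b ->
  (forall x : R, is_derive x 1 F (f x)) -> continuous f ->
  \int[leb]_(x in `[a, b]) f x = F b - F a.
Proof.
move=> ab dF cf.
have cF : continuous F.
  move=> x; apply: differentiable_continuous; apply/derivable1_diffP.
  by have [] := dF x.
rewrite /Rintegral (@continuous_FTC2 _ _ F) //.
- exact: continuous_subspaceT.
- split=> [x _||]; first by have [] := dF x.
    by apply: cvg_at_right_filter; exact: cF.
  by apply: cvg_at_left_filter; exact: cF.
- by move=> x _; rewrite derive1E; have [] := dF x.
Qed.

Lemma cint_cderive (F f : R -> C) (a b : R) : a < b ->
  (forall x, cderive F x (f x)) ->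
  continuous (fun x => complex.Re (f x)) -> continuous (fun x => complex.Im (f x)) ->
  cint `[a, b]%classic f = F b - F a.
Proof.
move=> ab dF cr ci; rewrite /cint.
rewrite (@Rintegral_derive _ _ a b ab (fun x => (dF x).1) cr).
rewrite (@Rintegral_derive _ _ a b ab (fun x => (dF x).2) ci).
by apply: complexP; rewrite ?ReD ?ImD ?ReN ?ImN.
Qed.

Lemma is_derive_cos_scale (a x : R) : is_derive x 1 (fun y => cos (a * y)) (- a * sin (a * x)).
Proof.
have d1 : is_derive x 1 (fun y => a * y) a.
  have := @is_deriveZ R R R id a x 1 1 _; rewrite /GRing.scale /= mulr1; apply.
have := @is_derive1_comp R (@cos R) (fun y => a * y) x _ _ (is_derive_cos _) d1.
by rewrite mulrC mulNr mulrN.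
Qed.

Lemma is_derive_sin_scale (a x : R) : is_derive x 1 (fun y => sin (a * y)) (a * cos (a * x)).
Proof.
have d1 : is_derive x 1 (fun y => a * y) a.
  have := @is_deriveZ R R R id a x 1 1 _; rewrite /GRing.scale /= mulr1; apply.
have := @is_derive1_comp R (@sin R) (fun y => a * y) x _ _ (is_derive_sin _) d1.
by rewrite mulrC.
Qed.

Lemma continuous_cos_scale (a : R) : continuous (fun y => cos (a * y)).
Proof.
move=> x; apply: (@continuous_comp R R R (fun y => a * y) (@cos R)).
  by apply: continuousM; [exact: cst_continuous|exact: cvg_id].
exact: continuous_cos.
Qed.

Lemma continuous_sin_scale (a : R) : continuous (fun y => sin (a * y)).
Proof.
move=> x; apply: (@continuous_comp R R R (fun y => a * y) (@sin R)).
  by apply: continuousM; [exact: cst_continuous|exact: cvg_id].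
exact: continuous_sin.
Qed.

End Derivatives.

Section TrigonometricSums.
Context {R : realType}.
Local Notation C := R[i].
Local Notation tor := (@torus R).
Implicit Types (f g v : R -> C) (n m : int).

Lemma cisD (x y : R) : cis (x + y) = cis x * cis y.
Proof. by apply: complexP; rewrite ?ReM ?ImM /= ?cosD ?sinD; ring. Qed.

Lemma cis0 : cis (0 : R) = 1.
Proof. by apply: complexP; rewrite /= ?cos0 ?sin0. Qed.

Lemma cis_conj (x : R) : (cis x)^*%C = cis (- x).
Proof. by apply: complexP; rewrite /= ?cosN ?sinN. Qed.

Lemma cmod_cis (x : R) : cmod (cis x) = 1.
Proof.
by apply/eqP; rewrite -(@eqrXn2 _ 2) ?cmod_ge0 // sqr_cmod /= cos2Dsin2 expr1n.
Qed.

Definition expi (n : int) (x : R) : C := cis (n%:~R * x).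

Arguments expi : simpl never.
Arguments fourier : simpl never.
Arguments cint : simpl never.

Lemma expiD n m x : expi (n + m) x = expi n x * expi m x.
Proof. by rewrite /expi intrD mulrDl cisD. Qed.

Lemma expi0 x : expi 0 x = 1.
Proof. by rewrite /expi mul0r cis0. Qed.

Lemma expi_conj n x : (expi n x)^*%C = expi (- n) x.
Proof. by rewrite /expi cis_conj mulrNz mulNr. Qed.

Lemma cmod_expi n x : cmod (expi n x) = 1.
Proof. exact: cmod_cis. Qed.

Lemma expi_2pi (n : int) : expi n (pi *+ 2) = 1.
Proof.
have nat_case (k : nat) : expi k (pi *+ 2) = 1.
  elim: k => [|k ih]; first exact: expi0.
  by rewrite -addn1 PoszD expiD ih mul1r /expi mul1r /cis cos2pi sin2pi.
case: n => k; first exact: nat_case.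
by rewrite NegzE -expi_conj nat_case conjc1.
Qed.

Lemma expi_periodic n : periodic (expi n) (pi *+ 2).
Proof. by move=> x; rewrite /expi mulrDr cisD -/(expi n (pi *+ 2)) expi_2pi mulr1. Qed.

Lemma cmeasurable_expi n : cmeasurable (expi n).
Proof.
split; apply: continuous_measurable_fun; [exact: continuous_cos_scale|exact: continuous_sin_scale].
Qed.

Lemma sqint_expi n : sqint (expi n).
Proof. by apply: (@sqint_bounded _ _ 1); [exact: cmeasurable_expi|move=> x; rewrite cmod_expi]. Qed.

Lemma cderive_expi n (c : C) x : cderive (fun y => c * expi n y) x (c * (Complex 0 n%:~R * expi n x)).
Proof.
have := is_derive_cos_scale (n%:~R) x; have := is_derive_sin_scale (n%:~R) x => ds dc.
split.
  have -> : (fun y => complex.Re (c * expi n y)) =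
      (complex.Re c \*: (fun y => cos (n%:~R * y)) - complex.Im c \*: (fun y => sin (n%:~R * y))).
    by apply/funext => y; rewrite ReM.
  apply: is_derive_eq; rewrite /GRing.scale !(ReM, ImM) /=; ring.
have -> : (fun y => complex.Im (c * expi n y)) =
    (complex.Re c \*: (fun y => sin (n%:~R * y)) + complex.Im c \*: (fun y => cos (n%:~R * y))).
  by apply/funext => y; rewrite ImM.
by apply: is_derive_eq; rewrite /GRing.scale !(ReM, ImM) /=; ring.
Qed.

Lemma two_pi_gt0 : 0 < pi *+ 2 :> R.
Proof. by rewrite mulrn_wgt0 ?pi_gt0. Qed.

(** For nonzero [n] the primitive [expi n / (i n)] is periodic. *)
Lemma cint_expi n : cint tor (expi n) = if n == 0 then (pi *+ 2)%:C%C else 0.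
Proof.
case: eqP => [->|/eqP n0].
  rewrite (@eq_cint _ _ _ (fun=> 1)); last by move=> x _; exact: expi0.
  have mT := @measurable_torus R.
  apply: complexP; rewrite /= Rintegral_cst // ?mul0r // mul1r.
  exact: (congr1 fine (@leb_torus R)).
have ni0 : Complex 0 n%:~R != 0 :> C by rewrite eq_complex /= negb_and intr_eq0 n0 orbT.
have dF x : cderive (fun y => (Complex 0 n%:~R)^-1 * expi n y) x (expi n x).
  have := cderive_expi n (Complex 0 n%:~R)^-1 x.
  by rewrite mulrA mulVf // mul1r.
have cr : continuous (fun x => complex.Re (expi n x)).
  by move=> x; exact: continuous_cos_scale.
have ci : continuous (fun x => complex.Im (expi n x)).
  by move=> x; exact: continuous_sin_scale.
rewrite /torus (cint_cderive two_pi_gt0 dF cr ci).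
by rewrite expi_2pi /expi mulr0 cis0 subrr.
Qed.

Lemma fourierE f n : fourier f n = ((pi *+ 2)^-1)%:C%C * cint tor (fun x => f x * expi (- n) x).
Proof. by rewrite /fourier; congr (_ * _); apply: eq_cint => x _; rewrite /expi mulrNz mulNr. Qed.

Lemma two_pi_neq0 : (pi *+ 2)%:C%C != 0 :> C.
Proof. by rewrite eq_complex /= gt_eqF ?two_pi_gt0. Qed.

Lemma cint_fourier f n : cint tor (fun x => f x * expi (- n) x) = (pi *+ 2)%:C%C * fourier f n.
Proof. by rewrite fourierE mulrA -rmorphM /= divff ?mul1r // gt_eqF ?two_pi_gt0. Qed.

Definition trigsum (c : nat -> C) (r : seq nat) (x : R) : C :=
  \sum_(j <- r) c j * expi j x.

Lemma trigsum_periodic c r : periodic (trigsum c r) (pi *+ 2).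
Proof. by move=> x; apply: eq_bigr => j _; rewrite expi_periodic. Qed.

Lemma sqint_sum (I : Type) (r : seq I) (F : I -> R -> C) :
  (forall i, sqint (F i)) -> sqint (fun x => \sum_(i <- r) F i x).
Proof.
move=> sF; elim: r => [|i r ih].
  by under eq_fun do rewrite big_nil; exact: sqint_cst.
by under eq_fun do rewrite big_cons; exact: sqintD.
Qed.

Lemma sqint_trigsum c r : sqint (trigsum c r).
Proof. by apply: sqint_sum => j; apply: sqintZ; exact: sqint_expi. Qed.

Lemma cint_trigsum c r v : sqint v ->
  cint tor (fun x => trigsum c r x * v x) =
  \sum_(j <- r) c j * cint tor (fun x => expi j x * v x).
Proof.
move=> sv; have mT := @measurable_torus R.
under eq_cint => x _.
  rewrite mulr_suml; under eq_bigr do rewrite -mulrA; over.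
rewrite cint_sum => [||j]; rewrite ?measurable_torus //.
  by apply: eq_bigr => j _; rewrite cintZ //; apply: sqintM => //; exact: sqint_expi.
by apply: cintegrableZ => //; apply: sqintM => //; exact: sqint_expi.
Qed.

Lemma fourier_trigsum c r n : uniq r ->
  fourier (trigsum c r) n = if n is Posz j then if j \in r then c j else 0 else 0.
Proof.
move=> ur; apply: (mulfI two_pi_neq0); rewrite -cint_fourier cint_trigsum; last exact: sqint_expi.
have eE (j : nat) : cint tor (fun x => expi j x * expi (- n) x) =
    if j%:Z == n then (pi *+ 2)%:C%C else 0.
  under eq_cint do rewrite -expiD.
  by rewrite cint_expi subr_eq0.
under eq_bigr do rewrite eE.
case: n {eE} => [k|k]; last by rewrite mulr0 big1 // => j _; rewrite mulr0.
case: ifPn => kr; last first.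
  rewrite mulr0 big1_seq // => j /andP[_ jr]; case: eqP => [[jk]|]; last by rewrite mulr0.
  by move: kr; rewrite -jk jr.
rewrite (bigD1_seq k) //= eqxx big1 ?addr0 1?mulrC // => j jk.
by rewrite eqz_nat (negbTE jk) mulr0.
Qed.

Lemma norm2E f : (norm2 f)%:C%C = cint tor (fun x => f x * (f x)^*%C).
Proof.
under eq_cint => x _ do rewrite mulCconj.
by rewrite /cint /= [in RHS]/Rintegral integral0.
Qed.

Lemma norm2_trigsum c r : uniq r ->
  norm2 (trigsum c r) = (pi *+ 2) * \sum_(j <- r) cmod (c j) ^+ 2.
Proof.
move=> ur; apply: (@complexI R); have st := sqint_trigsum c r.
rewrite norm2E // cint_trigsum; last exact: sqint_conj.
rewrite rmorphM rmorph_sum mulr_sumr; rewrite big_seq [RHS]big_seq.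
apply: eq_bigr => j jr.
have -> : cint tor (fun x => expi j x * (trigsum c r x)^*%C) =
   (cint tor (fun x => trigsum c r x * expi (- j%:Z) x))^*%C.
  rewrite -cint_conj; [|exact: measurable_torus|apply: sqintM => //; exact: sqint_expi].
  by apply: eq_cint => x _; rewrite conjM expi_conj opprK mulrC.
by rewrite cint_fourier fourier_trigsum // jr conjM conjc_real mulrCA mulCconj.
Qed.

Lemma norm2B f g : sqint f -> sqint g ->
  norm2 (fun x => f x - g x) =
  norm2 f + norm2 g - 2 * complex.Re (cint tor (fun x => f x * (g x)^*%C)).
Proof.
move=> sf sg; have mT := @measurable_torus R.
have [mf fi] := sf; have [mg gi] := sg.
have [fgi _] := sqintM sf (sqint_conj sg).
rewrite /norm2 /cint /= -RintegralZl // -RintegralD // -RintegralB //; last first.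
- exact: integrableZ_torus.
- exact: integrableD_torus.
by apply: eq_Rintegral => x _; rewrite !sqr_cmod !(ReD, ImD, ReN, ImN, ReM, Re_conj, Im_conj); ring.
Qed.

(** The partial sum is orthogonal to its difference with [f], and the norm of
    the difference is nonnegative. *)
Lemma bessel f N : sqint f ->
  (pi *+ 2) * (\sum_(j < N) cmod (fourier f j%:Z) ^+ 2) <= norm2 f.
Proof.
move=> sf; pose S := trigsum (fun j => fourier f j%:Z) (iota 0 N).
have sS : sqint S by exact: sqint_trigsum.
have := norm2_ge0 (fun x => f x - S x); rewrite norm2B //.
rewrite norm2_trigsum ?iota_uniq //.
have -> : cint tor (fun x => f x * (S x)^*%C) =
   ((pi *+ 2) * \sum_(j <- iota 0 N) cmod (fourier f j%:Z) ^+ 2)%:C%C.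
  have -> : cint tor (fun x => f x * (S x)^*%C) = (cint tor (fun x => S x * (f x)^*%C))^*%C.
    rewrite -cint_conj; [|exact: measurable_torus|by apply: sqintM => //; exact: sqint_conj].
    by apply: eq_cint => x _; rewrite conjM conjcK mulrC.
  rewrite cint_trigsum; last exact: sqint_conj.
  rewrite conj_sum real_complexM real_complex_sum mulr_sumr; apply: eq_bigr => j _.
  rewrite conjM.
  have -> : cint tor (fun x => expi j x * (f x)^*%C) =
      (cint tor (fun x => f x * expi (- j%:Z) x))^*%C.
    rewrite -cint_conj; [|exact: measurable_torus|by apply: sqintM => //; exact: sqint_expi].
    by apply: eq_cint => x _; rewrite conjM expi_conj opprK mulrC.
  by rewrite conjcK cint_fourier mulrCA [_^*%C * _]mulrC mulCconj.
rewrite /= -(big_mkord xpredT (fun j => cmod (fourier f j%:Z) ^+ 2)) /index_iota subn0.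
lra.
Qed.

End TrigonometricSums.

(** * The theorem of Riesz and Fischer *)

Section SeriesBounds.
Context {R : realType}.
Local Notation C := R[i].

Lemma nneseries_le (a : nat -> R) (B : R) (m : nat) : (forall k, 0 <= a k) ->
  (forall n, \sum_(m <= k < n) a k <= B) -> (\sum_(m <= k <oo) (a k)%:E <= B%:E)%E.
Proof.
move=> a0 aB; apply: lime_le.
  by apply: is_cvg_nneseries => k _ _; rewrite lee_fin.
by apply: nearW => n; rewrite sumEFin lee_fin.
Qed.

Lemma nneg_sum_tail (x : nat -> R) (E e : R) : (forall j, 0 <= x j) ->
  (forall n, \sum_(j < n) x j <= E) -> 0 < e ->
  exists M0, forall M N, (M0 <= M)%N -> \sum_(M <= j < N) x j <= e.
Proof.
move=> x0 xE e0; pose A (n : nat) : R := \sum_(0 <= j < n) x j.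
have AE n : A n <= E by rewrite /A big_mkord; exact: xE.
have ndA : nondecreasing_seq A.
  by move=> m n mn; rewrite /A (big_cat_nat (n := m) (p := n)) //= lerDl sumr_ge0.
have cA : cvgn A.
  by apply: nondecreasing_is_cvgn => //; exists E => _ [n _ <-].
have e20 : 0 < e / 2 by rewrite divr_gt0.
have /cvgrPdist_le/(_ _ e20)[M0 _ HM] := cA.
exists M0 => M N M0M; have [NM|MN] := leqP N M; first by rewrite big_geq // ltW.
have -> : \sum_(M <= j < N) x j = A N - A M.
  by rewrite /A [X in X - _](big_cat_nat (n := M)) //= ?(ltnW MN) // [X in X - _]addrC addrK.
have := HM M M0M; have := HM N (leq_trans M0M (ltnW MN)); rewrite /= !ler_norml.
move=> /andP[h1 h2] /andP[h3 h4]; lra.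
Qed.

Lemma ell2_tail (c : nat -> C) (E e : R) : ell2 c E -> 0 < e ->
  exists M0, forall M N, (M0 <= M)%N -> \sum_(M <= j < N) cmod (c j) ^+ 2 <= e.
Proof.
by move=> cE; apply: (nneg_sum_tail (x := fun j => cmod (c j) ^+ 2)) => // j; rewrite sqr_ge0.
Qed.

Lemma abs_summable_ccvg (z : nat -> C) (B : R) : (forall n, \sum_(j < n) cmod (z j) <= B) ->
  exists l, ccvg \oo (fun n => \sum_(0 <= j < n) z j) l.
Proof.
move=> zB; apply: cauchy_ccvg => e e0.
have [N HN] := nneg_sum_tail (fun j => cmod_ge0 (z j)) zB e0.
exists N => n Nn; rewrite [X in X - _](big_cat_nat (n := N)) //= [X in X - _]addrC addrK.
by apply: (le_trans (ler_cmod_sum _ _ _)); exact: HN.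
Qed.

Lemma sum_half_pow (n : nat) : \sum_(0 <= k < n) (2^-1 ^+ k : R) <= 2.
Proof.
suff -> : \sum_(0 <= k < n) (2^-1 ^+ k : R) = 2 - 2 * 2^-1 ^+ n.
  by rewrite gerBl mulr_ge0 // exprn_ge0.
elim: n => [|n ih]; first by rewrite big_geq // expr0 mulr1 subrr.
by rewrite big_nat_recr //= ih exprS; field.
Qed.

Lemma half_pow_small (e B : R) : 0 < e -> 0 <= B -> exists k, B * 2^-1 ^+ k <= e.
Proof.
move=> e0 B0; have [k k0 ke] := exists_nat_ge (B / e); exists k.
rewrite exprVn ler_pdivrMr ?exprn_gt0 // mulrC -ler_pdivrMr //.
apply: (le_trans ke); rewrite -natrX ler_nat; apply: ltnW; exact: ltn_expl.
Qed.

End SeriesBounds.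

Section RieszFischer.
Context {R : realType}.
Local Notation C := R[i].
Local Notation leb := (@lebesgue_measure R).
Local Notation tor := (@torus R).
Implicit Types (c : nat -> C).

Definition psum c (M : nat) : R -> C := trigsum c (index_iota 0 M).

Lemma psumB c M N x : (M <= N)%N ->
  psum c N x - psum c M x = trigsum c (index_iota M N) x.
Proof.
by move=> MN; rewrite /psum /trigsum [X in X - _](big_cat_nat (n := M)) //= [X in X - _]addrC addrK.
Qed.

Lemma sqint_psum c M : sqint (psum c M).
Proof. exact: sqint_trigsum. Qed.

Lemma EFin_norm2 (f : R -> C) : sqint f ->
  (\int[leb]_(x in tor) (cmod (f x) ^+ 2)%:E = (norm2 f)%:E)%E.
Proof.
move=> [mf fi]; rewrite /norm2 /Rintegral fineK //.
exact: (@integrable_fin_num _ _ R leb tor measurable_torus _ fi).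
Qed.

(** The partial sums are cut into blocks [D k] of square norm at most [2 pi 8 ^-
    k]. Then [Phi], the sum of [4 ^ k |D k| ^+ 2], is integrable, hence finite
    almost everywhere, and where it is finite [|D k|] is at most a multiple of
    [2 ^- k], so the blocks sum to a limit. The lemma of Fatou bounds its
    distance to every partial sum. The limit is set to 0 where [Phi] is
    infinite, a periodic set because the blocks are periodic. *)
Lemma riesz_fischer c (E : R) : ell2 c E -> exists h : R -> C,
  [/\ periodic h (pi *+ 2), sqint h &
   forall M (B : R), (forall N, \sum_(M <= j < N) cmod (c j) ^+ 2 <= B) ->
     norm2 (fun x => h x - psum c M x) <= (pi *+ 2) * B].
Proof.
move=> cE; have mT := @measurable_torus R.
have E0 := ell2_ge0 cE.
have /choice[m0 Hm0] : forall k, exists M0, forall M N, (M0 <= M)%N ->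
    \sum_(M <= j < N) cmod (c j) ^+ 2 <= 8^-1 ^+ k.
  by move=> k; apply: (ell2_tail cE); rewrite exprn_gt0.
(* Summing makes the block ends increasing and at least [k] and [m0 k]. *)
pose N k := (\sum_(i < k.+1) (m0 i).+1)%N.
have NS k : (N k <= N k.+1)%N by rewrite /N [in leqRHS]big_ord_recr /= leq_addr.
have m0N k : (m0 k <= N k)%N.
  by rewrite /N big_ord_recr /= (leq_trans (leqnSn _)) // leq_addl.
have kN k : (k <= N k)%N.
  rewrite /N (@leq_trans (\sum_(i < k.+1) 1)%N) //; first by rewrite sum1_card card_ord.
  by apply: leq_sum.
have N_le j k : (j <= k)%N -> (N j <= N k)%N.
  by move=> /subnKC <-; elim: (k - j)%N => [|i ih]; rewrite ?addn0 // addnS (leq_trans ih).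
pose D k := trigsum c (index_iota (N k) (N k.+1)).
have sD k : sqint (D k) by exact: sqint_trigsum.
have D_small k : norm2 (D k) <= (pi *+ 2) * 8^-1 ^+ k.
  rewrite norm2_trigsum ?iota_uniq // ler_wpM2l ?(ltW two_pi_gt0) //.
  by apply: Hm0; exact: m0N.
pose a k (x : R) : R := 4 ^+ k * cmod (D k x) ^+ 2.
have a0 k x : 0 <= a k x by rewrite mulr_ge0 ?sqr_ge0 // exprn_ge0.
have ma k : measurable_fun setT (a k).
  apply: measurable_funM; first exact: measurable_cst.
  by apply: measurable_sqr_cmod; case: (sD k).
have maE k : measurable_fun setT (fun x => (a k x)%:E) by apply/measurable_EFinP.
pose Phi x : \bar R := (\sum_(0 <= k <oo) (a k x)%:E)%E.
have Phi0 x : (0 <= Phi x)%E by apply: nneseries_ge0 => k _ _; rewrite lee_fin.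
have mPhi : measurable_fun setT Phi.
  by apply: ge0_emeasurable_sum => [k x _ _|k _]; rewrite ?lee_fin //; exact: maE.
have iPhi : leb.-integrable tor Phi.
  apply/integrableP; split; first exact: measurable_funTS mPhi.
  under eq_integral do rewrite gee0_abs //.
  rewrite /Phi (@integral_nneseries _ _ R leb tor mT (fun k x => (a k x)%:E)); last 2 first.
  - by move=> k; exact: measurable_funTS (maE k).
  - by move=> k x _; rewrite lee_fin.
  apply: (@le_lt_trans _ _ ((pi *+ 2) * 2)%:E); last exact: ltry.
  have -> : (\sum_(0 <= k <oo) \int[leb]_(x in tor) (a k x)%:E =
      \sum_(0 <= k <oo) (4 ^+ k * norm2 (D k))%:E)%E.
    apply: eq_eseriesr => k _.
    rewrite EFinM -EFin_norm2 //; under eq_integral do rewrite EFinM.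
    by rewrite integralZl //; case: (sD k).
  apply: nneseries_le => [k|n]; first by rewrite mulr_ge0 ?norm2_ge0 // exprn_ge0.
  apply: (@le_trans _ _ (\sum_(0 <= k < n) (pi *+ 2) * 2^-1 ^+ k)); last first.
    by rewrite -mulr_sumr ler_wpM2l ?(ltW two_pi_gt0) // sum_half_pow.
  apply: ler_sum => k _; apply: (le_trans (ler_wpM2l _ (D_small k))).
    by rewrite exprn_ge0.
  by rewrite mulrCA -exprMn; have -> : 4 * 8^-1 = 2^-1 :> R by lra.
pose A : set R := [set x | (Phi x < +oo)%E].
have mA : measurable A.
  by rewrite -[A]setTI; apply: emeasurable_fun_infty_o => //.
pose f k x : C := (\1_A x)%:C%C * psum c (N k) x.
have fA k x : A x -> f k x = psum c (N k) x.
  by move=> Ax; rewrite /f indicE mem_set // mul1r.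
have mf k : cmeasurable (f k).
  apply: cmeasurableM; last by case: (sqint_psum c (N k)).
  by apply: cmeasurable_real; exact: measurable_indic.
have f_cvg x : exists l, ccvg \oo (fun k => f k x) l.
  have [Ax|nAx] := pselect (A x); last first.
    exists 0; apply: near_eq_ccvg (ccvg_cst 0); apply: nearW => k.
    by rewrite /f indicE memNset // mul0r.
  pose B := fine (Phi x).
  have PhiB : Phi x = B%:E by rewrite /B fineK // ge0_fin_numE.
  have aB k : a k x <= B.
    rewrite -lee_fin -PhiB.
    have := @nneseries_lim_ge R (fun k => (a k x)%:E) xpredT 0%N k.+1.
    move=> /(_ (fun n _ _ => a0 n x)); apply: le_trans.
    rewrite big_nat_recr //= leeDr // sume_ge0 // => i _; rewrite lee_fin //.
  have B0 : 0 <= B by exact: le_trans (a0 0%N x) (aB 0%N).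
  have DB k : cmod (D k x) <= Num.sqrt B * 2^-1 ^+ k.
    rewrite -(@ler_pXn2r _ 2) ?nnegrE ?cmod_ge0 ?mulr_ge0 ?sqrtr_ge0 ?exprn_ge0 //.
    rewrite exprMn sqr_sqrtr // -exprM mulnC exprM exprVn -natrX /= exprVn.
    by rewrite ler_pdivlMr ?exprn_gt0 // mulrC; exact: aB.
  apply: cauchy_ccvg => e e0.
  have [j je] := half_pow_small e0 (mulr_ge0 (ler0n R 2) (sqrtr_ge0 B)).
  exists j => k jk; rewrite !fA // psumB ?N_le //; apply: le_trans je.
  have -> : trigsum c (index_iota (N j) (N k)) x = \sum_(j <= i < k) D i x.
    rewrite -{1}(subnKC jk) -{2}(subnKC jk); elim: (k - j)%N => [|i ih].
      by rewrite addn0 /index_iota subnn !big_geq // /trigsum big_nil.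
    rewrite addnS big_nat_recr ?leq_addr //= -ih /D /trigsum.
    by rewrite (big_cat_nat (n := N (j + i)%N)) //= N_le // leq_addr.
  apply: (le_trans (ler_cmod_sum _ _ _)).
  apply: (@le_trans _ _ (\sum_(j <= i < k) Num.sqrt B * 2^-1 ^+ i)).
    by apply: ler_sum => i _; exact: DB.
  rewrite -mulr_sumr -{1}[j]add0n big_addn.
  under eq_bigr do rewrite addnC exprD.
  rewrite -mulr_sumr mulrA mulrC [2 * _]mulrC -mulrA mulrCA [2 * _]mulrC mulrA.
  rewrite -[leLHS]mulrA [X in _ * X <= _]mulrC; apply: ler_wpM2l; first exact: sqrtr_ge0.
  by apply: ler_wpM2l; [rewrite exprn_ge0|exact: sum_half_pow].
have /choice[h hP] := f_cvg.
have mh : cmeasurable h by exact: (cmeasurable_lim mf hP).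
have ph : periodic h (pi *+ 2).
  move=> x; apply: ccvg_unique (hP (x + pi *+ 2)) _.
  have -> : (fun k => f k (x + pi *+ 2)) = (fun k => f k x); last exact: hP.
  have PhiE : Phi (x + pi *+ 2) = Phi x.
    by apply: eq_eseriesr => k _; rewrite /a /D trigsum_periodic.
  apply/funext => k; rewrite /f /psum trigsum_periodic; congr (_%:C%C * _).
  by rewrite !indicE; congr (nat_of_bool _)%:R; apply/idP/idP; rewrite !inE /A /= PhiE.
have aeA : {ae leb, forall x, tor x -> A x}.
  have := @integrable_ae _ _ R leb tor mT Phi iPhi.
  apply: filterS => x H tx; have := H tx; rewrite fin_numE => /andP[_ Py].
  by rewrite /A /= lt_neqAle Py leey.
have key M B : (forall N, \sum_(M <= j < N) cmod (c j) ^+ 2 <= B) ->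
    (\int[leb]_(x in tor) (cmod (h x - psum c M x) ^+ 2)%:E <= ((pi *+ 2) * B)%:E)%E.
  move=> cB; pose g k x := (cmod (f k x - psum c M x) ^+ 2)%:E.
  have mfM k : cmeasurable (fun x => f k x - psum c M x).
    by apply: cmeasurableB => //; case: (sqint_psum c M).
  have mg k : measurable_fun setT (g k).
    by apply/measurable_EFinP; exact: measurable_sqr_cmod.
  have := @fatou _ _ R leb tor mT g (fun k => measurable_funTS (mg k))
    (fun k x _ => sqr_ge0 _).
  have -> : (\int[leb]_(x in tor) limn_einf (g^~ x) =
      \int[leb]_(x in tor) (cmod (h x - psum c M x) ^+ 2)%:E)%E.
    apply: eq_integral => x _.
    have gcv : g^~ x @ \oo --> (cmod (h x - psum c M x) ^+ 2)%:E.
      apply: cvg_EFin; first exact: nearW.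
      rewrite /=; apply: cvgM; apply: ccvg_cmod; apply: ccvgB (hP x) (ccvg_cst _).
    by have [] := cvg_limn_einf_sup gcv.
  move/le_trans; apply.
  rewrite limn_einf_lim; apply: lime_le; first exact: is_cvg_einfs.
  exists M => // k /= Mk; apply: (@le_trans _ _ (\int[leb]_(x in tor) g k x)%E).
    by apply: ereal_inf_lbound; exists k => /=.
  have -> : (\int[leb]_(x in tor) g k x =
     \int[leb]_(x in tor) (cmod (trigsum c (index_iota M (N k)) x) ^+ 2)%:E)%E.
    apply: ge0_ae_eq_integral => //.
    - exact: measurable_funTS (mg k).
    - apply/measurable_EFinP; apply: measurable_funTS; apply: measurable_sqr_cmod.
      by case: (sqint_trigsum c (index_iota M (N k))).
    - by move=> x _; rewrite lee_fin sqr_ge0.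
    - by move=> x _; rewrite lee_fin sqr_ge0.
    apply: filterS aeA => x Ax tx; rewrite /g fA; last exact: Ax.
    by rewrite psumB // (leq_trans Mk) // kN.
  rewrite EFin_norm2; last exact: sqint_trigsum.
  by rewrite lee_fin norm2_trigsum ?iota_uniq // ler_wpM2l ?(ltW two_pi_gt0).
have sh : sqint h.
  split => //; apply/integrableP; split.
    apply/measurable_EFinP; apply: measurable_funTS; exact: measurable_sqr_cmod.
  have := key 0%N E (fun n => ell2_range 0 n cE) => /le_lt_trans /(_ (ltry _)).
  apply: le_lt_trans; rewrite le_eqVlt; apply/orP; left; apply/eqP.
  apply: eq_integral => x _.
  by rewrite /psum /trigsum /index_iota subn0 big_nil subr0 gee0_abs // lee_fin sqr_ge0.
exists h; split => // M B cB.
rewrite -lee_fin -EFin_norm2; first exact: key.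
by apply: sqintB => //; exact: sqint_psum.
Qed.

End RieszFischer.

(** * Uniqueness of Fourier coefficients *)

Section FourierUniqueness.
Context {R : realType}.
Local Notation C := R[i].
Local Notation leb := (@lebesgue_measure R).
Local Notation tor := (@torus R).
Implicit Types (g T : R -> C).

(** The class of these [T] is stable under multiplication by trigonometric
    polynomials because all the coefficients of [g * T] vanish, and not only its
    mean. *)
Definition annihilates g T : Prop := [/\ cmeasurable T,
  exists B : R, forall x, cmod (T x) <= B &
  forall n, cint tor (fun x => g x * T x * expi n x) = 0].

Lemma cintegrable_mul_bounded g T (B : R) : cmeasurable g -> cintegrable tor g ->
  cmeasurable T -> (forall x, cmod (T x) <= B) -> cintegrable tor (fun x => g x * T x).
Proof.
move=> mg ig mT TB; have mtor := @measurable_torus R.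
apply: (@cintegrable_le _ _ _ (fun x => B * cmod (g x))) => //.
- exact: cmeasurableM.
- by move=> x _; rewrite cmodM mulrC ler_wpM2r ?cmod_ge0.
- by apply: integrableZ_torus; exact: cintegrable_cmod.
Qed.

Section Algebra.
Variable g : R -> C.
Hypotheses (mg : cmeasurable g) (ig : cintegrable tor g).

Let int_term T n : annihilates g T -> cintegrable tor (fun x => g x * T x * expi n x).
Proof.
move=> [mT [B TB] _].
apply: (@cintegrable_mul_bounded _ _ 1) => //.
- exact: cmeasurableM.
- exact: (@cintegrable_mul_bounded _ _ B).
- exact: cmeasurable_expi.
- by move=> x; rewrite cmod_expi.
Qed.

Lemma annihilates1 : (forall n, fourier g n = 0) -> annihilates g (fun=> 1).
Proof.
move=> g0; split; [exact: cmeasurable_cst|by exists 1 => _; rewrite cmod1|move=> n].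
under eq_cint do rewrite mulr1.
by rewrite -[n]opprK cint_fourier g0 mulr0.
Qed.

Lemma annihilatesB S T : annihilates g S -> annihilates g T ->
  annihilates g (fun x => S x - T x).
Proof.
move=> hS hT; have [mS [A SA] S0] := hS; have [mT [B TB] T0] := hT.
split; first exact: cmeasurableB.
  by exists (A + B) => x; rewrite (le_trans (ler_cmodB _ _)) // lerD.
move=> n; have E x : g x * (S x - T x) * expi n x =
  g x * S x * expi n x - g x * T x * expi n x by ring.
under eq_cint do rewrite E.
by rewrite cintB ?S0 ?T0 ?subrr //; [exact: measurable_torus|exact: int_term|exact: int_term].
Qed.

Lemma annihilates_cos (A B c : C) T : annihilates g T ->
  annihilates g (fun x => T x * (A + B * expi 1 x + c * expi (-1) x)).
Proof.
move=> hT; have [mT [b Tb] T0] := hT; have mtor := @measurable_torus R.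
split.
- apply: cmeasurableM => //; apply: cmeasurableD; first apply: cmeasurableD.
  + exact: cmeasurable_cst.
  + by apply: cmeasurableM; [exact: cmeasurable_cst|exact: cmeasurable_expi].
  + by apply: cmeasurableM; [exact: cmeasurable_cst|exact: cmeasurable_expi].
- exists (b * (cmod A + cmod B + cmod c)) => x.
  rewrite cmodM ler_pM ?cmod_ge0 //.
  apply: (le_trans (ler_cmodD _ _)); apply: lerD; last by rewrite cmodM cmod_expi mulr1.
  by apply: (le_trans (ler_cmodD _ _)); rewrite lerD2l cmodM cmod_expi mulr1.
- move=> n; have E x : g x * (T x * (A + B * expi 1 x + c * expi (-1) x)) * expi n x =
    A * (g x * T x * expi n x) + B * (g x * T x * expi (1 + n) x) +
    c * (g x * T x * expi (-1 + n) x) by rewrite !expiD; ring.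
  under eq_cint do rewrite E.
  have iT k := int_term k hT.
  have iZ (z : C) k := cintegrableZ z mtor (iT k).
  rewrite cintD //; last exact: cintegrableD.
  by rewrite cintD // !cintZ // !T0 !mulr0 !addr0.
Qed.

Lemma annihilatesX (p : R -> C) T :
  (forall S, annihilates g S -> annihilates g (fun x => S x * p x)) ->
  annihilates g T -> forall k, annihilates g (fun x => T x * p x ^+ k).
Proof.
move=> hp hT; elim=> [|k ih].
  by under [X in annihilates _ X]eq_fun do rewrite expr0 mulr1.
by under [X in annihilates _ X]eq_fun do rewrite exprSr mulrA; exact: hp.
Qed.

End Algebra.

(** By the inequality of Bernoulli the left side is at least [1 - (2 * p) ^+ k].
    Together with [bernoulli_step_gt], polynomials in [p] converge boundedly to
    the indicator of [p < 1 / 2]. *)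
Lemma bernoulli_step_lt (p : R) : 0 <= p < 2^-1 ->
  (1 - p ^+ k) ^+ (2 ^ k) @[k --> \oo] --> (1 : R).
Proof.
move=> /andP[p0 p2].
have p21 : `|2 * p| < 1 by rewrite ger0_norm ?mulr_ge0 //; lra.
have cv : 1 - (2 * p) ^+ k @[k --> \oo] --> (1 : R).
  rewrite -[X in _ --> X]subr0; apply: cvgB; first exact: cvg_cst.
  exact: cvg_expr.
apply: (squeeze_cvgr _ cv (cvg_cst (1 : R))); apply: nearW => k.
have pk0 : 0 <= p ^+ k by rewrite exprn_ge0.
have pk1 : p ^+ k <= 1 by rewrite exprn_ile1 //; lra.
apply/andP; split; last by rewrite exprn_ile1 //; lra.
rewrite exprMn -natrX.
elim: (2 ^ k)%N => [|m ih]; first by rewrite mul0r subr0 expr0.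
rewrite exprS -natr1.
have q0 : 0 <= 1 - p ^+ k by lra.
apply: le_trans (ler_wpM2l q0 ih).
have := mulr_ge0 pk0 pk0; have : 0 <= m%:R :> R by [].
nra.
Qed.

(** The inequality of Bernoulli, in the form [(1 - q) ^+ m * (1 + m * q) <= 1]
    for [0 <= q <= 1]. *)
Lemma bernoulli_step_gt (p : R) : 2^-1 < p <= 1 ->
  (1 - p ^+ k) ^+ (2 ^ k) @[k --> \oo] --> (0 : R).
Proof.
move=> /andP[p2 p1]; have p0 : 0 < p by lra.
have cv : ((2 * p)^-1) ^+ k @[k --> \oo] --> (0 : R).
  apply: cvg_expr; rewrite ger0_norm ?invr_ge0 ?mulr_ge0 //; try lra.
  by rewrite invf_lt1 //; lra.
apply: (squeeze_cvgr _ (cvg_cst 0) cv); apply: nearW => k.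
have pk0 : 0 < p ^+ k by rewrite exprn_gt0.
have pk1 : p ^+ k <= 1 by rewrite exprn_ile1 //; lra.
have q0 : 0 <= 1 - p ^+ k by lra.
rewrite exprn_ge0 //=; rewrite exprVn exprMn -natrX.
set m := (2 ^ k)%N.
have m0 : 0 < m%:R :> R by rewrite ltr0n expn_gt0.
rewrite -[leRHS]mul1r ler_pdivlMr ?mulr_gt0 //.
have H : forall j : nat, (1 - p ^+ k) ^+ j * (1 + j%:R * p ^+ k) <= 1.
  elim=> [|j ih]; first by rewrite expr0 mul0r addr0 mul1r.
  apply: le_trans ih; rewrite exprSr -mulrA ler_wpM2l ?exprn_ge0 // -natr1.
  have : 0 <= j%:R :> R by []; nra.
apply: le_trans (H m); rewrite ler_wpM2l ?exprn_ge0 // lerDr //.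
Qed.

(** The cosine of the distance to the midpoint [b / 2] separates the arc from
    its complement. *)
Lemma cos_arc (b x : R) : 0 < b < pi *+ 2 -> 0 <= x <= pi *+ 2 ->
  [/\ 0 < x < b -> cos (b / 2) < cos (x - b / 2) &
      b < x < pi *+ 2 -> cos (x - b / 2) < cos (b / 2)].
Proof.
have pi2 : pi *+ 2 = 2 * pi :> R by ring.
rewrite pi2 => /andP[b0 b2] /andP[x0 x2]; have pi0 := pi_gt0 R.
have cosE (y : R) : cos y = cos `|y| by case: (ger0P y) => // _; rewrite cosN.
split=> /andP[h1 h2].
  rewrite [ltRHS]cosE ltr_cos ?in_itv /= ?normr_ge0 /=.
  - by rewrite ltr_norml; apply/andP; split; lra.
  - by rewrite ler_norml; apply/andP; split; lra.
  - by apply/andP; split; lra.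
have [xp|px] := leP (x - b / 2) pi.
  by rewrite ltr_cos ?in_itv /=; [lra|apply/andP; split; lra|apply/andP; split; lra].
have -> : cos (x - b / 2) = cos (pi *+ 2 - (x - b / 2)).
  by rewrite -[RHS]cosN opprB -(cosD2pi (x - b / 2 - pi *+ 2)) subrK.
rewrite pi2 ltr_cos ?in_itv /=; [lra|apply/andP; split; lra|apply/andP; split; lra].
Qed.

Lemma ae_neq (c : R) : {ae leb, forall x, x != c}.
Proof.
exists [set c]; split; [exact: measurable_set1|exact: lebesgue_measure_set1|].
by move=> x /=; case: eqP.
Qed.

(** The primitive of [f] is constant, and by Lebesgue differentiation its
    derivative is [f] almost everywhere. *)
Lemma ae_eq0_of_primitive (f : R -> R) : leb.-integrable tor (EFin \o f) ->
  (forall b, 0 < b < pi *+ 2 -> \int[leb]_(x in `[0, b]) f x = 0) ->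
  {ae leb, forall x, tor x -> f x = 0}.
Proof.
move=> fi f0; have mT := @measurable_torus R; pose ft := f \_ tor.
have ift : leb.-integrable setT (EFin \o ft).
  rewrite /ft -restrict_EFin; apply/integrable_restrict => //=.
  by rewrite setTI.
have lft : locally_integrable [set: R] ft by exact: integrable_locally.
have iy y : leb.-integrable [set` Interval (BLeft (0 : R)) (BRight y)] (EFin \o ft).
  by apply: integrableS ift => //; exact: measurable_itv.
have := FTC1 iy lft.
set F := (fun x => \int[leb]_(t in _) ft t).
have F0 b : 0 < b < pi *+ 2 -> F b = 0.
  move=> bb; rewrite -[RHS](f0 b bb); move/andP: bb => [b0 b2]; apply: eq_Rintegral => x.
  rewrite inE /= in_itv /= => /andP[x0 xb]; rewrite /ft patchE mem_set //.
  by rewrite /torus /= in_itv /= x0 (le_trans xb) // ltW.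
move=> FTC.
have n0 := ae_neq 0; have n2 := ae_neq (pi *+ 2).
apply: filterS3 FTC n0 n2 => x H x0 x2 tx.
move: (tx); rewrite /torus /= in_itv /= => /andP[h1 h2].
have {x0 h1}x0 : 0 < x by rewrite lt_neqAle eq_sym x0.
have {x2 h2}x2 : x < pi *+ 2 by rewrite lt_neqAle x2.
have [|_] := H _; first by rewrite /= lte_fin.
have -> : F^`()%classic x = 0; last first.
  by rewrite /ft patchE mem_set // => <-.
rewrite derive1E; have d0 : is_derive x 1 F 0.
  apply: is_derive_dist => e e0.
  exists (Num.min (x / 2) ((pi *+ 2 - x) / 2)).
    by rewrite lt_min !divr_gt0 // subr_gt0.
  move=> t; rewrite le_min => /andP[].
  move=> /ler_normlP[t1 t2] /ler_normlP[t3 t4].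
  rewrite !F0 ?x0 //; last by apply/andP; split; lra.
  by rewrite subrr mulr0 subrr normr0 mulr_ge0 // ltW.
by case: d0.
Qed.

(** The product of [g] with every trigonometric polynomial has mean zero.
    Polynomials in one cosine converge boundedly and almost everywhere to the
    indicator of an arc, so the integral of [g] over every arc from 0 is zero,
    and [ae_eq0_of_primitive] applies. *)
Theorem fourier_unique g : cmeasurable g -> cintegrable tor g ->
  (forall n, fourier g n = 0) -> {ae leb, forall x, tor x -> g x = 0}.
Proof.
move=> mg ig g0; have mT := @measurable_torus R.
have int0 b : 0 < b < pi *+ 2 -> cint `[0, b]%classic g = 0.
  move=> b02.
  (* By [cos_arc], [p < 1 / 2] inside the arc from 0 to [b] and [p > 1 / 2]
     outside. *)
  pose p x : R := 2^-1 + (cos (b / 2) - cos (x - b / 2)) / 4.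
  have p01 x : 0 <= p x <= 1.
    rewrite /p; have := cos_le1 (b / 2); have := cos_geN1 (b / 2).
    have := cos_le1 (x - b / 2); have := cos_geN1 (x - b / 2).
    by move=> *; apply/andP; split; lra.
  have pE x : (p x)%:C%C = (2^-1 + cos (b / 2) / 4)%:C%C +
      ((- 8^-1)%:C%C * cis (- (b / 2))) * expi 1 x +
      ((- 8^-1)%:C%C * cis (b / 2)) * expi (-1) x.
    rewrite /expi mul1r mulN1r; apply: complexP.
      rewrite !(ReD, ReM, ImM) /= /p cosB !cosN !sinN; lra.
    by rewrite !(ImD, ReM, ImM) /= !cosN !sinN; lra.
  have hp S : annihilates g S -> annihilates g (fun x => S x * (p x)%:C%C).
    by move=> hS; under [X in annihilates _ X]eq_fun do rewrite pE; exact: annihilates_cos.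
  pose q k x : R := (1 - p x ^+ k) ^+ (2 ^ k).
  have hq k : annihilates g (fun x => 1 * (1 - (p x)%:C%C ^+ k) ^+ (2 ^ k)).
    apply: (@annihilatesX g (fun x => 1 - (p x)%:C%C ^+ k) (fun=> 1)); last exact: annihilates1.
    move=> S hS; under [X in annihilates _ X]eq_fun do rewrite mulrBr mulr1.
    by apply: annihilatesB => //; exact: annihilatesX.
  have qE k x : 1 * (1 - (p x)%:C%C ^+ k) ^+ (2 ^ k) = (q k x)%:C%C.
    by rewrite mul1r /q rmorphXn rmorphB rmorphXn rmorph1.
  have q01 k x : `|q k x| <= 1.
    have /andP[h1 h2] := p01 x.
    have pk1 : p x ^+ k <= 1 by rewrite exprn_ile1.
    have pk0 : 0 <= p x ^+ k by rewrite exprn_ge0.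
    by rewrite ger0_norm /q ?exprn_ge0 ?exprn_ile1 ?subr_ge0 // gerBl.
  have mq k : cmeasurable (fun x => (q k x)%:C%C).
    by have [] := hq k; under eq_fun do rewrite qE.
  have cint0 k : cint tor (fun x => g x * (q k x)%:C%C) = 0.
    have [_ _ /(_ 0)] := hq k; under eq_cint => x _ do rewrite expi0 mulr1 qE.
    by [].
  have lim : ccvg \oo (fun k => cint tor (fun x => g x * (q k x)%:C%C))
      (cint tor (fun x => g x * (\1_(`[0, b]%classic) x)%:C%C)).
    apply: (@dominated_cint _ _ _ _ (fun x => cmod (g x))) => //.
    - by move=> k; exact: cmeasurableM.
    - apply: cmeasurableM => //; apply: cmeasurable_real; apply: measurable_indic.
      exact: measurable_itv.
    - have n0 := ae_neq 0; have n2 := ae_neq (pi *+ 2); have nb := ae_neq b.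
      apply: filterS3 n0 n2 nb => x x0 x2 xb tx.
      move: (tx); rewrite /torus /= in_itv /= => /andP[h1 h2].
      have {x0}x0 : 0 < x by rewrite lt_neqAle eq_sym x0.
      have {x2}x2 : x < pi *+ 2 by rewrite lt_neqAle x2.
      have tx' : 0 <= x <= pi *+ 2 by rewrite h1.
      have [lt1 lt2] := cos_arc b02 tx'; have /andP[p0 p1] := p01 x.
      have qcv : q k x @[k --> \oo] --> (\1_(`[0, b]%classic) x : R).
        rewrite indicE; case: (ltP x b) => xb'.
          rewrite (_ : x \in _ = true); last by rewrite mem_set //= in_itv /= h1 ltW.
          apply: bernoulli_step_lt; rewrite p0 /p /=.
          by have := lt1 _; rewrite x0 xb' => /(_ isT); lra.
        have {xb'}xb' : b < x by rewrite lt_neqAle eq_sym xb.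
        rewrite (_ : x \in _ = false); last first.
          by rewrite memNset //= in_itv /= (ltW x0) /= leNgt xb'.
        apply: bernoulli_step_gt; rewrite p1 /p andbT.
        by have := lt2 _; rewrite xb' x2 => /(_ isT); lra.
      apply: ccvgMl; split => //=; exact: cvg_cst.
    - exact: cintegrable_cmod.
    - by move=> k x _; rewrite cmodM cmod_real ler_piMr ?cmod_ge0.
  have cI : cint tor (fun x => g x * (\1_(`[0, b]%classic) x)%:C%C) = 0.
    apply: (ccvg_unique lim).
    by under [X in ccvg _ X _]eq_fun do rewrite cint0; exact: ccvg_cst.
  have subI : tor `&` `[0, b]%classic = `[0, b]%classic.
    apply/setIidr => x; rewrite /torus /= !in_itv /= => /andP[-> xb] /=.
    by case/andP: b02 => _ /ltW; exact: le_trans.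
  rewrite -cI /cint -{1 2}subI !Rintegral_mkcondr.
  by congr Complex; apply: eq_Rintegral => x _; rewrite patchE indicE;
    case: (x \in _); rewrite ?ReM ?ImM /= ?mulr1 ?mulr0 ?subr0 ?add0r.
have [gr gi] := ig.
have aer : {ae leb, forall x, tor x -> complex.Re (g x) = 0}.
  by apply: ae_eq0_of_primitive => // b b02; exact: (congr1 (@complex.Re R) (int0 b b02)).
have aei : {ae leb, forall x, tor x -> complex.Im (g x) = 0}.
  by apply: ae_eq0_of_primitive => // b b02; exact: (congr1 (@complex.Im R) (int0 b b02)).
apply: filterS2 aer aei => x h1 h2 tx; apply: complexP; [exact: h1|exact: h2].
Qed.

End FourierUniqueness.

(** * Expansion of Hardy functions *)

Section Parseval.
Context {R : realType}.
Local Notation C := R[i].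
Local Notation leb := (@lebesgue_measure R).
Local Notation tor := (@torus R).
Implicit Types (f h v : R -> C) (c : nat -> C).

Definition hardy_coef c (n : int) : C := if n is Posz j then c j else 0.

Definition fcoef f (j : nat) : C := fourier f j%:Z.

Definition hardy f : Prop := sqint f /\ forall k, fourier f (Negz k) = 0.

Lemma fourier_psum c M n :
  fourier (psum c M) n = hardy_coef (fun j => if (j < M)%N then c j else 0) n.
Proof.
rewrite /psum fourier_trigsum ?iota_uniq //.
by case: n => //= j; rewrite mem_index_iota.
Qed.

Lemma fourier_of_psum_cvg c h : sqint h ->
  norm2 (fun x => h x - psum c M x) @[M --> \oo] --> (0 : R) ->
  forall n, fourier h n = hardy_coef c n.
Proof.
move=> sh hc n; apply: (mulfI (@two_pi_neq0 R)); rewrite -cint_fourier.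
apply: ccvg_unique (ccvg_cint_norm2 (sqint_psum c) sh (sqint_expi (- n)) hc) _.
under [X in ccvg _ X _]eq_fun do rewrite cint_fourier.
apply: ccvgMl; under [X in ccvg _ X _]eq_fun do rewrite fourier_psum.
case: n => [j|j]; last exact: ccvg_cst.
by apply: near_eq_ccvg (ccvg_cst (c j)); exists j.+1 => // M /= ->.
Qed.

Lemma psum_cvg_of_tail c f (E : R) : ell2 c E ->
  (forall M (B : R), (forall N, \sum_(M <= j < N) cmod (c j) ^+ 2 <= B) ->
     norm2 (fun x => f x - psum c M x) <= (pi *+ 2) * B) ->
  norm2 (fun x => f x - psum c M x) @[M --> \oo] --> (0 : R).
Proof.
move=> cE H; apply/cvgrPdist_le => e e0.
have [M0 HM0] := ell2_tail cE (divr_gt0 e0 (@two_pi_gt0 R)).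
exists M0 => // M /= M0M; rewrite sub0r normrN ger0_norm ?norm2_ge0 //.
have := H M _ (fun N => HM0 M N M0M).
by rewrite mulrC divfK // gt_eqF // two_pi_gt0.
Qed.

Lemma hardy_exists c (E : R) : ell2 c E -> exists h : R -> C,
  [/\ periodic h (pi *+ 2), sqint h & forall n, fourier h n = hardy_coef c n].
Proof.
move=> cE; have [h [ph sh hB]] := riesz_fischer cE; exists h; split => //.
by apply: fourier_of_psum_cvg => //; exact: psum_cvg_of_tail hB.
Qed.

Lemma norm2_ae_eq f h : sqint f -> sqint h -> {ae leb, forall x, tor x -> f x = h x} ->
  norm2 f = norm2 h.
Proof.
move=> [mf fi] [mh hi] fh; have mT := @measurable_torus R.
rewrite /norm2 /Rintegral; congr fine; apply: ge0_ae_eq_integral => //.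
- by case/integrableP: fi.
- by case/integrableP: hi.
- by move=> x _; rewrite lee_fin sqr_ge0.
- by move=> x _; rewrite lee_fin sqr_ge0.
by apply: filterS fh => x fh tx; rewrite fh.
Qed.

Lemma fourierB f h n : cintegrable tor f -> cintegrable tor h ->
  cmeasurable f -> cmeasurable h ->
  fourier (fun x => f x - h x) n = fourier f n - fourier h n.
Proof.
move=> fi hi mf mh; rewrite !fourierE -mulrBr; congr (_ * _).
have iE (g : R -> C) : cintegrable tor g -> cmeasurable g ->
    cintegrable tor (fun x => g x * expi (- n) x).
  move=> ig mg; apply: (@cintegrable_mul_bounded _ _ _ 1) => //.
    exact: cmeasurable_expi.
  by move=> x; rewrite cmod_expi.
rewrite -cintB; [|exact: measurable_torus|exact: iE|exact: iE].
by apply: eq_cint => x _; rewrite mulrBl.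
Qed.

Lemma hardy_ell2 f : sqint f -> ell2 (fcoef f) (norm2 f / (pi *+ 2)).
Proof.
move=> sf N; rewrite ler_pdivlMr ?two_pi_gt0 // mulrC; exact: bessel.
Qed.

Lemma hardy_unique f h : sqint f -> sqint h -> (forall n, fourier f n = fourier h n) ->
  {ae leb, forall x, tor x -> f x = h x}.
Proof.
move=> sf sh fh; have sfh := sqintB sf sh.
have := @fourier_unique R _ sfh.1 (sqint_integrable sfh).
have H n : fourier (fun x => f x - h x) n = 0.
  by rewrite fourierB ?fh ?subrr //; [exact: sqint_integrable|exact: sqint_integrable|exact: sf.1|exact: sh.1].
move=> /(_ H); apply: filterS => x fhx tx; apply/eqP; rewrite -subr_eq0; apply/eqP; exact: fhx.
Qed.

(** By [hardy_unique], [f] agrees almost everywhere with the function that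
    [riesz_fischer] builds from the coefficients of [f]. *)
Lemma parseval_tail f M (B : R) : hardy f ->
  (forall N, \sum_(M <= j < N) cmod (fcoef f j) ^+ 2 <= B) ->
  norm2 (fun x => f x - psum (fcoef f) M x) <= (pi *+ 2) * B.
Proof.
move=> [sf f0] fB; have cE := hardy_ell2 sf.
have [h [ph sh hB]] := riesz_fischer cE.
have hc := fourier_of_psum_cvg sh (psum_cvg_of_tail cE hB).
have fh : {ae leb, forall x, tor x -> f x = h x}.
  by apply: hardy_unique => // n; rewrite hc; case: n => // k; rewrite f0.
rewrite (_ : norm2 _ = norm2 (fun x => h x - psum (fcoef f) M x)); first exact: hB.
apply: norm2_ae_eq; [by apply: sqintB => //; exact: sqint_psum|by apply: sqintB => //; exact: sqint_psum|].
by apply: filterS fh => x fh tx; rewrite fh.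
Qed.

Lemma parseval_cvg f : hardy f ->
  norm2 (fun x => f x - psum (fcoef f) M x) @[M --> \oo] --> (0 : R).
Proof.
move=> hf; apply: psum_cvg_of_tail (hardy_ell2 hf.1) _ => M B; exact: parseval_tail.
Qed.

Lemma norm2_le_ell2 f (E : R) : hardy f -> ell2 (fcoef f) E -> norm2 f <= (pi *+ 2) * E.
Proof.
move=> hf fE; have := @parseval_tail f 0 E hf (fun N => ell2_range 0 N fE).
rewrite (_ : (fun x => f x - psum _ 0 x) = f) //; apply/funext => x.
by rewrite /psum /trigsum /index_iota subn0 big_nil subr0.
Qed.

(** Only [f] is expanded; [v] enters through its pairings with exponentials and
    may have coefficients of both signs. *)
Lemma parseval_pairing f v : hardy f -> sqint v ->
  ccvg \oo (fun M => \sum_(0 <= j < M) fcoef f j * cint tor (fun x => expi j x * v x))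
    (cint tor (fun x => f x * v x)).
Proof.
move=> hf sv.
rewrite (_ : (fun M => \sum_(0 <= j < M) _) =
    (fun M => cint tor (fun x => psum (fcoef f) M x * v x))).
  exact: ccvg_cint_norm2 (sqint_psum (fcoef f)) hf.1 sv (parseval_cvg hf).
by apply/funext => M; rewrite cint_trigsum.
Qed.

(** Wave numbers of [f] are nonnegative, so only finitely many products
    contribute to each coefficient of the square. *)
Lemma fourier_sqr f n : hardy f ->
  fourier (fun x => f x ^+ 2) n = hardy_coef (sqcoef (fcoef f)) n.
Proof.
move=> hf; have [sf f0] := hf; apply: (mulfI (@two_pi_neq0 R)); rewrite -cint_fourier.
under eq_cint do rewrite expr2 -mulrA.
have sv : sqint (fun x => f x * expi (- n) x).
  by apply: (@sqint_mul_bounded _ _ _ 1) => //; [exact: cmeasurable_expi|move=> x; rewrite cmod_expi].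
apply: ccvg_unique (parseval_pairing hf sv) _.
have E (j : nat) : cint tor (fun x => expi j x * (f x * expi (- n) x)) =
    (pi *+ 2)%:C%C * fourier f (n - j%:Z).
  rewrite -cint_fourier; apply: eq_cint => x _.
  by rewrite opprB expiD; ring.
under [X in ccvg _ X _]eq_fun => M do under eq_bigr => j _ do rewrite E.
case: n {sv E} => [m|m]; last first.
  rewrite mulr0; apply: near_eq_ccvg (ccvg_cst 0); apply: nearW => M.
  apply: big1 => j _; rewrite (_ : Negz m - j%:Z = Negz (m + j)); last by rewrite !NegzE; lia.
  by rewrite f0 !mulr0.
apply: near_eq_ccvg (ccvg_cst _); exists m.+1 => // M /= mM.
rewrite (big_cat_nat (n := m.+1)) //= big_mkord [X in _ + X]big_nat_cond [X in _ + X]big1 ?addr0.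
  rewrite /sqcoef mulr_sumr; apply: eq_bigr => j _.
  rewrite mulrCA; congr (_ * (_ * _)); rewrite /fcoef; congr fourier.
  by rewrite subzn // -ltnS.
move=> j /andP[/andP[mj _] _].
rewrite (_ : m%:Z - j%:Z = Negz (j - m.+1)); last by rewrite NegzE; lia.
by rewrite f0 !mulr0.
Qed.

End Parseval.

(** * The nonlinearity as a function on the circle *)

Section InverseDerivative.
Context {R : realType}.
Local Notation C := R[i].
Local Notation tor := (@torus R).
Variables (a : nat -> C) (E : R).
Hypotheses (a0 : a 0%N = 0) (aE : ell2 a E).

(** At [m = 0] the inverse of 0 is 0, which normalizes the antiderivative to
    have zero mean. *)
Definition primcoef (b : nat -> C) (m : nat) : C := (Complex 0 m%:R)^-1 * sqcoef b m.

Lemma inv_imag (m : nat) : (Complex 0 m%:R)^-1 = Complex 0 (-1) * (m%:R)^-1 :> C.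
Proof.
have -> : Complex 0 m%:R = Complex 0 1 * m%:R :> C.
  by rewrite -(rmorph_nat (real_complex R)); apply: complexP; rewrite /=; ring.
rewrite invfM; congr (_ * _); apply: (@mulfI _ (Complex 0 1)).
  by rewrite eq_complex /= oner_eq0 andbF.
rewrite mulfV; first by apply: complexP; rewrite /=; ring.
by rewrite eq_complex /= oner_eq0 andbF.
Qed.

Lemma cmod_primcoef m : cmod (primcoef a m) = cmod (sqcoef a m) / m%:R.
Proof.
rewrite /primcoef cmodM cmodV mulrC; congr (_ / _).
by rewrite cmod_imag normr_nat.
Qed.

Lemma primcoef_summable n : \sum_(j < n) cmod (primcoef a j) <= 4 * E.
Proof.
under eq_bigr do rewrite cmod_primcoef; exact: sqcoef_hilbert.
Qed.

(** The antiderivative of [u ^+ 2] for [u] with coefficients [b]. The series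
    converges absolutely at every point by [sqcoef_hilbert], so it has a
    canonical representative, bounded and periodic. *)
Definition primitive_sqr (b : nat -> C) (x : R) : C :=
  xget 0 [set l | ccvg \oo (fun M => psum (primcoef b) M x) l].

Lemma cmod_psum_prim M x : cmod (psum (primcoef a) M x) <= 4 * E.
Proof.
apply: le_trans (primcoef_summable M).
rewrite -(big_mkord xpredT (fun j => cmod (primcoef a j))).
apply: (le_trans (ler_cmod_sum _ _ _)).
by apply: ler_sum => j _; rewrite cmodM cmod_expi mulr1.
Qed.

Lemma primitive_sqrP x : ccvg \oo (fun M => psum (primcoef a) M x) (primitive_sqr a x).
Proof.
apply: (@xgetPex _ (0 : C) [set l | ccvg \oo (fun M => psum (primcoef a) M x) l]).
apply: (@abs_summable_ccvg R (fun j => primcoef a j * expi j x) (4 * E)) => n.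
by under eq_bigr do rewrite cmodM cmod_expi mulr1; exact: primcoef_summable.
Qed.

Lemma cmod_primitive_sqr x : cmod (primitive_sqr a x) <= 4 * E.
Proof.
by apply: ccvg_cmod_le (primitive_sqrP x) _; apply: nearW => M; exact: cmod_psum_prim.
Qed.

Lemma cmeasurable_primitive_sqr : cmeasurable (primitive_sqr a).
Proof.
by apply: cmeasurable_lim primitive_sqrP => M; exact: (sqint_psum _ _).1.
Qed.

Lemma primitive_sqr_periodic : periodic (primitive_sqr a) (pi *+ 2).
Proof.
move=> x; apply: ccvg_unique (primitive_sqrP _) _.
by under [X in ccvg _ X _]eq_fun do rewrite /psum trigsum_periodic; exact: primitive_sqrP.
Qed.

Lemma sqint_primitive_sqr : sqint (primitive_sqr a).
Proof. exact: sqint_bounded cmeasurable_primitive_sqr cmod_primitive_sqr. Qed.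

Lemma fourier_primitive_sqr n : fourier (primitive_sqr a) n = hardy_coef (primcoef a) n.
Proof.
have mT := @measurable_torus R.
apply: (mulfI (@two_pi_neq0 R)); rewrite -cint_fourier.
have lim : ccvg \oo (fun M => cint tor (fun x => psum (primcoef a) M x * expi (- n) x))
    (cint tor (fun x => primitive_sqr a x * expi (- n) x)).
  apply: (@dominated_cint _ _ _ _ (fun=> 4 * E)) => //.
  - by move=> M; apply: cmeasurableM; [exact: (sqint_psum _ _).1|exact: cmeasurable_expi].
  - by apply: cmeasurableM; [exact: cmeasurable_primitive_sqr|exact: cmeasurable_expi].
  - apply: aeW => x _; apply: ccvgM (primitive_sqrP x) (ccvg_cst _).
  - exact: integrable_torus_cst.
  - by move=> M x _; rewrite cmodM cmod_expi mulr1; exact: cmod_psum_prim.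
apply: (ccvg_unique lim).
under [X in ccvg _ X _]eq_fun do rewrite cint_fourier fourier_psum.
apply: ccvgMl; case: n {lim} => [j|j]; last exact: ccvg_cst.
by apply: near_eq_ccvg (ccvg_cst (primcoef a j)); exists j.+1 => // M /= ->.
Qed.

Variable u : R -> C.
Hypotheses (hu : hardy u) (ua : fcoef u = a).

Lemma sqint_nonlinearity : sqint (fun x => (u x)^*%C * primitive_sqr a x).
Proof.
apply: (@sqint_mul_bounded _ _ _ (4 * E)).
- by apply: sqint_conj; exact: hu.1.
- exact: cmeasurable_primitive_sqr.
- exact: cmod_primitive_sqr.
Qed.

Lemma norm2_nonlinearity :
  norm2 (fun x => (u x)^*%C * primitive_sqr a x) <= (4 * E) ^+ 2 * ((pi *+ 2) * E).
Proof.
have [su _] := hu; have mT := @measurable_torus R.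
have uE : norm2 u <= pi *+ 2 * E by apply: norm2_le_ell2 => //; rewrite ua.
apply: le_trans (ler_wpM2l (sqr_ge0 _) uE); rewrite /norm2 -RintegralZl //; last exact: su.2.
apply: le_norm2.
- by apply: cmeasurableM; [apply: cmeasurable_conj; exact: su.1|exact: cmeasurable_primitive_sqr].
- move=> x _; rewrite cmodM cmod_conj exprMn mulrC ler_wpM2r ?sqr_ge0 //.
  rewrite ler_pXn2r ?nnegrE ?cmod_ge0 ?cmod_primitive_sqr //.
  exact: le_trans (cmod_ge0 _) (cmod_primitive_sqr 0).
- by apply: integrableZ_torus; exact: su.2.
Qed.

(** Expanding [u] in the pairing leaves the coefficients of [primitive_sqr a] at
    [n + j], and the sum is [cubic]. *)
Lemma fourier_nonlinearity (n : nat) :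
  fourier (fun x => (u x)^*%C * primitive_sqr a x) n = Complex 0 (-1) * cubic_inf a n.
Proof.
have [su _] := hu; have mT := @measurable_torus R.
apply: (mulfI (@two_pi_neq0 R)); rewrite -cint_fourier.
have sv : sqint (fun x => (primitive_sqr a x * expi (- n%:Z) x)^*%C).
  apply: sqint_conj; apply: (@sqint_mul_bounded _ _ _ 1).
  - exact: sqint_primitive_sqr.
  - exact: cmeasurable_expi.
  - by move=> x; rewrite cmod_expi.
have -> : cint tor (fun x => (u x)^*%C * primitive_sqr a x * expi (- n%:Z) x) =
    (cint tor (fun x => u x * (primitive_sqr a x * expi (- n%:Z) x)^*%C))^*%C.
  rewrite -cint_conj //; last exact: sqintM.
  by apply: eq_cint => x _; rewrite [RHS]conjM conjcK mulrA.
apply: ccvg_unique (ccvg_conj (parseval_pairing hu sv)) _.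
have E1 (j : nat) : cint tor (fun x => expi j x * (primitive_sqr a x * expi (- n%:Z) x)^*%C) =
    ((pi *+ 2)%:C%C * primcoef a (n + j))^*%C.
  have -> : cint tor (fun x => expi j x * (primitive_sqr a x * expi (- n%:Z) x)^*%C) =
    (cint tor (fun x => primitive_sqr a x * expi (- (n + j)%N%:Z) x))^*%C.
    rewrite -cint_conj //; last by apply: sqintM; [exact: sqint_primitive_sqr|exact: sqint_expi].
    apply: eq_cint => x _; rewrite !conjM !expi_conj !opprK PoszD expiD; ring.
  by rewrite cint_fourier fourier_primitive_sqr.
have E2 M : (\sum_(0 <= j < M) fcoef u j *
     cint tor (fun x => expi j x * (primitive_sqr a x * expi (- n%:Z) x)^*%C))^*%C =
   (pi *+ 2)%:C%C * (Complex 0 (-1) * cubic M a n).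
  rewrite conj_sum /cubic big_mkord !mulr_sumr; apply: eq_bigr => j _.
  by rewrite E1 [LHS]conjM conjcK ua /primcoef inv_imag; ring.
under [X in ccvg _ X _]eq_fun do rewrite E2.
by do 2 apply: ccvgMl; exact: cubic_infP.
Qed.

(** The nonlinearity is the product of a bounded and a square-integrable
    function, so it is square integrable, and the inequality of Bessel applies
    to its coefficients. *)
Lemma cubic_inf_ell2 : ell2 (cubic_inf a) (16 * E ^+ 3).
Proof.
move=> N; have := bessel N sqint_nonlinearity.
under eq_bigr do rewrite fourier_nonlinearity cmodM.
have -> : cmod (Complex 0 (-1) : C) = 1.
  by rewrite cmod_imag normrN normr1.
under eq_bigr do rewrite mul1r.
move=> /le_trans/(_ norm2_nonlinearity).
have -> : (4 * E) ^+ 2 * (pi *+ 2 * E) = (pi *+ 2) * (16 * E ^+ 3) by ring.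
by rewrite ler_pM2l // two_pi_gt0.
Qed.

End InverseDerivative.

(** * Lebesgue and Hardy classes *)

Section Lebesgue.
Context {R : realType}.
Local Notation C := R[i].
Local Notation leb := (@lebesgue_measure R).
Local Notation tor := (@torus R).
Local Notation mtor := (@torus_measure R).
Implicit Types (f g : R -> C) (p : \bar R).

Lemma integral_torus_measure (h : R -> R) : measurable_fun setT h -> (forall x, 0 <= h x) ->
  (\int[mtor]_x (h x)%:E = \int[leb]_(x in tor) (h x)%:E)%E.
Proof.
move=> mh h0; have mT := @measurable_torus R.
rewrite (@ge0_negligible_integral _ _ _ mtor setT (~` tor)) //; last 4 first.
- exact: measurableC.
- exact/measurable_EFinP.
- by move=> x _; rewrite lee_fin.
- by rewrite /torus_measure /= /mrestr setICl measure0.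
rewrite setTD setCK; apply: eq_measure_integral => A mA At.
by rewrite /torus_measure /= /mrestr setIidl.
Qed.

Lemma Lp_norm2E f : sqint f -> Lp_norm 2%:E f = (Num.sqrt (norm2 f))%:E.
Proof.
move=> [mf fi]; rewrite /Lp_norm unlock.
have H x : (`|(cmod (f x))%:E| `^ 2 = (cmod (f x) ^+ 2)%:E)%E.
  by rewrite abse_EFin ger0_norm ?cmod_ge0 // poweR_EFin powR_mulrn ?cmod_ge0.
under eq_integral do rewrite H.
rewrite integral_torus_measure; [|exact: measurable_sqr_cmod|by move=> x; exact: sqr_ge0].
have e : (\int[leb]_(x in tor) (cmod (f x) ^+ 2)%:E = (norm2 f)%:E)%E.
  by rewrite EFin_norm2.
by rewrite e poweR_EFin powR12_sqrt ?norm2_ge0.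
Qed.

Lemma sqint_Lp2 f : cmeasurable f -> (Lp_norm 2%:E f < +oo)%E -> sqint f.
Proof.
move=> mf; rewrite /Lp_norm unlock => fy; split => //; have mT := @measurable_torus R.
have ms := measurable_sqr_cmod mf.
have H x : (`|(cmod (f x))%:E| `^ 2 = (cmod (f x) ^+ 2)%:E)%E.
  by rewrite abse_EFin ger0_norm ?cmod_ge0 // poweR_EFin powR_mulrn ?cmod_ge0.
move: fy; under eq_integral do rewrite H.
rewrite integral_torus_measure; [|exact: ms|by move=> x; exact: sqr_ge0].
move=> fy; apply/integrableP; split.
  by apply/measurable_EFinP; apply: measurable_funTS.
under eq_integral => x _ do rewrite abse_EFin ger0_norm ?sqr_ge0 //.
rewrite ltey; apply: contraTN fy => /eqP ->.
by rewrite poweRyr ?ltxx // invr_neq0.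
Qed.

Lemma Lp2P f : Lp 2%:E f <-> periodic f (pi *+ 2) /\ sqint f.
Proof.
split=> [[pf mf fy]|[pf sf]]; first by split => //; exact: sqint_Lp2.
by split; [exact: pf|exact: sf.1|rewrite Lp_norm2E // ltry].
Qed.

Lemma Lp_plus2P f : Lp_plus 2%:E f <->
  [/\ periodic f (pi *+ 2), hardy f & fourier f 0 = 0].
Proof.
split=> [[/Lp2P[pf sf] f0]|[pf [sf fn] f0]].
  by split => //; [split => // k|]; exact: f0.
split; first exact/Lp2P.
by case=> [[|n]|n] // _; exact: fn.
Qed.

Lemma Lp1_cintegrable f : periodic f (pi *+ 2) -> cmeasurable f -> cintegrable tor f ->
  Lp 1%E f.
Proof.
move=> pf mf fi; have mT := @measurable_torus R; split => //; rewrite /Lp_norm Lnorm1.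
under eq_integral do rewrite abse_EFin ger0_norm ?cmod_ge0 //.
rewrite integral_torus_measure; [|exact: measurable_cmod|by move=> x; exact: cmod_ge0].
have /integrableP[_] := cintegrable_cmod mT mf fi.
by under eq_integral do rewrite abse_EFin ger0_norm ?cmod_ge0 //.
Qed.

Lemma torus_measure_fin : mtor setT \is a fin_num.
Proof. by rewrite /torus_measure /= /mrestr setTI leb_torus. Qed.

(** The circle has finite measure, so the Lebesgue spaces are nested. *)
Lemma Lp_sqint p f : (2%:E < p)%E -> Lp p f -> sqint f.
Proof.
move=> p2 [pf mf fp]; apply: sqint_Lp2 => //.
have p1 : (1 <= p)%E by apply: le_trans (ltW p2); rewrite lee_fin ler1n.
have q1 : (1 <= 2%:E :> \bar R)%E by rewrite lee_fin ler1n.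
have mc : (fun x => cmod (f x)) \in @mfun _ _ (measurableTypeR R) R.
  by rewrite inE /=; exact: measurable_cmod.
have : (fun x => cmod (f x)) \in Lfun mtor 2%:E.
  apply: (Lfun_subset q1 p1 torus_measure_fin (ltW p2)).
  by apply/andP; split => //; rewrite inE.
by case/andP => _; rewrite inE.
Qed.

Lemma W1p_sqint p f g : (2%:E < p)%E -> W1p_plus p f g ->
  [/\ hardy f, hardy g, fourier f 0 = 0, fourier g 0 = 0 & torus_derivative f g].
Proof.
move=> p2 [[fp f0] [gp g0] fg]; split; [| |exact: f0|exact: g0|exact: fg].
  by split=> [|k]; [exact: Lp_sqint fp|exact: f0].
by split=> [|k]; [exact: Lp_sqint gp|exact: g0].
Qed.

End Lebesgue.

(** * Weak derivatives in space *)

Section TestFunctions.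
Context {R : realType}.
Local Notation C := R[i].
Local Notation tor := (@torus R).

(** For a fixed frequency this family is closed under differentiation; it
    contains the real and imaginary parts of exponentials, which are admissible
    as real test functions. *)
Definition harmonic (a A B y : R) : R := A * cos (a * y) + B * sin (a * y).

Lemma is_derive_harmonic (a A B x : R) :
  is_derive x 1 (harmonic a A B) (harmonic a (a * B) (- (a * A)) x).
Proof.
have d1 := is_deriveZ A (is_derive_cos_scale a x).
have d2 := is_deriveZ B (is_derive_sin_scale a x).
have := is_deriveD d1 d2; rewrite /GRing.scale /=.
rewrite (_ : _ + _ = harmonic a (a * B) (- (a * A)) x) //.
by rewrite /harmonic; ring.
Qed.

Lemma derive1_harmonic (a A B : R) :
  derive1 (harmonic a A B) = harmonic a (a * B) (- (a * A)).
Proof.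
by apply/funext => x; rewrite derive1E (@derive_val _ _ _ _ _ _ _ (is_derive_harmonic a A B x)).
Qed.

Lemma smooth_harmonic (a A B : R) : smooth (harmonic a A B).
Proof.
move=> k x; have [A' [B' ->]] : exists A' B', derive1n k (harmonic a A B) = harmonic a A' B'.
  elim: k => [|k [A' [B' ih]]]; first by exists A, B.
  by rewrite derive1nS ih derive1_harmonic; exists (a * B'), (- (a * A')).
exact: (@ex_derive _ _ _ _ _ _ _ (is_derive_harmonic a A' B' x)).
Qed.

Lemma harmonic_cis (a A B y : R) :
  harmonic a A B y = complex.Re ((Complex A (- B)) * cis (a * y)).
Proof. by rewrite /harmonic /cis /=; ring. Qed.

Lemma harmonic_periodic (n : nat) (A B : R) : periodic (harmonic n%:R A B) (pi *+ 2).
Proof.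
move=> x; rewrite !harmonic_cis; congr (complex.Re (_ * _)).
exact: (expi_periodic n%:Z x).
Qed.

(** The weak derivative is tested with the real and the imaginary part of [expi
    (- n)]. *)
Lemma fourier_derivative (f g : R -> C) (n : nat) : sqint f -> sqint g ->
  torus_derivative f g -> fourier g n = Complex 0 n%:R * fourier f n.
Proof.
move=> sf sg fg; apply: (mulfI (@two_pi_neq0 R)).
rewrite [RHS]mulrCA -!cint_fourier; have mT := @measurable_torus R.
have E (A B : R) := fg _ (@smooth_harmonic n%:R A B) (@harmonic_periodic n A B).
have sh (A B : R) : sqint (fun x => (harmonic n%:R A B x)%:C%C).
  apply: (@sqint_bounded _ _ (`|A| + `|B|)) => [|x].
    apply: cmeasurable_real; apply: continuous_measurable_fun => x.
    by apply/differentiable_continuous/derivable1_diffP;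
       exact: (@ex_derive _ _ _ _ _ _ _ (is_derive_harmonic n%:R A B x)).
  rewrite cmod_real; apply: (le_trans (ler_normD _ _)).
  rewrite !normrM; apply: lerD; rewrite ler_piMr //.
    by rewrite ler_norml cos_geN1 cos_le1.
  by rewrite ler_norml sin_geN1 sin_le1.
have e0 x : expi (- n%:Z) x = Complex (cos (n%:R * x)) (- sin (n%:R * x)) :> C.
  by rewrite /expi /cis mulrNz mulNr cosN sinN.
have expE x : expi (- n%:Z) x = (harmonic n%:R 1 0 x)%:C%C + Complex 0 1 * (harmonic n%:R 0 (-1) x)%:C%C :> C.
  rewrite e0 /harmonic; apply: complexP; rewrite /=; ring.
have dE x : (harmonic n%:R 0 (- n%:R) x)%:C%C + Complex 0 1 * (harmonic n%:R (- n%:R) 0 x)%:C%C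
   = - (Complex 0 n%:R * expi (- n%:Z) x) :> C.
  rewrite e0 /harmonic; apply: complexP; rewrite /=; ring.
have split2 (k : R -> C) (A B A' B' : R) : sqint k ->
   cint tor (fun x => k x * ((harmonic n%:R A B x)%:C%C + Complex 0 1 * (harmonic n%:R A' B' x)%:C%C)) =
   cint tor (fun x => k x * (harmonic n%:R A B x)%:C%C) +
   Complex 0 1 * cint tor (fun x => k x * (harmonic n%:R A' B' x)%:C%C).
  move=> sk; rewrite -cintZ //; last exact: sqintM.
  rewrite -cintD //; [|exact: sqintM|by apply: cintegrableZ => //; exact: sqintM].
  by apply: eq_cint => x _; ring.
under eq_cint do rewrite expE.
rewrite split2 //.
have := E 1 0; have := E 0 (-1); rewrite !derive1_harmonic.
rewrite !(mulr0, mulr1, oppr0, mulrN1, mulrN, opprK).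
move=> e1 e2; apply: oppr_inj; rewrite opprD -e2 -mulrN -e1 -split2 //.
under eq_cint do rewrite dE mulrN mulrCA -mulNr.
by rewrite cintZ //; [rewrite mulNr|apply: sqintM => //; exact: sqint_expi].
Qed.

End TestFunctions.

(** * Distributional derivatives in time *)

Section TimeDistributions.
Context {R : realType}.
Local Notation C := R[i].
Local Notation leb := (@lebesgue_measure R).
Implicit Types (a b : R -> C) (g : R -> R).

Lemma bounded_clocally_integrable a (B : R) : cmeasurable a ->
  (forall t, cmod (a t) <= B) -> clocally_integrable a.
Proof.
move=> [mr mi] aB.
have H (h : R -> R) : measurable_fun setT h -> (forall t, `|h t| <= B) ->
    locally_integrable setT h.
  move=> mh hB; split => //; first exact: openT.
  move=> K _ cK; have mK := compact_measurable cK.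
  have fK := compact_finite_measure cK.
  apply: (@le_lt_trans _ _ (\int[leb]_(x in K) (cst B%:E x))%E).
    apply: ge0_le_integral => //.
    - apply/measurable_EFinP; apply: measurableT_comp => //.
      exact: measurable_funS mh.
    - by move=> x _; rewrite lee_fin (le_trans _ (hB x)).
  rewrite integral_cst // lte_mul_pinfty // ?lee_fin //.
  exact: le_trans (normr_ge0 _) (hB 0).
by split; apply: H => // t; apply: le_trans (aB t); [exact: ler_Re_cmod|exact: ler_Im_cmod].
Qed.

Lemma smooth_derive g (x : R) : smooth g -> is_derive x 1 g (derive1 g x).
Proof. by move=> sg; rewrite derive1E; apply: derivableP; exact: (sg 0%N x). Qed.

Lemma smooth_continuous g : smooth g -> continuous g.
Proof.
by move=> sg x; apply/differentiable_continuous/derivable1_diffP; exact: (sg 0%N x).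
Qed.

Lemma smooth_derive1 g : smooth g -> smooth (derive1 g).
Proof. by move=> sg k x; have := sg k.+1 x; rewrite /derive1n iterSr. Qed.

Lemma test_derive1 g : test_function g -> test_function (derive1 g).
Proof.
move=> [sg [r gr]]; split; first exact: smooth_derive1.
exists r => t rt; rewrite derive1E.
have E : \forall s \near t, g s = cst 0 s.
  have : \forall s \near t, r < `|s|.
    exact: (@cvgr_gt _ _ _ _ (fun s : R => `|s|) `|t| (@norm_continuous _ R t)).
  by apply: filterS => s; exact: gr.
by rewrite (near_eq_derive _ E) derive_cst.
Qed.

Lemma test_function_bound g : test_function g -> exists (r B : R), [/\ 0 < r,
  forall t, r <= `|t| -> g t = 0 & forall t, `|g t| <= B].
Proof.
move=> [sg [r0 gr]]; pose r := `|r0| + 1.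
have r_gt0 : 0 < r by rewrite ltr_wpDl.
have rr : - r <= r by rewrite ge0_cp // ltW.
have cn : {within `[- r, r], continuous (fun x => `|g x|)}.
  apply: continuous_subspaceT => x.
  by apply: (@continuous_comp _ _ _ g (fun y : R => `|y|)); [exact: smooth_continuous|exact: norm_continuous].
have [c _ gc] := EVT_max rr cn.
have g0 t : r <= `|t| -> g t = 0.
  by move=> rt; apply: gr; apply: lt_le_trans rt; rewrite (le_lt_trans (ler_norm _)) // ltrDl.
exists r, `|g c|; split => // t; have [tr|tr] := leP `|t| r.
  by apply: gc; rewrite in_itv /= -ler_norml.
by rewrite g0 ?normr0 // ltW.
Qed.

Lemma cint_support (D : set R) a : (forall x, ~ D x -> a x = 0) ->
  cint setT a = cint D a.
Proof.
move=> a0; rewrite /cint; apply: complexP; rewrite /= [RHS]Rintegral_mkcond; apply: eq_Rintegral => x _;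
  by rewrite patchE; case: ifPn => // /negP; rewrite inE => /a0 ->.
Qed.

Lemma integrable_itv_cst (r B : R) : leb.-integrable `[- r, r]%classic (EFin \o cst B).
Proof.
apply: measurable_bounded_integrable.
- exact: measurable_itv.
- by apply: compact_finite_measure; exact: segment_compact.
- exact: measurable_cst.
- exact: bounded_cst.
Qed.

Lemma cintegrable_itv_bounded (r B : R) a : cmeasurable a -> (forall t, cmod (a t) <= B) ->
  cintegrable `[- r, r]%classic a.
Proof.
move=> ma aB; apply: (@cintegrable_le _ _ _ (cst B)) => //.
exact: integrable_itv_cst.
Qed.

Lemma continuous_cmeasurable a : continuous (fun t => complex.Re (a t)) ->
  continuous (fun t => complex.Im (a t)) -> cmeasurable a.
Proof. by move=> cr ci; split; exact: continuous_measurable_fun. Qed.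

Lemma test_cmeasurable g : test_function g -> cmeasurable (fun t => (g t)%:C%C).
Proof.
move=> [sg _]; apply: cmeasurable_real; apply: continuous_measurable_fun.
exact: smooth_continuous.
Qed.

Lemma cderive_continuous a : (forall t, exists l, cderive a t l) ->
  continuous (fun t => complex.Re (a t)) /\ continuous (fun t => complex.Im (a t)).
Proof.
move=> da; split=> t; have [l [dr di]] := da t; apply/differentiable_continuous/derivable1_diffP;
  exact: ex_derive.
Qed.

(** The fundamental theorem of calculus for [a * g] on an interval outside of
    which the test function [g] and its derivative vanish. *)
Lemma distr_derivative_C1 a b (A B : R) : (forall t, cderive a t (b t)) ->
  continuous (fun t => complex.Re (b t)) -> continuous (fun t => complex.Im (b t)) ->
  (forall t, cmod (a t) <= A) -> (forall t, cmod (b t) <= B) ->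
  distr_derivative a b.
Proof.
move=> dab cbr cbi aA bB.
have [car cai] := cderive_continuous (fun t => ex_intro _ _ (dab t)).
have ma := continuous_cmeasurable car cai; have mb := continuous_cmeasurable cbr cbi.
split; [exact: bounded_clocally_integrable aA|exact: bounded_clocally_integrable bB|move=> g tg].
have tg' := test_derive1 tg.
have [r [G [r0 gr gG]]] := test_function_bound tg.
have [r' [G' [r'0 gr' gG']]] := test_function_bound tg'.
(* Beyond [s] both [g] and its derivative vanish. *)
pose s := r + r'.
have sr (t : R) : ~ `[- s, s]%classic t -> r <= `|t| /\ r' <= `|t|.
  rewrite /= in_itv /= -ler_norml => /negP; rewrite -ltNge /s => st; split; apply: ltW;
    apply: le_lt_trans st; lra.
rewrite (@cint_support `[- s, s]%classic) => [|t /sr[_ /gr' ->]]; last by rewrite mulr0.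
rewrite [in RHS](@cint_support `[- s, s]%classic) => [|t /sr[/gr -> _]]; last by rewrite mulr0.
have mS : measurable `[- s, s]%classic by exact: measurable_itv.
apply/eqP; rewrite -subr_eq0 opprK; apply/eqP.
rewrite -cintD //; last 2 first.
- apply: (@cintegrable_itv_bounded _ (A * G')); first by apply: cmeasurableM => //; exact: test_cmeasurable.
  by move=> t; rewrite cmodM cmod_real ler_pM ?cmod_ge0.
- apply: (@cintegrable_itv_bounded _ (B * G)); first by apply: cmeasurableM => //; exact: test_cmeasurable.
  by move=> t; rewrite cmodM cmod_real ler_pM ?cmod_ge0.
rewrite (@cint_cderive _ (fun t => a t * (g t)%:C%C)).
- rewrite !gr ?subrr ?mulr0 ?subrr // ?normrN ger0_norm /s ?lerDl ?ltW // addr_gt0 //.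
- by rewrite /s; lra.
- move=> t; have [dr di] := dab t; have dg := smooth_derive t tg.1; split.
  have -> : (fun s0 => complex.Re (a s0 * (g s0)%:C%C)) = (fun s0 => complex.Re (a s0)) * g.
    by apply/funext => y; rewrite ReM /= mulr0 subr0.
  apply: is_derive_eq (is_deriveM dr dg) _.
  by rewrite ReD !ReM /= /GRing.scale /=; ring.
- have -> : (fun s0 => complex.Im (a s0 * (g s0)%:C%C)) = (fun s0 => complex.Im (a s0)) * g.
    by apply/funext => y; rewrite ImM /= mulr0 add0r.
  apply: is_derive_eq (is_deriveM di dg) _.
  by rewrite ImD !ImM /= /GRing.scale /=; ring.
- move=> x; under eq_fun do rewrite ReD !ReM /= !mulr0 !subr0.
  apply: cvgD; apply: cvgM; [exact: car|exact: smooth_continuous tg'.1 _|exact: cbr|exact: smooth_continuous tg.1 _].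
- move=> x; under eq_fun do rewrite ImD !ImM /= !mulr0 !add0r.
  apply: cvgD; apply: cvgM; [exact: cai|exact: smooth_continuous tg'.1 _|exact: cbi|exact: smooth_continuous tg.1 _].
Qed.

Lemma test_pairing_lim (a : R -> C) (aN : nat -> R -> C) (A : R) g : test_function g ->
  (forall N, cmeasurable (aN N)) -> (forall t, ccvg \oo (fun N => aN N t) (a t)) ->
  (forall N t, cmod (aN N t) <= A) ->
  ccvg \oo (fun N => cint setT (fun t => aN N t * (g t)%:C%C))
    (cint setT (fun t => a t * (g t)%:C%C)).
Proof.
move=> tg mN lN aA; have [r [G [r0 gr gG]]] := test_function_bound tg.
have H (f : R -> C) : cint setT (fun t => f t * (g t)%:C%C) =
    cint `[- r, r]%classic (fun t => f t * (g t)%:C%C).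
  apply: cint_support => t; rewrite /= in_itv /= -ler_norml => /negP; rewrite -ltNge => /ltW/gr ->.
  by rewrite mulr0.
rewrite H; under [X in ccvg _ X _]eq_fun do rewrite H.
apply: (@dominated_cint _ _ _ _ (cst (A * G))).
- exact: measurable_itv.
- by move=> N; apply: cmeasurableM => //; exact: test_cmeasurable.
- by apply: cmeasurableM; [exact: cmeasurable_lim mN lN|exact: test_cmeasurable].
- by apply: aeW => t _; apply: ccvgM (lN t) (ccvg_cst _).
- exact: integrable_itv_cst.
- by move=> N t _; rewrite cmodM cmod_real ler_pM ?cmod_ge0.
Qed.

(** Dominated convergence on the support of the test function. *)
Lemma distr_derivative_lim a b (aN bN : nat -> R -> C) (A B : R) :
  (forall N, distr_derivative (aN N) (bN N)) ->
  (forall N, cmeasurable (aN N)) -> (forall N, cmeasurable (bN N)) ->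
  (forall t, ccvg \oo (fun N => aN N t) (a t)) -> (forall t, ccvg \oo (fun N => bN N t) (b t)) ->
  (forall N t, cmod (aN N t) <= A) -> (forall N t, cmod (bN N t) <= B) ->
  distr_derivative a b.
Proof.
move=> dN maN mbN la lb aA bB; split.
- apply: (@bounded_clocally_integrable _ A); first exact: cmeasurable_lim maN la.
  by move=> t; apply: ccvg_cmod_le (la t) _; exact: nearW.
- apply: (@bounded_clocally_integrable _ B); first exact: cmeasurable_lim mbN lb.
  by move=> t; apply: ccvg_cmod_le (lb t) _; exact: nearW.
move=> g tg; apply: ccvg_unique (test_pairing_lim (test_derive1 tg) maN la aA) _.
have E N : cint setT (fun t => aN N t * (derive1 g t)%:C%C) =
    - cint setT (fun t => bN N t * (g t)%:C%C).
  by have [_ _] := dN N; exact.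
under [X in ccvg _ X _]eq_fun do rewrite E.
apply: ccvgN; exact: test_pairing_lim tg mbN lb bB.
Qed.

End TimeDistributions.

(** * Approximation of paths by simple functions *)

Section SimpleApproximation.
Context {R : realType}.
Local Notation C := R[i].

(** A function that factors through a bounded measurable integer index is
    simple, whatever the value space is. *)
Lemma simple_valued_of_index {V : zmodType} (P : V -> Prop) (S : nat -> V) (idx : R -> nat) M :
  (forall i, P (S i)) -> (forall t, (idx t < M)%N) ->
  (forall i, measurable (idx @^-1` [set i])) ->
  simple_valued P (fun t => S (idx t)).
Proof.
move=> PS iM mi; split=> [t|| v]; first exact: PS.
  apply: (@sub_finite_set _ _ (S @` `I_M)).
    by move=> _ [t _ <-]; exists (idx t) => //; exact: iM.
  exact/finite_image/finite_II.
rewrite (_ : _ @^-1` _ = \bigcup_(i in `I_M `&` [set i | S i = v]) (idx @^-1` [set i])).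
  by apply: fin_bigcup_measurable => //; exact/finite_setIl/finite_II.
apply/seteqP; split => [t /= Sv|t [i [_ /= <-] <-] //].
by exists (idx t) => //; split => //=; exact: iM.
Qed.

(** Index 0 collects the times beyond [K]; index [j.+1] is the cell of length
    [d] that starts at [j * d - K]. *)
Definition time_index (d K t : R) : nat :=
  if `|t| <= K then (Num.truncn ((t + K) / d)).+1 else 0%N.

Definition time_node (d K : R) (i : nat) : R :=
  if i is j.+1 then j%:R * d - K else 0.

Lemma time_index_bound d K : 0 < d -> exists M, forall t, (time_index d K t < M)%N.
Proof.
move=> d0; exists (Num.truncn (2 * K / d)).+2 => t; rewrite /time_index; case: ifPn => // tK.
rewrite !ltnS; apply: le_truncn; rewrite ler_pM2r ?invr_gt0 //.
by move: tK; rewrite ler_norml => /andP[_ tK]; lra.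
Qed.

Lemma time_index_measurable d K i : 0 < d -> measurable (time_index d K @^-1` [set i]).
Proof.
move=> d0; case: i => [|j].
  rewrite (_ : _ @^-1` _ = ~` `[- K, K]%classic); first by apply: measurableC; exact: measurable_itv.
  apply/seteqP; split=> t /=; rewrite in_itv /= -ler_norml /time_index; case: (`|t| <= K) => //.
rewrite (_ : _ @^-1` _ = `[- K, K]%classic `&` `[j%:R * d - K, j.+1%:R * d - K[%classic).
  by apply: measurableI; exact: measurable_itv.
apply/seteqP; split=> t /=; rewrite !in_itv /= -ler_norml /time_index; case: ifPn => //.
- move=> tK [] <-; split => //.
  have /truncn_itv : 0 <= (t + K) / d.
    by rewrite divr_ge0 ?(ltW d0) //; move: tK; rewrite ler_norml => /andP[+ _]; lra.
  by rewrite ler_pdivlMr // ltr_pdivrMr //; lra.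
- move=> tK [_ jt]; congr _.+1; apply/truncn_def.
  by rewrite ler_pdivlMr // ltr_pdivrMr //; lra.
- by move=> tK [].
Qed.

Lemma time_node_dist d K t : 0 < d -> `|t| <= K -> `|t - time_node d K (time_index d K t)| <= d.
Proof.
move=> d0 tK; rewrite /time_index tK /time_node.
have /truncn_itv : 0 <= (t + K) / d.
  by rewrite divr_ge0 ?(ltW d0) //; move: tK; rewrite ler_norml => /andP[+ _]; lra.
rewrite ler_pdivlMr // ltr_pdivrMr // => H.
by rewrite ler_norml; lra.
Qed.

(** Uniform in time, but for one coordinate at a time: no continuity into l2 is
    asked for. *)
Definition coord_unif (F : R -> nat -> C) : Prop :=
  forall n (e : R), 0 < e -> exists2 d, 0 < d &
    forall s t, `|s - t| <= d -> cmod (F s n - F t n) <= e.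

Lemma mesh_exists F : coord_unif F -> exists d : nat -> R, forall k,
  0 < d k /\ forall s t n, (n < k)%N -> `|s - t| <= d k -> cmod (F s n - F t n) <= k.+1%:R^-1.
Proof.
move=> cF.
suff H k (e : R) : 0 < e -> exists d, 0 < d /\
    forall s t n, (n < k)%N -> `|s - t| <= d -> cmod (F s n - F t n) <= e.
  have /choice[d dP] : forall k, exists d, 0 < d /\ forall s t n, (n < k)%N -> `|s - t| <= d ->
      cmod (F s n - F t n) <= k.+1%:R^-1 by move=> k; apply: H; rewrite invr_gt0 ltr0Sn.
  by exists d.
move=> e0; elim: k => [|k [d [d0 dP]]]; first by exists 1.
have [d' d'0 d'P] := cF k e e0.
exists (Num.min d d'); split=> [|s t n]; first by rewrite lt_min d0.
rewrite ltnS leq_eqVlt le_min => /orP[/eqP -> | nk] /andP[sd sd']; [exact: d'P|exact: dP].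
Qed.

Definition truncate (k : nat) (a : nat -> C) (n : nat) : C := if (n < k)%N then a n else 0.

Lemma ell2_truncate k a (E : R) : ell2 a E -> ell2 (truncate k a) E.
Proof.
move=> aE N; apply: le_trans (aE N); apply: ler_sum => j _; rewrite /truncate.
by case: ifP => // _; rewrite cmod0 expr0n sqr_ge0.
Qed.

Definition sample (F : R -> nat -> C) (d : nat -> R) (k i : nat) : nat -> C :=
  truncate k (F (time_node (d k) k%:R i)).

(** Each of the first [k] coordinates is sampled within [1 / k.+1], which costs
    at most [1 / k.+1] in the sum of squares; the remaining coordinates form a
    tail of [F t]. *)
Lemma sample_cvg F (E : R) (d : nat -> R) t : (forall t, ell2 (F t) E) ->
  (forall k, 0 < d k /\ forall s t n, (n < k)%N -> `|s - t| <= d k ->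
     cmod (F s n - F t n) <= k.+1%:R^-1) ->
  forall e : R, 0 < e -> \forall k \near \oo,
   ell2 (fun n => F t n - sample F d k (time_index (d k) k%:R t) n) e.
Proof.
move=> FE dP e e0.
have [M0 HM0] := ell2_tail (FE t) (divr_gt0 e0 (ltr0Sn R 1)).
have [M1 _ HM1] := exists_nat_ge `|t|.
have [M2 M20 HM2] := exists_nat_ge (2 / e).
exists (M0 + M1 + M2)%N => // k /= kM N.
have kt : `|t| <= k%:R by apply: (le_trans HM1); rewrite ler_nat; lia.
have [dk0 dkP] := dP k; have tq := time_node_dist dk0 kt.
set q := time_node _ _ _ in tq; rewrite /sample -/q.
have H1 : \sum_(0 <= j < k) cmod (F t j - truncate k (F q) j) ^+ 2 <= e / 2.
  apply: (@le_trans _ _ (\sum_(0 <= j < k) (k.+1%:R^-1) ^+ 2)).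
    apply: ler_sum_nat => j /andP[_ jk]; rewrite /truncate jk.
    by rewrite ler_pXn2r ?nnegrE ?cmod_ge0 ?invr_ge0 ?ler0n // dkP.
  rewrite sumr_const_nat subn0 -[_ *+ k]mulr_natr expr2 -mulrA.
  apply: (@le_trans _ _ (k.+1%:R^-1)).
    rewrite ler_piMr ?invr_ge0 ?ler0n // ler_pdivrMl ?ltr0Sn // mulr1 ler_nat.
    by lia.
  rewrite -[e / 2]invrK lef_pV2 ?posrE ?ltr0Sn ?invr_gt0 ?divr_gt0 // invf_div.
  by apply: (le_trans HM2); rewrite ler_nat; lia.
have H2 : \sum_(k <= j < N) cmod (F t j - truncate k (F q) j) ^+ 2 <= e / 2.
  rewrite (eq_big_nat _ _ (F2 := fun j => cmod (F t j) ^+ 2)); last first.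
    by move=> j /andP[kj _]; rewrite /truncate ltnNge kj subr0.
  by apply: HM0; lia.
rewrite -(big_mkord xpredT (fun j => cmod (F t j - truncate k (F q) j) ^+ 2)).
rewrite [e](splitr e); have [kN|Nk] := leqP k N.
  by rewrite (big_cat_nat (n := k)) //=; exact: lerD.
apply: (@le_trans _ _ (e / 2)); last by rewrite lerDl divr_ge0 // ltW.
apply: le_trans H1; rewrite [leRHS](big_cat_nat (n := N)) //= ?(ltnW Nk) // lerDl.
by apply: sumr_ge0 => j _; exact: sqr_ge0.
Qed.

End SimpleApproximation.

(** * Sobolev norms of negative order *)

Section ErealLimit.
Context {R : realType} {T : Type} {F : set_system T} {FF : Filter F}.

Lemma ereal_cvg0 (h : T -> \bar R) : (forall x, 0 <= h x)%E ->
  (forall e : R, 0 < e -> \forall x \near F, (h x <= e%:E)%E) -> h x @[x --> F] --> 0%E.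
Proof.
move=> h0 hF; apply/fine_cvgP; split.
  by apply: filterS (hF 1 ltr01) => x hx; rewrite ge0_fin_numE // (le_lt_trans hx) // ltry.
apply/cvgrPdist_le => e e0; apply: filterS (hF e e0) => x hx.
rewrite /= sub0r normrN ger0_norm ?fine_ge0 //.
by rewrite -lee_fin fineK // ge0_fin_numE // (le_lt_trans hx) // ltry.
Qed.

End ErealLimit.

Section Sobolev.
Context {R : realType}.
Local Notation C := R[i].
Implicit Types (c : int -> C) (s : R).

Lemma Hs_norm_ge0 s c : (0 <= Hs_norm s c)%E.
Proof. exact: poweR_ge0. Qed.

Lemma Hs_norm_le s c (B : R) : 0 <= B ->
  (forall N, \sum_(1 <= n < N) (n%:R `^ (2 * s) * cmod (c n%:Z) ^+ 2) <= B ^+ 2) ->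
  (Hs_norm s c <= B%:E)%E.
Proof.
move=> B0 cB; have w0 (n : nat) : 0 <= n%:R `^ (2 * s) * cmod (c n%:Z) ^+ 2.
  by rewrite mulr_ge0 ?powR_ge0 ?sqr_ge0.
rewrite /Hs_norm; apply: (@le_trans _ _ ((B ^+ 2)%:E `^ 2^-1)%E).
  apply: gt0_ler_poweR => //.
  - by rewrite in_itv /= leey andbT; apply: nneseries_ge0 => n _ _; rewrite lee_fin.
  - by rewrite in_itv /= leey andbT lee_fin sqr_ge0.
  - exact: (nneseries_le w0 cB).
by rewrite poweR_EFin powR12_sqrt ?sqr_ge0 // sqrtr_sqr ger0_norm.
Qed.

Lemma powR_natV (n : nat) : (n%:R : R) `^ (2 * - 1) = (n%:R ^+ 2)^-1.
Proof. by rewrite mulrN mulr1 powRN powR_mulrn. Qed.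

(** One derivative costs a factor [n], which is the weight of H^(-1). *)
Lemma Hs_norm_dual_le c (a : nat -> C) (B : R) : 0 <= B -> ell2 a (B ^+ 2) ->
  (forall n, cmod (c n%:Z) <= n%:R * cmod (a n)) -> (Hs_norm (- 1) c <= B%:E)%E.
Proof.
move=> B0 aB ca; apply: Hs_norm_le => // N; apply: le_trans (ell2_range 1 N aB).
apply: ler_sum_nat => n /andP[n1 _]; rewrite powR_natV ler_pdivrMl ?exprn_gt0 ?ltr0n //.
by rewrite -exprMn ler_pXn2r ?nnegrE ?cmod_ge0 // mulr_ge0 ?cmod_ge0.
Qed.

Lemma weight_le1 s (n : nat) : 0 <= s -> (0 < n)%N -> n%:R `^ (2 * - s) <= 1.
Proof.
move=> s0 n0; rewrite mulrN powRN invf_le1 ?powR_gt0 ?ltr0n //.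
apply: (@le_trans _ _ ((1 : R) `^ (2 * s))); first by rewrite powR1.
apply: ge0_ler_powR; rewrite ?nnegrE ?ler1n ?mulr_ge0 //.
Qed.

Lemma weight_small s (e : R) : 0 < s -> 0 < e ->
  exists2 N0 : nat, (0 < N0)%N & forall n, (N0 <= n)%N -> n%:R `^ (2 * - s) <= e.
Proof.
move=> s0 e0; have s2 : 0 < 2 * s by rewrite mulr_gt0.
have [N0 N00 HN0] := exists_nat_ge (e^-1 `^ (2 * s)^-1); exists N0 => // n N0n.
have n0 : 0 < n%:R :> R by rewrite ltr0n (leq_trans N00).
rewrite mulrN powRN -[e]invrK lef_pV2 ?posrE ?invr_gt0 ?powR_gt0 //.
have -> : e^-1 = (e^-1 `^ (2 * s)^-1) `^ (2 * s).
  by rewrite -powRrM mulVf ?gt_eqF // powRr1 // invr_ge0 ltW.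
apply: ge0_ler_powR; rewrite ?nnegrE ?powR_ge0 ?(ltW s2) ?(ltW n0) //.
by apply: (le_trans HN0); rewrite ler_nat.
Qed.

(** The weight makes the high modes small uniformly over the ball of l2, and the
    finitely many others are continuous. *)
Lemma continuous_Hs_of_coords s (F : R -> nat -> C) (E : R) : 0 < s ->
  (forall t, F t 0%N = 0) -> (forall t, ell2 (F t) E) -> coord_unif F ->
  continuous_Hs_plus (- s) (fun t => hardy_coef (F t)).
Proof.
move=> s0 F0 FE cF; have E0 := ell2_ge0 (FE 0); split=> [t|t0].
  split=> [[[|n]|n] //= _|].
  apply: (@le_lt_trans _ _ (Num.sqrt E)%:E); last by rewrite ltry.
  apply: Hs_norm_le; rewrite ?sqrtr_ge0 // sqr_sqrtr // => N.
  apply: le_trans (ell2_range 1 N (FE t)); apply: ler_sum_nat => n /andP[n1 _].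
  by rewrite ler_piMl ?sqr_ge0 // weight_le1 // ltW.
apply: ereal_cvg0 => [t|e e0]; first exact: Hs_norm_ge0.
have dE t : ell2 (fun n => F t n - F t0 n) (4 * E).
  move=> N; apply: (@le_trans _ _ (\sum_(j < N) (2 * (cmod (F t j) ^+ 2 + cmod (F t0 j) ^+ 2)))).
    by apply: ler_sum => j _; have := sqr_cmodD_le (F t j) (- F t0 j); rewrite cmodN.
  rewrite -mulr_sumr big_split /=; have := FE t N; have := FE t0 N; lra.
have d0 : 0 < 4 * E + 1 by rewrite ltr_wpDl // mulr_ge0.
have e2 : 0 < e ^+ 2 / 2 by rewrite divr_gt0 // exprn_gt0.
have [N0 N00 HN0] := weight_small s0 (divr_gt0 e2 d0).
have Q : \forall t \near t0, \sum_(1 <= n < N0) cmod (F t n - F t0 n) ^+ 2 <= e ^+ 2 / 2.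
  have : \sum_(n <- index_iota 1 N0) cmod (F t n - F t0 n) ^+ 2 @[t --> t0] -->
         (\sum_(n <- index_iota 1 N0) (0 : R)).
    apply: cvg_sumr => n; apply/cvgrPdist_le => d d_gt0.
    have d1 : 0 < Num.min d 1 by rewrite lt_min d_gt0 ltr01.
    have [r r0 Fr] := cF n _ d1; near=> t.
    have : cmod (F t n - F t0 n) <= Num.min d 1.
      by apply: Fr; rewrite distrC; near: t; exact: cvgr_dist_le.
    rewrite le_min => /andP[Fd F1]; rewrite sub0r normrN ger0_norm ?sqr_ge0 //.
    by apply: le_trans Fd; rewrite expr2 ler_piMr ?cmod_ge0.
  rewrite big1 // => /cvgrPdist_le /(_ _ e2); apply: filterS => t.
  by rewrite sub0r normrN ger0_norm // sumr_ge0 // => n _; exact: sqr_ge0.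
apply: filterS Q => t Q; apply: Hs_norm_le; first exact: ltW.
move=> N.
have low M : (M <= N0)%N ->
    \sum_(1 <= n < M) (n%:R `^ (2 * - s) * cmod (F t n - F t0 n) ^+ 2) <= e ^+ 2 / 2.
  move=> MN0; have [M1|M1] := leqP M 1; first by rewrite big_geq // ltW.
  apply: le_trans Q; rewrite [leRHS](big_cat_nat (n := M)) //= ?(ltnW M1) //.
  apply: ler_wpDr; first by apply: sumr_ge0 => j _; exact: sqr_ge0.
  apply: ler_sum_nat => n /andP[n1 _]; rewrite ler_piMl ?sqr_ge0 // weight_le1 //.
  exact: ltW.
have [NN0|N0N] := leqP N N0.
  by apply: le_trans (low N NN0) _; rewrite [leRHS](splitr (e ^+ 2)) lerDl ltW.
rewrite (big_cat_nat (n := N0)) //= ?(ltnW N0N) // [leRHS](splitr (e ^+ 2)) lerD //.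
  exact: low.
apply: (@le_trans _ _ (\sum_(N0 <= n < N) (e ^+ 2 / 2 / (4 * E + 1) * cmod (F t n - F t0 n) ^+ 2))).
  by apply: ler_sum_nat => n /andP[n1 _]; rewrite ler_wpM2r ?sqr_ge0 // HN0.
rewrite -mulr_sumr -mulrA ler_piMr ?(ltW e2) // ler_pdivrMl // mulr1.
by apply: le_trans (ell2_range N0 N (dE t)) _; rewrite lerDl.
Unshelve. all: by end_near. Qed.

End Sobolev.

(** * From the coefficients to the weak formulation *)

Section Solution.
Context {R : realType}.
Local Notation C := R[i].
Local Notation tor := (@torus R).

Lemma cderiveZ (k : C) (f : R -> C) t l : cderive f t l -> cderive (fun s => k * f s) t (k * l).
Proof.
move=> [dr di]; split.
  have -> : (fun s => complex.Re (k * f s)) =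
     (complex.Re k \*: (fun s => complex.Re (f s))) - (complex.Im k \*: (fun s => complex.Im (f s))).
    by apply/funext => s; rewrite ReM.
  by apply: is_derive_eq (is_deriveB (is_deriveZ _ dr) (is_deriveZ _ di)) _; rewrite ReM.
have -> : (fun s => complex.Im (k * f s)) =
   (complex.Re k \*: (fun s => complex.Im (f s))) + (complex.Im k \*: (fun s => complex.Re (f s))).
  by apply/funext => s; rewrite ImM.
by apply: is_derive_eq (is_deriveD (is_deriveZ _ di) (is_deriveZ _ dr)) _; rewrite ImM.
Qed.

Lemma cderiveD (f g : R -> C) t l m : cderive f t l -> cderive g t m ->
  cderive (fun s => f s + g s) t (l + m).
Proof.
move=> [dr di] [er ei]; split.
  have -> : (fun s => complex.Re (f s + g s)) =
     (fun s => complex.Re (f s)) + (fun s => complex.Re (g s)).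
    by apply/funext => s; rewrite ReD.
  by apply: is_derive_eq (is_deriveD dr er) _; rewrite ReD.
have -> : (fun s => complex.Im (f s + g s)) =
   (fun s => complex.Im (f s)) + (fun s => complex.Im (g s)).
  by apply/funext => s; rewrite ImD.
by apply: is_derive_eq (is_deriveD di ei) _; rewrite ImD.
Qed.

Lemma cderive_sum (I : Type) (r : seq I) (f : I -> R -> C) t (l : I -> C) :
  (forall i, cderive (f i) t (l i)) ->
  cderive (fun s => \sum_(i <- r) f i s) t (\sum_(i <- r) l i).
Proof.
move=> fl; elim: r => [|i r ih].
  under [X in cderive X]eq_fun do rewrite big_nil.
  by rewrite big_nil; split; exact: is_derive_cst.
under [X in cderive X]eq_fun do rewrite big_cons.
by rewrite big_cons; exact: cderiveD.
Qed.

Lemma coord_unif_continuous (F : R -> nat -> C) n t : coord_unif F ->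
  ccvg (nbhs t) (fun s => F s n) (F t n).
Proof.
move=> cF; apply/ccvgP => e e0; have [d d0 Fd] := cF n e e0; near=> s.
by apply: Fd; rewrite distrC; near: s; exact: cvgr_dist_le.
Unshelve. all: by end_near. Qed.

Variables (c : R -> nat -> C) (E K : R).
Hypotheses (c0 : forall t, c t 0%N = 0) (cE : forall t, ell2 (c t) E).
Hypothesis cL : forall n s t, cmod (c t n - c s n) <= n%:R * K * `|t - s|.
Hypothesis cd : forall n t,
  cderive (fun s => c s n) t (Complex 0 n%:R * cubic_inf (c t) n).

Let G t n := cubic_inf (c t) n.

Lemma coord_unif_path : coord_unif c.
Proof.
move=> n e e0; pose L := `|n%:R * K| + 1; have L0 : 0 < L by rewrite ltr_wpDl.
exists (e / L); first exact: divr_gt0.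
move=> s t; rewrite ler_pdivlMr // mulrC => st; apply: le_trans st.
apply: (le_trans (cL n t s)); rewrite ler_wpM2r //.
by apply: (le_trans (ler_norm _)); rewrite lerDl.
Qed.

(** Each component of the nonlinearity is controlled by finitely many
    coordinates, by [cubic_inf_unif]. *)
Lemma coord_unif_nonlinearity : coord_unif G.
Proof.
move=> n e e0; have [J [d [d0 H]]] := cubic_inf_unif n (ell2_ge0 (cE 0)) e0.
suff [d' d'0 Hd'] : exists2 d', 0 < d' & forall s t, `|s - t| <= d' ->
    forall j, (j < J)%N -> cmod (c s j - c t j) <= d.
  by exists d' => // s t st; apply: H => //; exact: Hd'.
elim: J {H} => [|J [d1 d10 H1]]; first by exists 1.
have [d2 d20 H2] := coord_unif_path J d0.
exists (Num.min d1 d2); first by rewrite lt_min d10.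
move=> s t; rewrite le_min => /andP[st1 st2] j; rewrite ltnS leq_eqVlt => /orP[/eqP ->|].
  exact: H2.
exact: H1.
Qed.

Variable u : R -> R -> C.
Hypotheses (pu : forall t, periodic (u t) (pi *+ 2)) (su : forall t, sqint (u t)).
Hypothesis fu : forall t n, fourier (u t) n = hardy_coef (c t) n.

Lemma hardy_u t : hardy (u t).
Proof. by split=> [|k]; [exact: su|rewrite fu]. Qed.

Lemma fcoef_u t : fcoef (u t) = c t.
Proof. by apply/funext => n; rewrite /fcoef fu. Qed.

Lemma nonlinearity_ell2 t : ell2 (G t) (16 * E ^+ 3).
Proof. exact: (cubic_inf_ell2 (c0 t) (cE t) (hardy_u t) (fcoef_u t)). Qed.

Lemma Lp_plus_u t : Lp_plus 2%:E (u t).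
Proof.
by apply/Lp_plus2P; split; [exact: pu|exact: hardy_u|rewrite fu /=; exact: c0].
Qed.

Lemma inverse_derivative_u t :
  inverse_derivative (fun x => u t x ^+ 2) (primitive_sqr (c t)).
Proof.
have mT := @measurable_torus R; have hu := hardy_u t; have [mu _] := su t.
have fs n : fourier (fun x => u t x ^+ 2) n = hardy_coef (sqcoef (c t)) n.
  by rewrite fourier_sqr // fcoef_u.
have sw := sqint_primitive_sqr (c0 t) (cE t).
split.
- apply: Lp1_cintegrable.
  + by move=> x; rewrite pu.
  + by under eq_fun do rewrite expr2; exact: cmeasurableM.
  + by under [X in cintegrable _ X]eq_fun do rewrite expr2; exact: sqintM.
- by rewrite fs /= /sqcoef big_ord1 c0 mul0r.
- apply: Lp1_cintegrable; first exact: primitive_sqr_periodic (c0 t) (cE t).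
    exact: sw.1.
  exact: sqint_integrable.
- rewrite (fourier_primitive_sqr (c0 t) (cE t)) /= /primcoef.
  by rewrite /sqcoef big_ord1 c0 mul0r mulr0.
- move=> n _; rewrite (fourier_primitive_sqr (c0 t) (cE t)) fs.
  by case: n => [m|m] /=; rewrite ?mulr0.
Qed.

Lemma distr_derivative_coord n : distr_derivative (fun t => c t n) (fun t => Complex 0 n%:R * G t n).
Proof.
have cb (t : R) : ccvg (nbhs t) (fun s => Complex 0 n%:R * G s n) (Complex 0 n%:R * G t n).
  by apply: ccvgMl; exact: coord_unif_continuous coord_unif_nonlinearity.
apply: (@distr_derivative_C1 _ _ _ (Num.sqrt E) (cmod (Complex 0 n%:R : C) * Num.sqrt (16 * E ^+ 3))).
- by move=> t; exact: cd.
- by move=> t; exact: (cb t).1.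
- by move=> t; exact: (cb t).2.
- by move=> t; exact: ell2_coord.
- by move=> t; rewrite cmodM ler_wpM2l ?cmod_ge0 //; exact: ell2_coord (nonlinearity_ell2 t).
Qed.

Lemma cint_expi_conj (g : R -> C) n : sqint g ->
  cint tor (fun x => expi n x * (g x)^*%C) = ((pi *+ 2)%:C%C * fourier g n)^*%C.
Proof.
move=> sg; rewrite -cint_fourier -cint_conj; [|exact: measurable_torus|].
  by apply: eq_cint => x _; rewrite conjM expi_conj opprK mulrC.
by apply: sqintM => //; exact: sqint_expi.
Qed.

(** Both sides are limits of sums over the first [N] modes of the test function,
    for which the identity is the system of ordinary differential equations. The
    inequality of Bessel bounds these sums uniformly in [N] and in time, as
    [distr_derivative_lim] requires. *)
Lemma weak_formulation (phi phi_x : R -> C) : hardy phi -> hardy phi_x ->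
  (forall n, fcoef phi_x n = Complex 0 n%:R * fcoef phi n) ->
  distr_derivative
    (fun t => cint tor (fun x => (phi x)^*%C * u t x))
    (fun t => - Complex 0 1 * cint tor (fun x => (phi_x x)^*%C * ((u t x)^*%C * primitive_sqr (c t) x))).
Proof.
move=> hp hpx px; have mT := @measurable_torus R.
pose k (j : nat) : C := (pi *+ 2)%:C%C * (fcoef phi j)^*%C.
pose aN N t := \sum_(0 <= j < N) k j * c t j.
pose bN N t := \sum_(0 <= j < N) k j * (Complex 0 j%:R * G t j).
have ck j : cmod (k j) = (pi *+ 2) * cmod (fcoef phi j).
  by rewrite /k cmodM cmod_conj cmod_real ger0_norm // ltW // two_pi_gt0.
have mulle (x y : R) : x * y <= x ^+ 2 + y ^+ 2.
  by have := sqr_ge0 (x - y); rewrite sqrrB; have := sqr_ge0 x; have := sqr_ge0 y; lra.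
have aB N t : cmod (aN N t) <= (pi *+ 2) * (norm2 phi / (pi *+ 2) + E).
  apply: (le_trans (ler_cmod_sum _ _ _)).
  apply: (@le_trans _ _ (\sum_(0 <= j < N) (pi *+ 2) * (cmod (fcoef phi j) ^+ 2 + cmod (c t j) ^+ 2))).
    apply: ler_sum => j _; rewrite cmodM ck -mulrA; apply: ler_wpM2l => //; exact: ltW (@two_pi_gt0 R).
  rewrite -mulr_sumr; apply: ler_wpM2l; first exact: ltW (@two_pi_gt0 R).
  rewrite big_split /= lerD //.
    exact: ell2_range (hardy_ell2 hp.1).
  exact: ell2_range (cE t).
have bB N t : cmod (bN N t) <= (pi *+ 2) * (norm2 phi_x / (pi *+ 2) + 16 * E ^+ 3).
  apply: (le_trans (ler_cmod_sum _ _ _)).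
  apply: (@le_trans _ _ (\sum_(0 <= j < N) (pi *+ 2) * (cmod (fcoef phi_x j) ^+ 2 + cmod (G t j) ^+ 2))).
    apply: ler_sum => j _; rewrite cmodM ck cmodM -mulrA; apply: ler_wpM2l; first exact: ltW (@two_pi_gt0 R).
    by rewrite mulrA [_ * cmod (Complex _ _)]mulrC -cmodM -px.
  rewrite -mulr_sumr; apply: ler_wpM2l; first exact: ltW (@two_pi_gt0 R).
  rewrite big_split /= lerD //.
    exact: ell2_range (hardy_ell2 hpx.1).
  exact: ell2_range (nonlinearity_ell2 t).
have da N t : cderive (aN N) t (bN N t).
  by apply: cderive_sum => j; apply: cderiveZ; exact: cd.
have cb N t : ccvg (nbhs t) (bN N) (bN N t).
  apply: ccvg_sum => j; do 2 apply: ccvgMl.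
  exact: coord_unif_continuous coord_unif_nonlinearity.
have [ca] : (forall N, cmeasurable (aN N)) /\ (forall N, cmeasurable (bN N)).
  split=> N; apply: continuous_cmeasurable => t; try exact: (cb N t).1; try exact: (cb N t).2.
    exact: (cderive_continuous (fun s => ex_intro _ _ (da N s))).1.
  exact: (cderive_continuous (fun s => ex_intro _ _ (da N s))).2.
move=> mb; apply: distr_derivative_lim (ca) (mb) _ _ (aB) (bB).
- move=> N; apply: distr_derivative_C1 (da N) _ _ (aB N) (bB N).
    by move=> t; exact: (cb N t).1.
  by move=> t; exact: (cb N t).2.
- move=> t; rewrite (_ : cint tor _ = cint tor (fun x => u t x * (phi x)^*%C)); last first.
    by apply: eq_cint => x _; rewrite mulrC.
  apply: near_eq_ccvg (parseval_pairing (hardy_u t) (sqint_conj hp.1)); apply: nearW => N.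
  apply: eq_bigr => j _; rewrite fcoef_u (cint_expi_conj j%:Z hp.1).
  by rewrite conjM conjc_real [LHS]mulrC.
- move=> t.
  have sv : sqint (fun x => (u t x)^*%C * primitive_sqr (c t) x).
    by exact: (sqint_nonlinearity (c0 t) (cE t) (hardy_u t)).
  rewrite (_ : cint tor _ = (cint tor (fun x => phi_x x * ((u t x)^*%C * primitive_sqr (c t) x)^*%C))^*%C); last first.
    rewrite -cint_conj //; last by apply: sqintM; [exact: hpx.1|exact: sqint_conj].
    apply: eq_cint => x _; rewrite [RHS]conjM; congr (_ * _); by rewrite [RHS]conjcK.
  apply: near_eq_ccvg (ccvgMl (- Complex 0 1) (ccvg_conj (parseval_pairing hpx (sqint_conj sv)))).
  apply: nearW => N; rewrite conj_sum mulr_sumr; apply: eq_bigr => j _.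
  rewrite (cint_expi_conj j%:Z sv) (conjM (fcoef phi_x j)) conjcK px.
  rewrite (fourier_nonlinearity (c0 t) (cE t) (hardy_u t) (fcoef_u t)) (conjM (Complex 0 j%:R)) /k -/(G t j).
  have -> : (Complex 0 j%:R)^*%C = - Complex 0 j%:R :> C by apply: complexP; rewrite /= ?oppr0.
  have ii : Complex 0 1 * Complex 0 (-1) = 1 :> C by apply: complexP; rewrite /=; ring.
  rewrite -[LHS]mul1r -ii; ring.
Qed.

End Solution.

(** * Bochner spaces and the main result *)

Section Bochner.
Context {R : realType}.
Local Notation C := R[i].
Local Notation leb := (@lebesgue_measure R).
Local Notation tor := (@torus R).
Implicit Types (a : nat -> C) (F : R -> nat -> C).

Lemma Lp_plus_psum a M : a 0%N = 0 -> Lp_plus 2%:E (psum a M).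
Proof.
move=> a0; apply/Lp_plus2P; split.
- exact: trigsum_periodic.
- by split=> [|k]; [exact: sqint_psum|rewrite fourier_psum].
- by rewrite fourier_psum /= a0 if_same.
Qed.

Lemma Lp_norm2_le f (B : R) : 0 <= B -> hardy f -> ell2 (fcoef f) (B ^+ 2 / (pi *+ 2)) ->
  (Lp_norm 2%:E f <= B%:E)%E.
Proof.
move=> B0 hf fB; rewrite Lp_norm2E ?lee_fin; last exact: hf.1.
rewrite -(ger0_norm B0) -sqrtr_sqr ler_wsqrtr //.
by have := norm2_le_ell2 hf fB; rewrite mulrC divfK // gt_eqF // two_pi_gt0.
Qed.

(** The samples of [sample_cvg], as trigonometric polynomials, are simple and
    converge to [u t] for every [t]. *)
Lemma Linfty_L2 F (u : R -> R -> C) (E : R) : (forall t, F t 0%N = 0) ->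
  (forall t, ell2 (F t) E) -> coord_unif F ->
  (forall t, periodic (u t) (pi *+ 2)) -> (forall t, sqint (u t)) ->
  (forall t n, fourier (u t) n = hardy_coef (F t) n) ->
  Linfty (Lp_plus 2%:E) (Lp_norm 2%:E) u.
Proof.
move=> F0 FE cF pu su fu; have E0 := ell2_ge0 (FE 0); have P0 := @two_pi_gt0 R.
have hu t : hardy (u t) by split=> [|k]; [exact: su|rewrite fu].
have fcu t : fcoef (u t) = F t by apply/funext => n; rewrite /fcoef fu.
split.
- by move=> t; apply/Lp_plus2P; split; [exact: pu|exact: hu|rewrite fu; exact: F0].
- have [d dP] := mesh_exists cF.
  exists (fun k t => psum (sample F d k (time_index (d k) k%:R t)) k).
    move=> k; have [M MP] := time_index_bound k%:R (dP k).1.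
    apply: (simple_valued_of_index (M := M) (S := fun i => psum (sample F d k i) k)) MP _.
      by move=> i; apply: Lp_plus_psum; rewrite /sample /truncate; case: ifP.
    by move=> i; apply: time_index_measurable; exact: (dP k).1.
  apply: aeW => t; apply: ereal_cvg0 => [k|e e0]; first exact: Lnorm_ge0.
  have e'0 : 0 < e ^+ 2 / (pi *+ 2) by rewrite divr_gt0 // exprn_gt0.
  apply: filterS (sample_cvg t FE dP e'0) => k ek.
  set q := time_index _ _ _ in ek *.
  have sp := sqint_psum (sample F d k q) k.
  have fE n : fourier (u t - psum (sample F d k q) k) n =
      hardy_coef (fun j => F t j - sample F d k q j) n.
    rewrite fourierB ?fu ?fourier_psum; [|exact: sqint_integrable|exact: sqint_integrable|exact: (su t).1|exact: sp.1].
    case: n => [j|j] /=; last by rewrite subr0.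
    by rewrite /sample /truncate; case: (j < k)%N.
  apply: Lp_norm2_le; first exact: ltW.
    by split=> [|j]; [exact: sqintB|rewrite fE].
  by rewrite (_ : fcoef _ = fun j => F t j - sample F d k q j) //; apply/funext => j; rewrite /fcoef fE.
- exists (Num.sqrt ((pi *+ 2) * E)); apply: aeW => t; apply: Lp_norm2_le => //.
  rewrite sqr_sqrtr; last by rewrite mulr_ge0 // ltW.
  by rewrite fcu mulrC mulKf // gt_eqF.
Qed.

(** Multiplication of the coefficients by [i n] is an isometry from l2, on
    positive wave numbers, to H^(-1), so the samples of [F] give simple
    approximations of the derivative. *)
Lemma Linfty_dual F (E : R) : (forall t, ell2 (F t) E) -> coord_unif F ->
  Linfty (Hs_plus (- 1)) (Hs_norm (- 1))
    (fun t => hardy_coef (fun n => Complex 0 n%:R * F t n)).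
Proof.
move=> FE cF; have E0 := ell2_ge0 (FE 0).
have cj (j : nat) : cmod (Complex 0 j%:R : C) = j%:R.
  by rewrite cmod_imag normr_nat.
pose D (a : nat -> C) := hardy_coef (fun n => Complex 0 n%:R * a n).
have norm_le a (B : R) : 0 <= B -> ell2 a (B ^+ 2) ->
    (Hs_norm (- 1)%R (D a) <= B%:E)%E.
  by move=> B0 aB; apply: Hs_norm_dual_le aB _ => // n; rewrite /= cmodM cj.
have mem a (B : R) : ell2 a B -> Hs_plus (- 1) (D a).
  move=> aB; split=> [[[|n]|n] //= _|]; first by rewrite (_ : Complex 0 _ = 0) ?mul0r.
  apply: (@le_lt_trans _ _ (Num.sqrt B)%:E); last by rewrite ltry.
  by apply: norm_le; rewrite ?sqrtr_ge0 // sqr_sqrtr // (ell2_ge0 aB).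
split.
- by move=> t; exact: mem (FE t).
- have [d dP] := mesh_exists cF.
  exists (fun k t => hardy_coef (fun n => Complex 0 n%:R * sample F d k (time_index (d k) k%:R t) n)).
    move=> k; have [M MP] := time_index_bound k%:R (dP k).1.
    apply: (simple_valued_of_index (M := M)
       (S := fun i => hardy_coef (fun n => Complex 0 n%:R * sample F d k i n))) MP _.
      by move=> i; apply: (mem _ E); exact: ell2_truncate.
    by move=> i; apply: time_index_measurable; exact: (dP k).1.
  apply: aeW => t; apply: ereal_cvg0 => [k|e e0]; first exact: Hs_norm_ge0.
  have e'0 : 0 < e ^+ 2 by rewrite exprn_gt0.
  apply: filterS (sample_cvg t FE dP e'0) => k ek.
  rewrite (_ : _ - _ = hardy_coef (fun n => Complex 0 n%:R *
      (F t n - sample F d k (time_index (d k) k%:R t) n))).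
    by apply: norm_le => //; exact: ltW.
  by apply/funext => -[n|n]; rewrite !fctE /= ?mulrBr ?subr0.
- exists (Num.sqrt E); apply: aeW => t; apply: norm_le; rewrite ?sqrtr_ge0 //.
  by rewrite sqr_sqrtr.
Qed.

Lemma torus_ae_eq (f g : R -> C) : {ae leb, forall x, tor x -> f x = g x} ->
  f = g %[ae @torus_measure R].
Proof.
move=> [N [mN N0 fg]]; exists (N `&` tor `|` ~` tor); split.
- apply: measurableU; last by apply: measurableC; exact: measurable_torus.
  by apply: measurableI => //; exact: measurable_torus.
- rewrite /torus_measure /= /mrestr setIUl setICl setU0 -setIA setIid.
  apply/eqP; rewrite eq_le measure_ge0 andbT -N0; apply: le_measure; rewrite ?inE //.
  by apply: measurableI => //; exact: measurable_torus.
move=> x /= nfg; have [tx|tx] := pselect (tor x); last by right.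
by left; split => //; apply: fg => /= h; apply: nfg => _; exact: h.
Qed.

End Bochner.

Theorem theorem3 (R : realType) (f : R -> R[i]) :
  Lp_plus 2%:E f ->
  exists u : R -> R -> R[i],
    [/\ weak_solution u,
        (forall s : R, 0 < s <= 1 ->
           continuous_Hs_plus (- s) (fun t => fourier (u t))),
        u 0 = f %[ae @torus_measure R],
        Linfty (Lp_plus 2%:E) (Lp_norm 2%:E) u &
        exists2 v : R -> int -> R[i],
          Hs_time_derivative (fun t => fourier (u t)) v &
          Linfty (Hs_plus (- 1)) (Hs_norm (- 1)) v].
Proof.
move=> /Lp_plus2P[pf hf f0].
have [c [ci c0 cE cL cd]] := ode_exists f0 (hardy_ell2 hf.1).
have /choice[u uP] t := hardy_exists (cE t).
have pu t : periodic (u t) (pi *+ 2) by have [] := uP t.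
have su t : sqint (u t) by have [] := uP t.
have fu t n : fourier (u t) n = hardy_coef (c t) n by have [_ _] := uP t; exact.
have fuE : (fun t => fourier (u t)) = (fun t => hardy_coef (c t)).
  by apply/funext => t; apply/funext => n; exact: fu.
have cU := coord_unif_path cL.
have GU := coord_unif_nonlinearity cE cL.
have GE t := nonlinearity_ell2 c0 cE su fu t.
exists u; split.
- split; first exact (Lp_plus_u c0 pu su fu).
  exists (fun t => primitive_sqr (c t)); first exact (inverse_derivative_u c0 cE pu su fu).
  move=> p phi phi_x p2 /(W1p_sqint p2)[hp hpx _ _ pd].
  apply: (weak_formulation c0 cE cL cd su fu hp hpx) => n.
  exact: fourier_derivative hp.1 hpx.1 pd.
- by move=> s /andP[s0 _]; rewrite fuE; exact (continuous_Hs_of_coords s0 c0 cE cU).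
- apply: torus_ae_eq; apply: hardy_unique => //; first exact: hf.1.
  by move=> [n|n]; rewrite fu /= ?ci ?hf.2.
- exact (Linfty_L2 c0 cE cU pu su fu).
exists (fun t => hardy_coef (fun n => Complex 0 n%:R * cubic_inf (c t) n)).
  rewrite fuE => -[n|n] /=; first exact (distr_derivative_coord c0 cE cL cd su fu n).
  apply: (@distr_derivative_C1 _ _ _ 0 0) => t; rewrite ?cmod0 //; try exact: cvg_cst.
  by split; exact: is_derive_cst.
exact (Linfty_dual GE GU).
Qed.
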